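(* Let $b,\alpha\ge0$ and $1<p<\infty$ be such that $p\ge2(\alpha+2)$. Then $$\|\mathcal{H}_b\|_{A_\alpha^p\to A_\alpha^p}=B\Big(\frac{\alpha+2}{p},\,b+1-\frac{\alpha+2}{p}\Big).$$
   Context: $\mathbb{D}$ is the open unit disk in $\mathbb{C}$ and $dA$ is the normalized area measure on $\mathbb{D}$. For $0<p<\infty$ and $\alpha>-1$, the weighted Bergman space $A_\alpha^p$ is the space of analytic functions $f$ on $\mathbb{D}$ with $\|f\|_{A_\alpha^p}^p=(\alpha+1)\int_{\mathbb{D}}|f(z)|^p(1-|z|^2)^\alpha\,dA(z)<\infty$; $\|T\|_{A_\alpha^p\to A_\alpha^p}$ denotes the operator norm. For $b\ge0$ the generalized Hilbert operator $\mathcal{H}_b$ is defined on $f(z)=\sum_{k\ge0}a_kz^k$ by $$\mathcal{H}_b(f)(z)=\sum_{n=0}^\infty\Big(\sum_{k=0}^\infty\frac{\Gamma(n+b+1)\Gamma(n+k+1)}{\Gamma(n+1)\Gamma(n+k+b+2)}a_k\Big)z^n;$$ when $1<p<\infty$, $\alpha+2<p(b+1)$ and $f\in A_\alpha^p$, this is well defined and equals $\int_0^1\frac{f(t)(1-t)^b}{(1-tz)^{b+1}}\,dt$ for $z\in\mathbb{D}$. $B(s,t)=\int_0^1x^{s-1}(1-x)^{t-1}dx$ is the Beta function. *)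

(* Defs.v *)
From mathcomp Require Import all_boot all_order all_algebra.
From mathcomp Require Import all_classical all_reals all_analysis.
From mathcomp Require Import complex.

Set Implicit Arguments.
Unset Strict Implicit.
Unset Printing Implicit Defensive.

Import Order.TTheory GRing.Theory Num.Theory.
Import numFieldNormedType.Exports.
(* [normc : R[i] -> R] is the modulus; the norm [`|z|] of [R[i]] takes its
   values in [R[i]]. *)
Notation normc := ComplexField.Normc.normc.

Local Open Scope classical_set_scope.
Local Open Scope complex_scope.
Local Open Scope ring_scope.

Section special_functions.
Context {R : realType}.
Local Notation mu := (@lebesgue_measure R).

Definition Gamma (s : R) : R :=
  \int[mu]_(t in `]0, +oo[) (t `^ (s - 1) * expR (- t)).

Definition Beta (s t : R) : R :=
  \int[mu]_(x in `]0, 1[) (x `^ (s - 1) * (1 - x) `^ (t - 1)).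

End special_functions.

Section bergman.
Context {R : realType}.
Implicit Types (f : R[i] -> R[i]) (a : nat -> R[i]).

Definition unit_disk : set R[i] := [set z | normc z < 1].

(* Functions on the disk are represented by functions on [R[i]] whose values
   outside [unit_disk] are never used. The topology of the complex numbers is
   that of the numeric field [R[i]^o]. *)
Definition has_power_series f a : Prop :=
  forall z, unit_disk z ->
    series (fun k => a k * z ^+ k : R[i]^o) @ \oo --> (f z : R[i]^o).

Definition analytic_on_disk f : Prop := exists a, has_power_series f a.

Definition taylor_coef f : nat -> R[i] :=
  xget (fun=> 0) [set a | has_power_series f a].

(* Integral over the disk against dA = pi^-1 dx dy. *)
Definition disk_integral (g : R[i] -> \bar R) : \bar R :=
  ((pi^-1)%:E *
   \int[(lebesgue_measure \x lebesgue_measure)%E]_(w in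
     [set w : R * R | unit_disk (w.1 +i* w.2)]) g (w.1 +i* w.2))%E.

Definition bergman_norm (p alpha : R) f : \bar R :=
  (((alpha + 1)%:E *
    disk_integral (fun z =>
      (normc (f z) `^ p * (1 - normc z ^+ 2) `^ alpha)%:E)) `^ p^-1)%E.

Definition bergman (p alpha : R) : set (R[i] -> R[i]) :=
  [set f | analytic_on_disk f /\ (bergman_norm p alpha f < +oo)%E].

Definition bergman_opnorm (p alpha : R)
    (T : (R[i] -> R[i]) -> (R[i] -> R[i])) : \bar R :=
  ereal_sup [set bergman_norm p alpha (T f) | f in
    [set f | bergman p alpha f /\ (bergman_norm p alpha f <= 1)%E]].

End bergman.

Section hilbert_operator.
Context {R : realType}.
Implicit Types (f : R[i] -> R[i]) (b : R).

Definition hilbert_weight b (n k : nat) : R :=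
  (Gamma (n%:R + b + 1) * Gamma (n%:R + k%:R + 1)) /
  (Gamma (n%:R + 1) * Gamma (n%:R + k%:R + b + 2)).

Definition hilbert_coef_series b f (n : nat) : nat -> R[i]^o :=
  series (fun k => (hilbert_weight b n k)%:C * taylor_coef f k : R[i]^o).

Definition hilbert_coef b f (n : nat) : R[i] := limn (hilbert_coef_series b f n).

Definition hilbert_series b f (z : R[i]) : nat -> R[i]^o :=
  series (fun n => hilbert_coef b f n * z ^+ n : R[i]^o).

Definition hilbert_op b f : R[i] -> R[i] := fun z => limn (hilbert_series b f z).

(* [limn] is total, so convergence of the two series defining [hilbert_op] has
   to be stated separately. *)
Definition hilbert_op_well_defined b f : Prop :=
  (forall n, cvgn (hilbert_coef_series b f n)) /\
  (forall z, unit_disk z -> cvgn (hilbert_series b f z)).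

End hilbert_operator.

(* Main.v *)
(* For 0 < s < 1 put T_s f(z) = (1 - (1-s)z)^-1 f(s / (1 - (1-s)z)). Then
   H_b f is the integral over s of (1-s)^b T_s f, and a change of variables
   gives |T_s f| <= s^(gm-1) (1-s)^(-gm) |f| with gm = (alpha+2)/p as soon as
   p >= 2(alpha+2). Minkowski's inequality yields the upper bound
   B = Beta(gm, b+1-gm). Parseval and Hoelder give sum |a_k|/(k+1) <= C |f|,
   which justifies the integral formula and, applied to T_s f, gives the
   growth bound |f(1-u)| <= C u^(-gm) |f|.

   For the lower bound let ell(g) be the integral of g(1-u) u^(gm-1) over
   [tau, 1/2]. On functions that are nonnegative on [0, 1) one has
   ell(H_b g) >= B ell(g) - C |g|, with C independent of tau. If the norm were
   at most Lam < B, the map H_b / Lam would preserve the nonnegative part of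
   the unit ball, so the supremum of ell over it would be at most
   C / (B - Lam) for every tau. But a sum of J dyadic simple poles, normalized,
   makes ell at least of order J^(1 - 1/p). *)

From HB Require Import structures.
Require Import Defs.
From mathcomp Require Import all_boot all_order all_algebra.
From mathcomp Require Import all_classical all_reals all_analysis.
From mathcomp Require Import measurable_realfun complex.
From mathcomp Require Import cyclic separable cyclotomic.
From mathcomp Require Import ring lra.

Set Implicit Arguments.
Unset Strict Implicit.
Unset Printing Implicit Defensive.
Import Order.TTheory GRing.Theory Num.Theory.
Import numFieldNormedType.Exports.

Local Open Scope classical_set_scope.
Local Open Scope complex_scope.
Local Open Scope ring_scope.
Local Notation Re := complex.Re.
Local Notation Im := complex.Im.
#[local] Arguments ComplexField.Normc.normc : simpl never.

(** * Lebesgue measure on the plane *)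

(** [hilbert_op] is given by coefficients, so the integral over s is found by comparing Taylor
    coefficients: those of T_s applied to z^k are negative binomial terms, and their integrals
    against (1-s)^b are exactly the Gamma quotients. No path of integration is deformed inside the
    disk. Area integrals are treated without polar coordinates: substitutions are composed of affine
    maps, shears and the inversion 1/z, and means over circles become averages over roots of unity,
    for which Parseval's identity is exact on polynomials of low degree. Minkowski's inequality is
    Jensen's for the density s^(gm-1) (1-s)^(b-gm) / B; this density is proportional to the bound on
    (1-s)^b |T_s|, so the constant loses nothing. For the lower bound, the natural extremal
    (1-z)^(-gm) just fails to be in the space: the p-th power of its norm diverges logarithmically.
    This divergence is what makes the supremum of ell grow as tau tends to 0, while the error in the
    inequality for ell stays bounded. The cut-off tau keeps that supremum finite, hence
    subtractable. *)

Section product_measure.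
Context {R : realType}.
Local Notation mu := (@lebesgue_measure R).
Local Notation mu2 := (mu \x mu)%E.
Local Notation RT := (measurableTypeR R).
Local Notation T2 := (RT * RT)%type.
Local Notation T3 := (RT * (RT * RT))%type.

Lemma measurable_id3 : measurable_fun [set: T3] (fun x : T3 => (x.1, (x.2.1,x.2.2)) : (R * (R * R))%type).
Proof. apply/measurable_fun_pairP; split; first exact: measurable_fst.
apply/measurable_fun_pairP; split.
- by apply: (measurableT_comp (f := (fst : T2 -> RT)) (g := (snd : T3 -> T2)));
    [exact: measurable_fst | exact: measurable_snd].
- by apply: (measurableT_comp (f := (snd : T2 -> RT)) (g := (snd : T3 -> T2)));
    [exact: measurable_snd | exact: measurable_snd].
Qed.

Lemma sigma_finite_mu2 : sigma_finite [set: T2] mu2.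
Proof.
have /sigma_finiteP[F [TF ndF Foo]] := sigma_finiteT mu.
exists (fun n => F n `*` F n).
 rewrite -setXTT TF predeqE => -[x y]; split.
    move=> [/= [n _ Fnx] [k _ Gky]]; exists (maxn n k) => //; split.
    - by move: x Fnx; exact/subsetPset/ndF/leq_maxl.
    - by move: y Gky; exact/subsetPset/ndF/leq_maxr.
  by move=> [n _ []/= ? ?]; split; exists n.
move=> k; have [? ?] := Foo k.
split; first exact: measurableX.
by rewrite product_measure1E// lte_mul_pinfty// ge0_fin_numE.
Qed.

End product_measure.

Section leb2.
Context {R : realType}.
Local Notation mu := (@lebesgue_measure R).
Local Notation RT := (measurableTypeR R).

(** A named copy of the product measure that carries a sigma-finite instance, so that it can itself
    be a factor in Tonelli's theorem for three real variables. *)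
Definition leb2 : set (RT * RT)%type -> \bar R := (mu \x mu)%E.
HB.instance Definition _ := Measure.on leb2.
HB.instance Definition _ := Measure_isSigmaFinite.Build _ _ _ leb2 (@sigma_finite_mu2 R).
End leb2.

Section tonelli_affine.
Context {R : realType}.
Local Notation mu := (@lebesgue_measure R).
Local Notation RT := (measurableTypeR R).
Local Notation T2 := (RT * RT)%type.
Local Notation T3 := (RT * (RT * RT))%type.

Lemma leb2E (D : set (R * R)) (f : R * R -> \bar R) :
 (\int[(lebesgue_measure \x lebesgue_measure)%E]_(w in D) f w = \int[leb2]_(w in D) f w)%E.
Proof. by []. Qed.

Lemma tonelli3 (f : R * (R * R) -> \bar R) : measurable_fun setT f -> (forall w, 0 <= f w)%E ->
 (\int[mu]_s \int[leb2]_w f (s, w)  = \int[leb2]_w \int[mu]_s f (s,w))%E.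
Proof. move=> mf f0.
have := measurableT_comp mf measurable_id3.
pose g : T3 -> \bar R := fun x => f (x.1, (x.2.1, x.2.2)).
rewrite -/(g) => mg.
have -> : f = g by apply/funext => -[x [y z]].
have g0 w : (0 <= g w)%E by exact: f0.
exact: (@fubini_tonelli _ _ RT _ R mu leb2 g mg g0).
Qed.

Lemma tonelli1 (f : R * R -> \bar R) : measurable_fun setT f -> (forall w, 0 <= f w)%E ->
 (\int[leb2]_w f w = \int[mu]_x \int[mu]_y f (x,y))%E.
Proof. move=> mf f0. exact: fubini_tonelli1. Qed.

Lemma tonelli2 (f : R * R -> \bar R) : measurable_fun setT f -> (forall w, 0 <= f w)%E ->
 (\int[leb2]_w f w = \int[mu]_y \int[mu]_x f (x,y))%E.
Proof. move=> mf f0. exact: fubini_tonelli2. Qed.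

(** By uniqueness of Lebesgue measure it is enough to compare the two measures on the intervals ]a,
    b]. For [c < 0] the preimage is closed at the other end, with the same length. *)
Lemma leb_affine_pushforward (c d : R) (phi := (fun x : RT => c * x + d : R) : RT -> RT) (A : set RT) :
  c != 0 -> measurable A -> mu A = (`|c|%:E * mu (phi @^-1` A))%E.
Proof.
move=> c0 mA.
have mphi : measurable_fun setT phi.
  by apply: measurable_funD => //; exact: measurable_funM.
pose m0 := mscale (NngNum (normr_ge0 c)) (pushforward mu phi).
pose m := m0 mphi.
rewrite (@lebesgue_measure_unique R m)// => {mA A}_ [[a b]/= _ <-].
rewrite /m /m0 /mscale /= /pushforward.
have cp : 0 < `|c| by rewrite normr_gt0.
case: (ltgtP 0 c) c0 => // [cg|cl] _.
- have -> : phi @^-1` [set x | x \in `]a, b]] = [set` `](a - d) / c, (b - d) / c]].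
    apply/seteqP; split => x; rewrite /phi /= !in_itv/= ltr_pdivrMr// ler_pdivlMr//;
    by rewrite lerBrDr ltrBlDr mulrC.
  rewrite !lebesgue_measure_itv/= !lte_fin ltr_pM2r ?invr_gt0// ltrBlDr subrK gtr0_norm//.
  case: ifPn => ab; last by rewrite mule0.
  by rewrite -!EFinD -EFinM; congr EFin; field; rewrite gt_eqF.
- have -> : phi @^-1` [set x | x \in `]a, b]] = [set` `[(b - d) / c, (a - d) / c[].
    apply/seteqP; split => x; rewrite /phi /= !in_itv/= ltr_ndivlMr// ler_ndivrMr//;
    by rewrite lerBrDr ltrBlDr mulrC andbC.
  rewrite !lebesgue_measure_itv/= !lte_fin ltr_nM2r ?invr_lt0// ltrBlDr subrK ltr0_norm//.
  case: ifPn => ab; last by rewrite mule0.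
  by rewrite -!EFinD -EFinM; congr EFin; field; rewrite lt_eqF.
Qed.

Lemma integral_affine (c d : R) (f : R -> \bar R) : c != 0 ->
  measurable_fun setT f -> (forall x, 0 <= f x)%E ->
  (\int[mu]_x f x = `|c|%:E * \int[mu]_x f (c * x + d)%R)%E.
Proof.
move=> c0 mf f0.
pose phi := (fun x : RT => c * x + d : R) : RT -> RT.
have mphi : measurable_fun setT phi.
  by apply: measurable_funD => //; exact: measurable_funM.
pose m0 := mscale (NngNum (normr_ge0 c)) (pushforward mu phi).
pose m := m0 mphi.
rewrite (eq_measure_integral m); last first.
  by move=> A mA _; rewrite [LHS](leb_affine_pushforward d c0).
rewrite ge0_integral_mscale//; congr (_ * _)%E.
by rewrite ge0_integral_pushforward.
Qed.

End tonelli_affine.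

Section measurability.
Context {R : realType}.

(** The inverse is written x (x^2)^(-1) with a real power, which is measurable on the whole line; at
    0 both sides are 0. *)
Lemma measurable_funV d (T : measurableType d) (D : set T) (f : T -> R) :
  measurable_fun D f -> measurable_fun D (fun x => (f x)^-1).
Proof.
move=> mf.
have -> : (fun x => (f x)^-1) = (fun x => f x * (f x ^+ 2) `^ (-1)).
  apply/funext => x; rewrite powR_inv1 ?sqr_ge0//.
  by have [->|fx0] := eqVneq (f x) 0; [rewrite invr0 mul0r | field].
apply: measurable_funM => //.
exact: (measurableT_comp (@measurable_powR R (-1)) (measurable_funX 2 mf)).
Qed.

Lemma measurable_fun_powR d (T : measurableType d) (D : set T) (f : T -> R) a :
  measurable_fun D f -> measurable_fun D (fun x => f x `^ a).
Proof.
by move=> mf; exact: (measurableT_comp (@measurable_powR R a) mf).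
Qed.

Lemma measurable_fun_sqrt d (T : measurableType d) (D : set T) (f : T -> R) :
  measurable_fun D f -> measurable_fun D (fun x => Num.sqrt (f x)).
Proof.
move=> mf.
(* [Num.sqrt] vanishes on negative numbers, whence the maximum with 0. *)
have -> : (fun x => Num.sqrt (f x)) = (fun x => (Num.max (f x) 0) `^ 2^-1).
  apply/funext => x; rewrite powR12_sqrt ?le_max ?lexx ?orbT//.
  by case: (leP 0 (f x)) => // fx0; rewrite sqrtr0 ler0_sqrtr// ltW.
by apply: measurable_fun_powR; exact: measurable_maxr.
Qed.

End measurability.

(** Proves measurability by following the syntax of the integrand; compositions with an opaque
    function are left as goals. *)
Ltac mfun := repeat lazymatch goal with
  | |- measurable_fun _ (fun _ => if _ then _ else _) => apply: measurable_fun_ifT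
  | |- measurable_fun _ (fun _ => _ && _) => apply: measurable_and
  | |- measurable_fun _ (fun _ => (_ < _)%R) => apply: measurable_fun_ltr
  | |- measurable_fun _ (fun _ => (_ <= _)%R) => apply: measurable_fun_ler
  | |- measurable_fun _ (fun _ => (_ - _)%R) => apply: measurable_funB
  | |- measurable_fun _ (fun _ => (_ + _)%R) => apply: measurable_funD
  | |- measurable_fun _ (fun _ => (- _)%R) => apply: measurable_funN
  | |- measurable_fun _ (fun _ => (_ * _)%R) => apply: measurable_funM
  | |- measurable_fun _ (fun _ => (_ ^-1)%R) => apply: measurable_funV
  | |- measurable_fun _ (fun _ => (_ ^+ _)%R) => apply: measurable_funX
  | |- measurable_fun _ (fun _ => (_ `^ _)%R) => apply: measurable_fun_powR
  | |- measurable_fun _ (fun _ => (_ %:E)%E) => apply/measurable_EFinP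
  | |- measurable_fun _ (fun _ => (_ * _)%E) => apply: emeasurable_funM
  | |- measurable_fun _ _ => first [assumption | exact: measurable_cst | exact: measurable_id
     | exact: measurable_fst | exact: measurable_snd
  | exact: (measurableT_comp measurable_fst measurable_snd)
  | exact: (measurableT_comp measurable_snd measurable_snd)
  | apply: measurable_fun_ltr | apply: measurable_fun_ler | apply: measurable_funV
  | apply: measurable_funN | apply: measurable_funD | apply: measurable_funM
  | apply: measurable_fun_powR | apply: measurable_fun_sqrt | apply: measurable_maxr ]
 end.

(** * Substitutions on the line *)

Section line_substitutions.
Context {R : realType}.
Local Notation mu := (@lebesgue_measure R).
Local Notation RT := (measurableTypeR R).

Lemma measurable_RT d (U : measurableType d) (f : R -> U) :
  measurable_fun [set: R] f -> measurable_fun [set: RT] f.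
Proof. by []. Qed.

Lemma integral_scale (c : R) (f : R -> \bar R) : 0 < c ->
  measurable_fun setT f -> (forall x, 0 <= f x)%E ->
  (\int[mu]_x f x = c%:E * \int[mu]_x f (c * x)%R)%E.
Proof.
move=> c0 mf f0; rewrite (@integral_affine R c 0)// ?gt_eqF// gtr0_norm//.
by congr (_ * _)%E; apply: eq_integral => x _; rewrite addr0.
Qed.

Lemma integral_ltr_itv (a b : R) : a <= b ->
 (\int[mu]_x (if ((a < x) && (x < b))%R then 1 else 0) = (b - a)%:E)%E.
Proof.
move=> ab.
transitivity (\int[mu]_x (\1_(`]a, b[) x)%:E)%E.
  by apply: eq_integral => x _; rewrite indicE mem_setE in_itv/=; case: ifPn.
rewrite integral_indic// setIT [LHS]lebesgue_measure_itv/= lte_fin.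
case: ifPn => [_|]; first by rewrite EFinB.
by rewrite -leNgt => ba; rewrite (@le_anti _ _ a b) ?ab// subrr.
Qed.

(* Pair the integral with the unit mass of [y] on ]1, 2[, and use three times
   that [dx / x] is invariant under dilations. *)
Lemma integral_inv (f : R -> \bar R) :
  measurable_fun setT f -> (forall x, 0 <= f x)%E ->
  (\int[mu]_x (if (0 < x)%R then f (x^-1)%R * (x ^- 2)%:E else 0) =
   \int[mu]_x (if (0 < x)%R then f x else 0))%E.
Proof.
move=> mf f0.
pose K1 (w : R * R) : \bar R := if (0 < w.1) && ((1 < w.1 * w.2) && (w.1 * w.2 < 2))
   then (f (w.1^-1)%R * (w.1^-1)%:E)%E else 0%E.
pose K2 (w : R * R) : \bar R := if (0 < w.2) && ((1 < w.1) && (w.1 < 2))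
   then (f (w.2 * w.1^-1)%R * (w.1^-1)%:E)%E else 0%E.
have mK1 : measurable_fun setT K1.
  rewrite /K1; mfun. apply: (measurableT_comp mf); mfun.
have mK2 : measurable_fun setT K2.
  rewrite /K2; mfun. apply: (measurableT_comp mf); mfun.
have K10 w : (0 <= K1 w)%E.
  rewrite /K1; case: ifPn => // /andP[w0 _].
  by rewrite mule_ge0// lee_fin invr_ge0 ltW.
have K20 w : (0 <= K2 w)%E.
  rewrite /K2; case: ifPn => // /andP[_ /andP[w0 _]].
  by rewrite mule_ge0// lee_fin invr_ge0 ltW// (lt_trans _ w0).
transitivity (\int[mu]_x \int[mu]_y K1 (x, y))%E.
  apply: eq_integral => x _; rewrite /K1/=; case: ifPn => [x0|] /=; last first.
    by rewrite integral0.
  pose g (y : R) : \bar R := if (1 < y) && (y < 2) then 1%E else 0%E.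
  have mg : measurable_fun setT g by rewrite /g; mfun.
  have g0 (y : R) : (0 <= g y)%E by rewrite /g; case: ifP.
  have E1 : (\int[mu]_y g y = 1)%E by rewrite integral_ltr_itv ?ler1n// (_ : 2 - 1 = 1)%R//; lra.
  transitivity (\int[mu]_y (f (x^-1)%R * (x^-1)%:E * g (x * y)%R))%E.
    rewrite ge0_integralZl//; last 2 first.
    - by apply: measurable_RT; apply: (measurableT_comp mg); mfun.
    - by rewrite mule_ge0// lee_fin invr_ge0 ltW.
    move: E1; rewrite (integral_scale x0 mg g0) => /(congr1 (fun z => (x^-1)%:E * z)%E).
    rewrite muleA -EFinM mulVf ?gt_eqF// mul1e mule1 => ->.
    by rewrite -muleA -EFinM -expr2 exprVn.
  by apply: eq_integral => y _; rewrite /g; case: ifPn; rewrite ?mule1 ?mule0.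
rewrite -tonelli1// tonelli2//.
(* Replacing x by x / y turns the window 1 < x y < 2 into 1 < x < 2 and, with the Jacobian 1 / y,
   f(1/x) / x into f(y/x) / x. *)
transitivity (\int[mu]_y \int[mu]_x K2 (x, y))%E.
  apply: eq_integral => y _.
  have [y0|y0] := ltP 0 y; last first.
    rewrite [RHS]integral0_eq => [|x _]; last by rewrite /K2 /= (le_gtF y0).
    rewrite integral0_eq// => x _; rewrite /K1/=; case: ifPn => //= /and3P[x0 xy1 _].
    by have := lt_le_trans xy1 (mulr_ge0_le0 (ltW x0) y0); rewrite ltr10.
  have mK1y : measurable_fun [set: R] (fun x : R => K1 (x, y)).
    by apply: (measurableT_comp mK1); apply: measurable_fun_pair; mfun.
  have mK1y' : measurable_fun [set: R] (fun x : R => K1 (y^-1 * x, y)).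
    by apply: (measurableT_comp mK1); apply: measurable_fun_pair; mfun.
  have yV0 : 0 < y^-1 by rewrite invr_gt0.
  rewrite (integral_scale yV0 mK1y (fun x => K10 (x, y))).
  rewrite -(ge0_integralZl mu measurableT (measurable_RT mK1y') (fun x _ => K10 _)) ?lee_fin ?ltW//.
  apply: eq_integral => x _; rewrite /K1 /K2/=.
  rewrite invfM invrK pmulr_rgt0 ?invr_gt0// (mulrC y^-1 x) -mulrA mulVf ?gt_eqF// mulr1.
  case: (ltP 0 x) => x0; last first.
    by rewrite mule0 (lt_gtF (le_lt_trans x0 ltr01)) andbF.
  rewrite y0 /=; case: ifPn; rewrite ?mule0// => _.
  rewrite muleCA -EFinM; congr (_ * _%:E)%E.
  by rewrite mulrA mulVf ?gt_eqF// mul1r.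
rewrite -tonelli2// tonelli1//.
pose F (x : R) := (if (0 < x)%R then f x else 0)%E.
have mF : measurable_fun setT F by rewrite /F; mfun.
have F0 (x : R) : (0 <= F x)%E by rewrite /F; case: ifP.
(* Replacing y by x y separates the variables; the window in x has mass 1. *)
transitivity (\int[mu]_x (if ((1 < x) && (x < 2))%R then \int[mu]_y F y else 0))%E.
  apply: eq_integral => x _; case: ifPn => x12; last first.
    by rewrite integral0_eq// => y _; rewrite /K2 /= (negbTE x12) andbF.
  have x0 : 0 < x by case/andP: x12 => x1 _; exact: lt_trans x1.
  have mK2x : measurable_fun [set: R] (fun y : R => K2 (x, y)).
    by apply: (measurableT_comp mK2); apply: measurable_fun_pair; mfun.
  have mK2x' : measurable_fun [set: R] (fun y : R => K2 (x, x * y)).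
    by apply: (measurableT_comp mK2); apply: measurable_fun_pair; mfun.
  rewrite (integral_scale x0 mK2x (fun y => K20 (x, y))).
  rewrite -(ge0_integralZl mu measurableT (measurable_RT mK2x') (fun x _ => K20 _)) ?lee_fin ?ltW//.
  apply: eq_integral => y _; rewrite /K2 /= x12 andbT /F pmulr_rgt0//.
  case: ifPn; rewrite ?mule0// => y0.
  rewrite mulrAC mulfV ?gt_eqF// mul1r muleCA -EFinM.
  by rewrite mulfV ?gt_eqF// mule1.
transitivity (\int[mu]_x ((\int[mu]_y F y) * (if ((1 < x) && (x < 2))%R then 1 else 0)))%E.
  by apply: eq_integral => x _; case: ifP; rewrite ?mule1 ?mule0.
rewrite ge0_integralZl//; last 3 first.
- by mfun.
- by move=> x _; case: ifP.
- exact: integral_ge0.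
rewrite integral_ltr_itv ?ler1n// (_ : 2 - 1 = 1)%R; last by lra.
by rewrite mule1.
Qed.

End line_substitutions.

(** * Substitutions in the plane *)

Section plane_substitutions.
Context {R : realType}.
Local Notation mu := (@lebesgue_measure R).
Local Notation RT := (measurableTypeR R).

(* In the coordinates (x, m) = (x, y / x) the inversion reads
   (x, m) |-> (1 / (x (1 + m ^ 2)), - m). *)
Lemma integral_inv2 (G : R * R -> \bar R) :
  measurable_fun setT G -> (forall w, 0 <= G w)%E ->
  (\int[leb2]_w (if (0 < w.1)%R then
      G (w.1 / (w.1 ^+ 2 + w.2 ^+ 2), - w.2 / (w.1 ^+ 2 + w.2 ^+ 2))%R *
      ((w.1 ^+ 2 + w.2 ^+ 2) ^- 2)%:E else 0) =
   \int[leb2]_w (if (0 < w.1)%R then G w else 0))%E.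
Proof.
move=> mG G0.
pose K0 (w : R * R) : \bar R := if 0 < w.1 then
      (G (w.1 / (w.1 ^+ 2 + w.2 ^+ 2), - w.2 / (w.1 ^+ 2 + w.2 ^+ 2))%R *
      ((w.1 ^+ 2 + w.2 ^+ 2) ^- 2)%:E)%E else 0%E.
pose K1 (w : R * R) : \bar R := if 0 < w.1 then
   (G ((w.1 * (1 + w.2 ^+ 2))^-1, - w.2 / (w.1 * (1 + w.2 ^+ 2)))%R *
   ((w.1 ^- 3 * (1 + w.2 ^+ 2) ^- 2))%:E)%E else 0%E.
pose K2 (w : R * R) : \bar R := if 0 < w.1 then
   (G (w.1, - w.2 * w.1)%R * w.1%:E)%E else 0%E.
pose K3 (w : R * R) : \bar R := if 0 < w.1 then G w else 0%E.
have mK0 : measurable_fun setT K0.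
  by rewrite /K0; mfun; apply: (measurableT_comp mG); apply: measurable_fun_pair; mfun.
have mK1 : measurable_fun setT K1.
  by rewrite /K1; mfun; apply: (measurableT_comp mG); apply: measurable_fun_pair; mfun.
have mK2 : measurable_fun setT K2.
  by rewrite /K2; mfun; apply: (measurableT_comp mG); apply: measurable_fun_pair; mfun.
have mK3 : measurable_fun setT K3 by rewrite /K3; mfun.
have K00 w : (0 <= K0 w)%E.
  by rewrite /K0; case: ifPn => // _; rewrite mule_ge0// lee_fin invr_ge0 exprn_ge0// addr_ge0// sqr_ge0.
have K10 w : (0 <= K1 w)%E.
  rewrite /K1; case: ifPn => // w0; rewrite mule_ge0// lee_fin mulr_ge0// invr_ge0 exprn_ge0// ?(ltW w0)//.
  by rewrite addr_ge0// sqr_ge0.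
have K20 w : (0 <= K2 w)%E.
  by rewrite /K2; case: ifPn => // w0; rewrite mule_ge0// lee_fin ltW.
have K30 w : (0 <= K3 w)%E by rewrite /K3; case: ifPn.
rewrite -/(K0 _) -/(K3 _).
rewrite (tonelli1 mK0 K00).
transitivity (\int[mu]_x \int[mu]_m K1 (x, m))%E.
  apply: eq_integral => x _.
  case: (ltP 0 x) => x0; last first.
    by rewrite !integral0_eq// => m _; rewrite /K0 /K1/= (le_gtF x0).
  have mx : measurable_fun [set: R] (fun y : R => K0 (x, y)).
    by apply: (measurableT_comp mK0); apply: measurable_fun_pair; mfun.
  have mx' : measurable_fun [set: R] (fun y : R => K0 (x, x * y)).
    by apply: (measurableT_comp mK0); apply: measurable_fun_pair; mfun.
  rewrite (integral_scale x0 mx (fun y => K00 _)).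
  rewrite -(ge0_integralZl mu measurableT (measurable_RT mx') (fun x _ => K00 _)) ?lee_fin ?ltW//.
  apply: eq_integral => m _; rewrite /K0 /K1 /= x0 muleCA -EFinM.
  have m0 : 1 + (m : R) ^+ 2 != 0 by rewrite gt_eqF// ltr_pwDl// sqr_ge0.
  have xm0 : (x : R) ^+ 2 + (x * m) ^+ 2 != 0.
    by rewrite exprMn -[X in X + _]mulr1 -mulrDr mulf_neq0// expf_neq0// gt_eqF.
  have x0' : (x : R) != 0 by rewrite gt_eqF.
  congr (G (_, _) * _%:E)%E; field; rewrite ?m0 ?xm0 ?x0'//.
rewrite -(tonelli1 mK1 K10) (tonelli2 mK1 K10).
(* For a fixed slope m, the map x |-> 1 / (x (1 + m^2)) is composed of a dilation and the inversion
   of the half-line. *)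
transitivity (\int[mu]_m \int[mu]_x K2 (x, m))%E.
  apply: eq_integral => m _.
  have m0 : 0 < 1 + (m : R) ^+ 2 by rewrite ltr_pwDl// sqr_ge0.
  have mV0 : 0 < (1 + (m : R) ^+ 2)^-1 by rewrite invr_gt0.
  have mx : measurable_fun [set: R] (fun x : R => K1 (x, m)).
    by apply: (measurableT_comp mK1); apply: measurable_fun_pair; mfun.
  have mx' : measurable_fun [set: R] (fun x : R => K1 ((1 + (m : R) ^+ 2)^-1 * x, m)).
    by apply: (measurableT_comp mK1); apply: measurable_fun_pair; mfun.
  rewrite (integral_scale mV0 mx (fun y => K10 _)).
  rewrite -(ge0_integralZl mu measurableT (measurable_RT mx') (fun x _ => K10 _)) ?lee_fin ?ltW//.
  pose f (t : R) := (G (t, - m * t)%R * (Num.max t 0)%:E)%E.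
  have mf : measurable_fun setT f.
    rewrite /f; mfun; apply: (measurableT_comp mG); apply: measurable_fun_pair; mfun.
  have f0 t : (0 <= f t)%E by rewrite mule_ge0// lee_fin le_max lexx orbT.
  transitivity (\int[mu]_x (if (0 < x)%R then f x else 0))%E; last first.
    apply: eq_integral => x _; rewrite /f /K2/=; case: ifPn => // x0.
    by rewrite max_l// ltW.
  rewrite -(integral_inv mf f0); apply: eq_integral => x _.
  rewrite /K1 /f /= pmulr_rgt0//; case: ifPn => x0; last by rewrite mule0.
  rewrite max_l ?invr_ge0 ?ltW// -muleA -EFinM muleCA -EFinM.
  have x0' : (x : R) != 0 by rewrite gt_eqF.
  have m0' : 1 + (m : R) ^+ 2 != 0 by rewrite gt_eqF.
  congr (G (_, _) * _%:E)%E; field; rewrite ?m0' ?x0'//.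
rewrite -(tonelli2 mK2 K20) (tonelli1 mK2 K20) (tonelli1 mK3 K30).
apply: eq_integral => x _.
case: (ltP 0 x) => x0; last first.
  by rewrite !integral0_eq// => m _; rewrite /K2 /K3/= (le_gtF x0).
have mx : measurable_fun [set: R] (fun y : R => K3 (x, y)).
  by apply: (measurableT_comp mK3); apply: measurable_fun_pair; mfun.
have mx' : measurable_fun [set: R] (fun y : R => K3 (x, - x * y + 0)).
  by apply: (measurableT_comp mK3); apply: measurable_fun_pair; mfun.
have x0' : - (x : R) != 0 by rewrite oppr_eq0 gt_eqF.
rewrite (integral_affine 0 x0' mx (fun y => K30 _)) normrN gtr0_norm//.
rewrite -(ge0_integralZl mu measurableT (measurable_RT mx') (fun x _ => K30 _)) ?lee_fin ?ltW//.
apply: eq_integral => m _; rewrite /K2 /K3 /= x0 addr0 muleC.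
by congr (_ * G (_, _))%E; rewrite mulNr mulrC mulNr.
Qed.

Lemma integral2_affine (a b d e : R) (F : R * R -> \bar R) : a != 0 -> b != 0 ->
  measurable_fun setT F -> (forall w, 0 <= F w)%E ->
  (\int[leb2]_w F w = (`|a| * `|b|)%:E * \int[leb2]_w F (a * w.1 + d, b * w.2 + e)%R)%E.
Proof.
move=> a0 b0 mF F0.
have mF' : measurable_fun setT (fun w : R * R => F (a * w.1 + d, b * w.2 + e)).
  by apply: (measurableT_comp mF); apply: measurable_fun_pair; mfun.
have mF1 : measurable_fun [set: R] (fun x : R => \int[mu]_y F (x, y))%E.
  exact: (@measurable_fun_fubini_tonelli_F _ _ RT RT R mu F mF F0).
rewrite (tonelli1 mF F0) (tonelli1 mF' (fun=> F0 _)).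
rewrite (integral_affine d a0 mF1); last by move=> x; exact: integral_ge0.
rewrite EFinM -muleA; congr (_ * _)%E.
have mF2 : measurable_fun [set: R] (fun x : R => \int[mu]_y F (a * x + d, b * y + e)%R)%E.
  exact: (@measurable_fun_fubini_tonelli_F _ _ RT RT R mu _ mF' (fun w => F0 _)).
rewrite -(ge0_integralZl mu measurableT (measurable_RT mF2)) ?lee_fin//; last first.
  by move=> x _; exact: integral_ge0.
apply: eq_integral => x _.
have mx : measurable_fun [set: R] (fun y : R => F (a * (x : R) + d, y)).
  by apply: (measurableT_comp mF); apply: measurable_fun_pair; mfun.
by rewrite (integral_affine e b0 mx (fun y => F0 _)).
Qed.

Lemma integral2_shear1 (t : R) (F : R * R -> \bar R) :
  measurable_fun setT F -> (forall w, 0 <= F w)%E ->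
  (\int[leb2]_w F w = \int[leb2]_w F (w.1 + t * w.2, w.2)%R)%E.
Proof.
move=> mF F0.
have mF' : measurable_fun setT (fun w : R * R => F (w.1 + t * w.2, w.2)).
  by apply: (measurableT_comp mF); apply: measurable_fun_pair; mfun.
rewrite (tonelli2 mF F0) (tonelli2 mF' (fun=> F0 _)).
apply: eq_integral => y _.
have my : measurable_fun [set: R] (fun x : R => F (x, y)).
  by apply: (measurableT_comp mF); apply: measurable_fun_pair; mfun.
rewrite (integral_affine (t * y) (oner_neq0 R) my (fun x => F0 _)) normr1 mul1e.
by apply: eq_integral => x _; rewrite mul1r.
Qed.

Lemma integral2_shear2 (t : R) (F : R * R -> \bar R) :
  measurable_fun setT F -> (forall w, 0 <= F w)%E ->
  (\int[leb2]_w F w = \int[leb2]_w F (w.1, w.2 + t * w.1)%R)%E.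
Proof.
move=> mF F0.
have mF' : measurable_fun setT (fun w : R * R => F (w.1, w.2 + t * w.1)).
  by apply: (measurableT_comp mF); apply: measurable_fun_pair; mfun.
rewrite (tonelli1 mF F0) (tonelli1 mF' (fun=> F0 _)).
apply: eq_integral => x _.
have mx : measurable_fun [set: R] (fun y : R => F (x, y)).
  by apply: (measurableT_comp mF); apply: measurable_fun_pair; mfun.
rewrite (integral_affine (t * x) (oner_neq0 R) mx (fun x => F0 _)) normr1 mul1e.
by apply: eq_integral => y _; rewrite mul1r.
Qed.

(* A rotation is a product of three shears unless it is +1 or -1. *)
Lemma integral2_rot (c s : R) (F : R * R -> \bar R) : c ^+ 2 + s ^+ 2 = 1 ->
  measurable_fun setT F -> (forall w, 0 <= F w)%E ->
  (\int[leb2]_w F w = \int[leb2]_w F (c * w.1 - s * w.2, s * w.1 + c * w.2)%R)%E.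
Proof.
move=> cs mF F0.
have [s0|s0] := eqVneq s 0.
  have c0 : c != 0.
    by apply: contraPneq cs => ->; rewrite s0 expr0n/= addr0 => /esym/eqP; rewrite oner_eq0.
  rewrite (integral2_affine 0 0 c0 c0 mF F0).
  have -> : `|c| * `|c| = 1 by rewrite -normrM -expr2 -[RHS]normr1 -cs s0 expr0n addr0.
  rewrite mul1e; apply: eq_integral => w _.
  by rewrite s0 !mul0r subr0 add0r !addr0.
(* In terms of the angle, [t] is minus the tangent of its half; the shears are by t, s and t in
   turn. *)
set t := (c - 1) / s.
pose F1 (w : R * R) := F (w.1 + t * w.2, w.2).
pose F2 (w : R * R) := F1 (w.1, w.2 + s * w.1).
have mF1 : measurable_fun setT F1.
  by apply: (measurableT_comp mF); apply: measurable_fun_pair; mfun.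
have mF2 : measurable_fun setT F2.
  by apply: (measurableT_comp mF1); apply: measurable_fun_pair; mfun.
rewrite (integral2_shear1 t mF F0) (integral2_shear2 s mF1 (fun=> F0 _)).
rewrite (integral2_shear1 t mF2 (fun=> F0 _)).
apply: eq_integral => w _; rewrite /F2 /F1/= /t.
have E : w.2 + s * (w.1 + (c - 1) / s * w.2) = s * (w.1 : R) + c * w.2 by field.
have E' : (w.1 : R) + (c - 1) / s * w.2 + (c - 1) / s * (s * w.1 + c * w.2) =
    c * w.1 - s * w.2.
  have -> : s * (w.2 : R) = (1 - c ^+ 2) / s * w.2 by rewrite -cs; field.
  by field.
by rewrite E E'.
Qed.

End plane_substitutions.

(** * Radial integrals *)

Section radial_integrals.
Context {R : realType}.
Local Notation mu := (@lebesgue_measure R).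
Local Notation RT := (measurableTypeR R).

(** The constant of radial integration. It is kept abstract: the estimates use that it is positive
    and finite. The origin is left out to match integrals over ]0, +oo[ in the squared radius. *)
Definition disk_area : \bar R :=
  (\int[leb2]_w (if ((0 < (w.1 : R) ^+ 2 + w.2 ^+ 2) && (w.1 ^+ 2 + w.2 ^+ 2 < 1))%R
    then 1 else 0))%E.

(* Both sides are dilation invariant measures of degree 1 in [G]; pairing with
   the indicator of ]0, 1[ identifies the constant. *)
Lemma integral_radial (G : R -> \bar R) :
  measurable_fun setT G -> (forall x, 0 <= G x)%E ->
  (\int[leb2]_w (if (0 < (w.1 : R) ^+ 2 + w.2 ^+ 2)%R then G (w.1 ^+ 2 + w.2 ^+ 2)%R else 0) =
   disk_area * \int[mu]_x (if (0 < x)%R then G x else 0))%E.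
Proof.
move=> mG G0.
pose n (w : R * R) := w.1 ^+ 2 + w.2 ^+ 2.
have mn : measurable_fun setT n by rewrite /n; mfun.
have n0 w : 0 <= n w by rewrite addr_ge0// sqr_ge0.
pose K1 (x : R * (R * R)) : \bar R := if ((0 < n x.2) && ((0 < n x.2 * x.1) && (n x.2 * x.1 < 1)))%R
  then (G (n x.2) * (n x.2)%:E)%E else 0%E.
pose K2 (x : R * (R * R)) : \bar R := if ((0 < x.1) && ((0 < n x.2) && (n x.2 < 1)))%R
  then (G (n x.2 / x.1)%R * (n x.2 * x.1 ^- 2)%:E)%E else 0%E.
have mn2 : measurable_fun setT (fun x : R * (R * R) => n x.2).
  exact: (measurableT_comp mn).
have mK1 : measurable_fun setT K1 by rewrite /K1; mfun; exact: (measurableT_comp mG).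
have mK2 : measurable_fun setT K2 by rewrite /K2; mfun; apply: (measurableT_comp mG); mfun.
have K10 x : (0 <= K1 x)%E.
  by rewrite /K1; case: ifPn => // _; rewrite mule_ge0// lee_fin.
have K20 x : (0 <= K2 x)%E.
  by rewrite /K2; case: ifPn => // _; rewrite mule_ge0// lee_fin mulr_ge0// invr_ge0 sqr_ge0.
transitivity (\int[leb2]_w \int[mu]_x K1 (x, w))%E.
  apply: eq_integral => w _; rewrite -/(n w) /K1/=; case: ifPn => [w0|] /=; last first.
    by rewrite integral0.
  pose g (y : R) : \bar R := if ((0 < y) && (y < 1))%R then 1%E else 0%E.
  have mg : measurable_fun setT g by rewrite /g; mfun.
  have g0 y : (0 <= g y)%E by rewrite /g; case: ifP.
  have mg' : measurable_fun setT (fun y => g (n w * y)) by rewrite /g; mfun.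
  have E1 : (\int[mu]_y g y = 1)%E by rewrite integral_ltr_itv ?ler01// subr0.
  rewrite -[LHS]mule1 -E1 (integral_scale w0 mg g0) muleA.
  rewrite -(ge0_integralZl mu measurableT (measurable_RT mg') (fun x _ => g0 _)); last first.
    by rewrite mule_ge0// lee_fin ltW.
  by apply: eq_integral => y _; rewrite /g; case: ifPn; rewrite ?mule1 ?mule0.
rewrite -(tonelli3 mK1 K10).
transitivity (\int[mu]_x \int[leb2]_w K2 (x, w))%E.
  apply: eq_integral => x _.
  case: (ltP 0 x) => x0; last first.
    rewrite [RHS]integral0_eq => [|w _]; last by rewrite /K2 /= (le_gtF x0).
    rewrite integral0_eq// => w _; rewrite /K1 /=; case: ifPn => // /and3P[w0].
    by rewrite pmulr_rgt0// (le_gtF x0).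
  (* Dilating the plane by x^(-1/2) divides the squared radius by x; the Jacobian is 1 / x. *)
  set r := (Num.sqrt (x : R))^-1.
  have r0 : 0 < r by rewrite invr_gt0 sqrtr_gt0.
  have r2 : r ^+ 2 = (x : R)^-1 by rewrite exprVn sqr_sqrtr// ltW.
  have rn0 : r != 0 by rewrite gt_eqF.
  have mx : measurable_fun setT (fun w => K1 (x, w)).
    by apply: (measurableT_comp mK1); apply: measurable_fun_pair; mfun.
  have mx' : measurable_fun setT (fun w : R * R => K1 (x, (r * w.1 + 0, r * w.2 + 0))).
    by apply: (measurableT_comp mx); apply: measurable_fun_pair; mfun.
  rewrite (integral2_affine 0 0 rn0 rn0 mx (fun=> K10 _)) gtr0_norm// -expr2 r2.
  rewrite -ge0_integralZl//; last by rewrite lee_fin invr_ge0 ltW.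
  apply: eq_integral => w _; rewrite /K1 /K2 /= !addr0.
  have -> : n (r * w.1, r * w.2) = n w / x.
    by rewrite /n/= !exprMn -mulrDr r2 mulrC.
  rewrite mulfVK ?gt_eqF// x0 /= pmulr_lgt0 ?invr_gt0//.
  rewrite andbA andbb; case: ifPn; rewrite ?mule0// => _.
  rewrite muleCA -EFinM; congr (_ * _%:E)%E; by field; rewrite gt_eqF.
rewrite (tonelli3 mK2 K20).
pose IG := (\int[mu]_x (if (0 < x)%R then G x else 0))%E.
have mi : measurable_fun setT (fun w : R * R => if ((0 < n w) && (n w < 1))%R then 1 else 0 : \bar R)%E.
  by mfun.
have IG0 : (0 <= IG)%E by apply: integral_ge0 => x _; case: ifP.
rewrite /disk_area -(ge0_integralZr leb2 measurableT mi)//; last by move=> w _; case: ifP.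
apply: eq_integral => w _; rewrite -/(n w) /K2 /=; case: ifPn => w01; last first.
  by rewrite mul0e integral0_eq// => x _; rewrite andbF.
rewrite mul1e; have /andP[w0 _] := w01.
pose f (t : R) := (G (n w * t)%R * (n w)%:E)%E.
have mf : measurable_fun setT f.
  by rewrite /f; mfun; apply: (measurableT_comp mG); mfun.
have f0 t : (0 <= f t)%E by rewrite mule_ge0// lee_fin.
(* For fixed w, inversion in x followed by the dilation by [n w] removes w from the integrand. *)
transitivity (\int[mu]_x (if (0 < x)%R then f x^-1%R * (x ^- 2)%:E else 0))%E.
  apply: eq_integral => x _; rewrite andbT; case: ifPn => // _.
  by rewrite /f -muleA -EFinM.
rewrite (integral_inv mf f0).
have mG' : measurable_fun [set: R] (fun x : R => if (0 < x)%R then G x else 0%E) by mfun.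
have G0' (x : R) : (0 <= (if (0 < x)%R then G x else 0))%E by case: ifP.
have mG'' : measurable_fun [set: R] (fun x : R => if (0 < n w * x)%R then G (n w * x) else 0%E).
  by mfun; apply: (measurableT_comp mG); mfun.
rewrite (integral_scale w0 mG' G0').
rewrite -(ge0_integralZl mu measurableT (measurable_RT mG'') (fun x _ => G0' _)) ?lee_fin ?ltW//.
by apply: eq_integral => x _; rewrite pmulr_rgt0// /f; case: ifPn; rewrite ?mule0// muleC.
Qed.

End radial_integrals.

Section disk_area.
Context {R : realType}.
Local Notation mu := (@lebesgue_measure R).
Local Notation RT := (measurableTypeR R).

Lemma leb2_rect (a b c d : R) : a <= b -> c <= d ->
  (\int[leb2]_w (if ((a < (w.1 : R)) && (w.1 < b) && ((c < (w.2 : R)) && (w.2 < d)))%R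
     then 1 else 0) = ((b - a) * (d - c))%:E)%E.
Proof.
move=> ab cd.
have mF : measurable_fun setT (fun w : R * R =>
    if ((a < w.1) && (w.1 < b) && ((c < w.2) && (w.2 < d)))%R then 1 else 0 : \bar R)%E.
  by mfun.
rewrite (tonelli1 mF); last by move=> w; case: ifP.
have mi : measurable_fun [set: R] (fun x => if ((a < x) && (x < b))%R then 1 else 0 : \bar R)%E.
  by mfun.
transitivity (\int[mu]_x ((if ((a < x) && (x < b))%R then 1 else 0) * (d - c)%:E))%E.
  apply: eq_integral => x _ /=; case: ifP => _ /=; last by rewrite integral0 mul0e.
  by rewrite integral_ltr_itv// mul1e.
rewrite (ge0_integralZr mu measurableT (measurable_RT mi)).
- by rewrite integral_ltr_itv.
- by move=> x _; case: ifP.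
- by rewrite lee_fin subr_ge0.
Qed.

Lemma measurable_RT2 d (U : measurableType d) (f : R * R -> U) :
  measurable_fun [set: R * R] f -> measurable_fun [set: (RT * RT)%type] f.
Proof. by []. Qed.

Lemma le_integral_leb (f g : R -> \bar R) : measurable_fun setT f -> measurable_fun setT g ->
  (forall x, 0 <= f x)%E -> (forall x, f x <= g x)%E ->
  (\int[mu]_x f x <= \int[mu]_x g x)%E.
Proof.
move=> /measurable_RT mf /measurable_RT mg f0 fg.
by apply: ge0_le_integral => // x _; rewrite (le_trans (f0 x)).
Qed.

Lemma le_integral_leb2 (f g : R * R -> \bar R) : measurable_fun setT f -> measurable_fun setT g ->
  (forall x, 0 <= f x)%E -> (forall x, f x <= g x)%E ->
  (\int[leb2]_x f x <= \int[leb2]_x g x)%E.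
Proof.
move=> /measurable_RT2 mf /measurable_RT2 mg f0 fg.
by apply: ge0_le_integral => // x _; rewrite (le_trans (f0 x)).
Qed.

Lemma disk_area_gt0 : (0 < @disk_area R)%E.
Proof.
apply: (@lt_le_trans _ _ ((1 / 2 - 0) * (1 / 2 - 0))%:E); first by rewrite lte_fin; lra.
rewrite -leb2_rect; [|lra..].
apply: le_integral_leb2.
- by mfun.
- by mfun.
- by move=> w; case: ifP.
- move=> w; case: ifPn => [/andP[/andP[w10 w11] /andP[w20 w21]]|_]; last by case: ifP.
  rewrite ifT//; apply/andP; split; nra.
Qed.

Lemma disk_area_lty : (@disk_area R < +oo)%E.
Proof.
apply: (@le_lt_trans _ _ ((1 - (- 1)) * (1 - (- 1)))%:E); last by rewrite ltry.
rewrite -leb2_rect; [|lra..].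
apply: le_integral_leb2.
- by mfun.
- by mfun.
- by move=> w; case: ifP.
- move=> w; case: ifPn => [/andP[w0 w1]|_]; last by case: ifP.
  rewrite ifT//; apply/andP; split; apply/andP; split; nra.
Qed.

End disk_area.

(** * Complex power series *)

Section complex_facts.
Context {R : realType}.
Implicit Types (z w : R[i]) (u v : nat -> R[i]).

Lemma normrC z : `|z| = (normc z)%:C. Proof. by []. Qed.

Lemma normc_ge0 z : 0 <= normc z. Proof. by case: z => a b; exact: sqrtr_ge0. Qed.

Lemma sqr_normcE z : normc z ^+ 2 = Re z ^+ 2 + Im z ^+ 2.
Proof. by case: z => a b; rewrite sqr_sqrtr// addr_ge0// sqr_ge0. Qed.

Lemma normcR (x : R) : normc x%:C = `|x|.
Proof. by rewrite /ComplexField.Normc.normc /= expr0n/= addr0 sqrtr_sqr. Qed.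

Lemma normcX z n : normc (z ^+ n) = normc z ^+ n.
Proof.
elim: n => [|n IH]; first by rewrite !expr0 ComplexField.Normc.normc1.
by rewrite !exprS ComplexField.Normc.normcM IH.
Qed.

Lemma normc_eq0 z : (normc z == 0) = (z == 0).
Proof.
apply/eqP/eqP => [|->]; first exact: ComplexField.Normc.eq0_normc.
exact: ComplexField.Normc.normc0.
Qed.

Lemma ler_normc_Re z : `|Re z| <= normc z.
Proof.
rewrite -ler_sqr ?nnegrE ?normc_ge0// sqr_normcE real_normK ?num_real//.
by rewrite lerDl sqr_ge0.
Qed.

Lemma ler_normc_Im z : `|Im z| <= normc z.
Proof.
rewrite -ler_sqr ?nnegrE ?normc_ge0// sqr_normcE real_normK ?num_real//.
by rewrite lerDr sqr_ge0.
Qed.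

Lemma ler_normcD z w : normc (z + w) <= normc z + normc w.
Proof. exact: le_normcD. Qed.

Lemma ler_normcB z w : normc (z - w) <= normc z + normc w.
Proof. by rewrite (le_trans (ler_normcD _ _))// normcN. Qed.

Lemma ler_normc_ReIm z : normc z <= `|Re z| + `|Im z|.
Proof.
rewrite -ler_sqr ?nnegrE ?normc_ge0 ?addr_ge0// sqr_normcE sqrrD !real_normK ?num_real//.
by rewrite addrAC lerDl mulrn_wge0// mulr_ge0.
Qed.

Lemma normc_sum (I : Type) (s : seq I) (P : pred I) (F : I -> R[i]) :
  normc (\sum_(i <- s | P i) F i) <= \sum_(i <- s | P i) normc (F i).
Proof.
elim/big_ind2: _ => //; first by rewrite ComplexField.Normc.normc0.
by move=> x1 x2 y1 y2 h1 h2; rewrite (le_trans (ler_normcD _ _))// lerD.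
Qed.

Lemma Re_sum (I : Type) (s : seq I) (P : pred I) (F : I -> R[i]) :
  Re (\sum_(i <- s | P i) F i) = \sum_(i <- s | P i) Re (F i).
Proof. by apply: (big_morph (@complex.Re R)) => // -[? ?] [? ?]. Qed.

Lemma Im_sum (I : Type) (s : seq I) (P : pred I) (F : I -> R[i]) :
  Im (\sum_(i <- s | P i) F i) = \sum_(i <- s | P i) Im (F i).
Proof. by apply: (big_morph (@complex.Im R)) => // -[? ?] [? ?]. Qed.

Lemma ReB z w : Re (z - w) = Re z - Re w.
Proof. by case: z => ? ?; case: w. Qed.

Lemma ImB z w : Im (z - w) = Im z - Im w.
Proof. by case: z => ? ?; case: w. Qed.

Lemma cvgC_normP u (l : R[i]) : ((u : nat -> R[i]^o) @ \oo --> (l : R[i]^o)) <->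
  forall e : R, 0 < e -> \forall n \near \oo, normc (l - u n) < e.
Proof.
split=> [/cvgrPdist_lt h e e0|h].
  have e0' : 0 < (e%:C : R[i]) by rewrite ltcR.
  by apply: filterS (h _ e0') => n; rewrite normrC ltcR.
apply/cvgrPdist_lt => e e0.
have : e \is Num.real by exact: gtr0_real.
move=> /RRe_real er; move: e0; rewrite -er ltcR => e0.
by apply: filterS (h _ e0) => n; rewrite normrC ltcR.
Qed.

Lemma cvgCP u (l : R[i]) : ((u : nat -> R[i]^o) @ \oo --> (l : R[i]^o)) <->
  ((fun n => Re (u n)) @ \oo --> Re l) /\ ((fun n => Im (u n)) @ \oo --> Im l).
Proof.
split=> [/cvgC_normP h|[hr hi]].
  split; apply/cvgrPdist_lt => e e0; apply: filterS (h _ e0) => n /(le_lt_trans _); apply.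
  - by rewrite -ReB ler_normc_Re.
  - by rewrite -ImB ler_normc_Im.
apply/cvgC_normP => e e0.
have e20 : 0 < e / 2 by rewrite divr_gt0.
move/cvgrPdist_lt : hr => /(_ _ e20) hr; move/cvgrPdist_lt : hi => /(_ _ e20) hi.
apply: filterS2 hr hi => n hr hi.
by rewrite (le_lt_trans (ler_normc_ReIm _))// (splitr e) ltrD// ?ReB ?ImB.
Qed.

Lemma cvgC_unique u (l l' : R[i]) : ((u : nat -> R[i]^o) @ \oo --> (l : R[i]^o)) ->
  ((u : nat -> R[i]^o) @ \oo --> (l' : R[i]^o)) -> l = l'.
Proof.
move=> h1 h2.
exact: (@cvg_unique _ (@norm_hausdorff _ (R[i]^o)) (u @ \oo) _ l l' h1 h2).
Qed.

Lemma cvgC_lim u (l : R[i]) : ((u : nat -> R[i]^o) @ \oo --> (l : R[i]^o)) ->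
  limn (u : nat -> R[i]^o) = l.
Proof. by move=> h; apply: cvg_lim => //; exact: norm_hausdorff. Qed.

Lemma cvgC_norm_le u (l c : R[i]) (M : R) : ((u : nat -> R[i]^o) @ \oo --> (l : R[i]^o)) ->
  (\forall n \near \oo, normc (u n - c) <= M) -> normc (l - c) <= M.
Proof.
move=> /cvgC_normP h hM; apply/ler_addgt0Pr => e e0.
near \oo => n.
have -> : l - c = (u n - c) + (l - u n) by ring.
rewrite (le_trans (ler_normcD _ _))// lerD//; first by near: n.
by apply: ltW; near: n; exact: h.
Unshelve. all: by end_near. Qed.

Lemma cvgC_mull (c : R[i]) u l : ((u : nat -> R[i]^o) @ \oo --> (l : R[i]^o)) ->
  ((fun n => c * u n : R[i]^o) @ \oo --> (c * l : R[i]^o)).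
Proof.
move=> /cvgC_normP h; apply/cvgC_normP => e e0.
have c0 : 0 < normc c + 1 by rewrite ltr_wpDl// normc_ge0.
have ec : 0 < e / (normc c + 1) by rewrite divr_gt0.
apply: filterS (h _ ec) => n; rewrite ltr_pdivlMr// => hn.
rewrite -mulrBr ComplexField.Normc.normcM (le_lt_trans _ hn)// mulrC.
by rewrite ler_wpM2l ?normc_ge0// lerDl.
Qed.

Lemma cvgC_add u v (l m : R[i]) : ((u : nat -> R[i]^o) @ \oo --> (l : R[i]^o)) ->
  ((v : nat -> R[i]^o) @ \oo --> (m : R[i]^o)) ->
  ((fun n => u n + v n : R[i]^o) @ \oo --> (l + m : R[i]^o)).
Proof.
move=> /cvgC_normP hu /cvgC_normP hv; apply/cvgC_normP => e e0.
have e2 : 0 < e / 2 by rewrite divr_gt0.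
apply: filterS2 (hu _ e2) (hv _ e2) => n h1 h2.
have -> : l + m - (u n + v n) = (l - u n) + (m - v n) by ring.
by rewrite (le_lt_trans (ler_normcD _ _))// (splitr e) ltrD.
Qed.

Lemma nneg_series_cvg (u : nat -> R) M : (forall k, 0 <= u k) ->
  (forall n, \sum_(0 <= k < n) u k <= M) -> cvgn (series u).
Proof.
move=> u0 uM; apply: nondecreasing_is_cvgn.
  by apply: nondecreasing_series => // n _; exact: u0.
by exists M => _ [n _ <-]; exact: uM.
Qed.

Lemma abs_series_cvgC u M : (forall n, \sum_(0 <= k < n) normc (u k) <= M) ->
  exists l : R[i], (series (u : nat -> R[i]^o)) @ \oo --> (l : R[i]^o).
Proof.
move=> uM.
have h (f : R[i] -> R) : (forall z, `|f z| <= normc z) -> cvgn (series (f \o u)).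
  move=> fz; apply: normed_cvg; apply: (@nneg_series_cvg _ M) => [k|n] //=.
  by rewrite (le_trans _ (uM n))// ler_sum// => k _; exact: fz.
exists (limn (series (@Re R \o u)) +i* limn (series (@Im R \o u))).
apply/cvgCP; split => /=.
- under eq_fun do rewrite /series/= Re_sum.
  exact: (h _ ler_normc_Re).
- under eq_fun do rewrite /series/= Im_sum.
  exact: (h _ ler_normc_Im).
Qed.

Lemma cvgC_sum (F : nat -> nat -> R[i]) (t : nat -> R[i]) K :
  (forall k, (fun N => F N k : R[i]^o) @ \oo --> (t k : R[i]^o)) ->
  (fun N => \sum_(0 <= k < K) F N k : R[i]^o) @ \oo --> (\sum_(0 <= k < K) t k : R[i]^o).
Proof.
move=> Ft; elim: K => [|K IH].
  apply/cvgC_normP => e e0; apply: nearW => N.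
  by rewrite !big_geq// subrr ComplexField.Normc.normc0.
have -> : (fun N => \sum_(0 <= k < K.+1) F N k) = (fun N => \sum_(0 <= k < K) F N k + F N K).
  by apply/funext => N; rewrite big_nat_recr.
rewrite big_nat_recr; last by [].
exact: (cvgC_add IH (Ft K)).
Qed.

(* Tannery's theorem: dominated convergence for series. *)
Lemma cvg_series_dominatedC (F : nat -> nat -> R[i]) (Y t : nat -> R[i]) (T : R[i])
   (M : nat -> R) (S : R) :
  (forall N k, normc (F N k) <= M k) -> (forall K, \sum_(0 <= k < K) M k <= S) ->
  (forall N, series (F N : nat -> R[i]^o) @ \oo --> (Y N : R[i]^o)) ->
  (forall k, (fun N => F N k : R[i]^o) @ \oo --> (t k : R[i]^o)) ->
  series (t : nat -> R[i]^o) @ \oo --> (T : R[i]^o) ->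
  (Y : nat -> R[i]^o) @ \oo --> (T : R[i]^o).
Proof.
move=> FM MS FY Ft tT; apply/cvgC_normP => e e0.
have M0 k : 0 <= M k by exact: le_trans (normc_ge0 _) (FM 0%N k).
have e3 : 0 < e / 4 by rewrite divr_gt0.
have tM k : normc (t k) <= M k.
  rewrite -[t k]subr0; apply: cvgC_norm_le (Ft k) _.
  by apply: nearW => N; rewrite subr0.
have /cauchy_seriesP/(_ _ e3) hM : cauchy (series M @ \oo).
  by apply/cauchy_cvgP; exact: nneg_series_cvg MS.
have [K hK] : exists K, forall n, \sum_(K <= k < n) M k < e / 4.
  move: hM => [[A B] [[a _ ha] [b _ hb]] hAB].
  exists (maxn a b) => n.
  have [nm|mn] := leqP n (maxn a b); first by rewrite big_geq.
  rewrite (le_lt_trans (ler_norm _))//; apply: (hAB (maxn a b, n)); split => /=.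
    by apply: ha => /=; exact: leq_maxl.
  by apply: hb => /=; rewrite (leq_trans (leq_maxr a b))// ltnW.
have tail (v : nat -> R[i]) (l : R[i]) : (forall k, normc (v k) <= M k) ->
    series (v : nat -> R[i]^o) @ \oo --> (l : R[i]^o) ->
    normc (l - \sum_(0 <= k < K) v k) <= e / 4.
  move=> vM vl; apply: cvgC_norm_le vl _.
  exists K => // n /= Kn.
  rewrite /series/= (@big_cat_nat _ _ _ K)//= addrAC subrr add0r.
  rewrite (le_trans (normc_sum _ _ _))// (le_trans _ (ltW (hK n)))//.
  by apply: ler_sum => k _; exact: vM.
have : (fun N => \sum_(0 <= k < K) F N k : R[i]^o) @ \oo --> (\sum_(0 <= k < K) t k : R[i]^o).
  exact: cvgC_sum.
move=> /cvgC_normP/(_ _ e3); apply: filterS => N hN.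
have h1 := tail _ _ (FM N) (FY N).
have h2 := tail _ _ tM tT.
set a := \sum_(0 <= k < K) F N k in hN h1.
set b := \sum_(0 <= k < K) t k in hN h2.
have -> : T - Y N = (T - b) + (b - a) - (Y N - a).
  by ring.
rewrite (le_lt_trans (ler_normcB _ _))//.
have := ler_normcD (T - b) (b - a); lra.
Qed.

End complex_facts.

Section power_series.
Context {R : realType}.
Implicit Types (z w : R[i]) (f : R[i] -> R[i]) (a : nat -> R[i]).

(** Interchange of the two summations, as Tannery's theorem applied to the partial sums over n. *)
Lemma cvg_series_doubleC (x : nat -> nat -> R[i]) (y t : nat -> R[i]) (T : R[i])
   (M : nat -> R) (S : R) :
  (forall k N, \sum_(0 <= n < N) normc (x n k) <= M k) ->
  (forall K, \sum_(0 <= k < K) M k <= S) ->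
  (forall n, series (x n : nat -> R[i]^o) @ \oo --> (y n : R[i]^o)) ->
  (forall k, series (fun n => x n k : R[i]^o) @ \oo --> (t k : R[i]^o)) ->
  series (t : nat -> R[i]^o) @ \oo --> (T : R[i]^o) ->
  series (y : nat -> R[i]^o) @ \oo --> (T : R[i]^o).
Proof.
move=> xM MS xy xt tT.
pose F N k := \sum_(0 <= n < N) x n k.
have FM N k : normc (F N k) <= M k by rewrite (le_trans (normc_sum _ _ _)).
apply: (@cvg_series_dominatedC _ F _ t T M S FM MS _ xt tT) => N.
have -> : series (F N : nat -> R[i]^o) =
    (fun K => \sum_(0 <= n < N) series (x n : nat -> R[i]^o) K).
  by apply/funext => K; rewrite /series /F exchange_big_nat.
exact: (@cvgC_sum _ (fun K n => series (x n : nat -> R[i]^o) K) y N xy).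
Qed.

Lemma normc_nat n : normc (n%:R : R[i]) = n%:R.
Proof.
have -> : (n%:R : R[i]) = (n%:R : R)%:C by rewrite rmorph_nat.
by rewrite normcR ger0_norm.
Qed.

Lemma geometric_sum_le (q : R) n : 0 <= q < 1 -> \sum_(0 <= k < n) q ^+ k <= (1 - q)^-1.
Proof.
move=> /andP[q0 q1]; have q1' : 0 < 1 - q by rewrite subr_gt0.
rewrite -[leRHS]mul1r ler_pdivlMr// mulrC.
have -> : (1 - q) * \sum_(0 <= k < n) q ^+ k = 1 - q ^+ n.
  elim: n => [|n IH]; first by rewrite big_geq// mulr0 expr0 subrr.
  by rewrite big_nat_recr//= mulrDr IH exprS; ring.
by rewrite gerBl exprn_ge0.
Qed.

(** Convergence at [rho], strictly between r and 1, bounds the terms there; at r they are then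
    dominated by a geometric series of ratio r / rho. *)
Lemma power_series_abs_bound f a (r : R) : has_power_series f a -> 0 <= r < 1 ->
  exists M, forall n, \sum_(0 <= k < n) normc (a k) * r ^+ k <= M.
Proof.
move=> fa /andP[r0 r1].
pose rho := (1 + r) / 2.
have rho0 : 0 < rho by rewrite /rho; lra.
have rrho : r < rho by rewrite /rho; lra.
have rho1 : rho < 1 by rewrite /rho; lra.
have /fa/cvgC_normP/(_ _ ltr01)[N _ hN] : unit_disk (rho%:C).
  by rewrite /unit_disk /= normcR gtr0_norm.
(* From N on, a term is a difference of two remainders of modulus less than 1, which gives the 2;
   the sum takes care of the terms before N. *)
pose M0 := 2 + \sum_(0 <= k < N) normc (a k * rho%:C ^+ k).
have hM0 k : normc (a k) * rho ^+ k <= M0.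
  have -> : normc (a k) * rho ^+ k = normc (a k * rho%:C ^+ k).
    by rewrite ComplexField.Normc.normcM normcX normcR gtr0_norm.
  have [kN|Nk] := ltnP k N.
    rewrite /M0 (bigD1_seq k) ?mem_index_iota ?iota_uniq//= addrCA lerDl addr_ge0//.
    by rewrite sumr_ge0// => i _; exact: normc_ge0.
  have h1 := hN k Nk; have h2 := hN k.+1 (leqW Nk).
  rewrite /M0 -[leLHS]addr0 lerD//; last by rewrite sumr_ge0// => i _; exact: normc_ge0.
  have diff (v : nat -> R[i]) (l : R[i]) : v k = (l - \sum_(0 <= i < k) v i) - (l - \sum_(0 <= i < k.+1) v i).
    by rewrite big_nat_recr//; move: (\sum_(0 <= i < k) v i) => A /=; ring.
  by rewrite [X in normc X](diff (fun k => a k * rho%:C ^+ k) (f rho%:C)) (le_trans (ler_normcB _ _))// ltW// -[2]/(1 + 1) ltrD.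
have q1 : 0 <= r / rho < 1 by rewrite divr_ge0 ?(ltW rho0)//= ltr_pdivrMr// mul1r.
exists (M0 / (1 - r / rho)) => n.
apply: (@le_trans _ _ (\sum_(0 <= k < n) M0 * (r / rho) ^+ k)).
  apply: ler_sum => k _; rewrite exprMn exprVn mulrA ler_pdivlMr ?exprn_gt0//.
  by rewrite mulrAC ler_wpM2r// exprn_ge0.
rewrite -mulr_sumr ler_wpM2l ?geometric_sum_le//.
by rewrite (le_trans _ (hM0 0%N))// mulr_ge0 ?normc_ge0// exprn_ge0// ltW.
Qed.

(** Pascal's rule and telescoping. This is the step in k of the negative binomial expansion, with
    the boundary term of the truncated sum. *)
Lemma negbin_sum_rec (K : comNzRingType) (q : K) k n :
  (1 - q) * \sum_(0 <= i < n) 'C(i + k.+1, k.+1)%:R * q ^+ i =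
  \sum_(0 <= i < n) 'C(i + k, k)%:R * q ^+ i - 'C(n + k, k.+1)%:R * q ^+ n.
Proof.
elim: n => [|n IH]; first by rewrite !big_geq// mulr0 add0n bin_small// mul0r subrr.
have E1 : 'C(n + k.+1, k.+1) = ('C(n + k, k.+1) + 'C(n + k, k))%N by rewrite addnS binS.
have E2 : 'C(n.+1 + k, k.+1) = ('C(n + k, k.+1) + 'C(n + k, k))%N by rewrite addSn binS.
rewrite big_nat_recr//= mulrDr IH big_nat_recr//= E1 E2 natrD exprS.
move: (\sum_(0 <= i < n) _) => A; ring.
Qed.

Lemma negbin_sum_le (q : R) k n : 0 <= q < 1 ->
  \sum_(0 <= i < n) 'C(i + k, k)%:R * q ^+ i <= (1 - q) ^- k.+1.
Proof.
move=> q01; have /andP[q0 q1] := q01; have q1' : 0 < 1 - q by rewrite subr_gt0.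
elim: k => [|k IH].
  rewrite expr1; under eq_bigr do rewrite bin0 mul1r.
  exact: geometric_sum_le.
rewrite exprS invfM -ler_pdivrMl ?invr_gt0// invrK negbin_sum_rec.
by rewrite (le_trans _ IH)// gerBl mulr_ge0// exprn_ge0.
Qed.

Lemma negbin_cvg0 (q : R) k : 0 <= q < 1 ->
  (fun n => 'C(n + k, k)%:R * q ^+ n) @ \oo --> (0 : R).
Proof.
move=> q01; have /andP[q0 q1] := q01; apply: cvg_series_cvg_0.
apply: (@nneg_series_cvg _ _ ((1 - q) ^- k.+1)) => n.
  by rewrite mulr_ge0// exprn_ge0.
exact: negbin_sum_le.
Qed.

(** Induction on k: dividing the finite identity by 1 - w raises k by one, and the boundary term
    tends to 0. *)
Lemma negbin_series w k : normc w < 1 ->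
  series (fun n => 'C(n + k, k)%:R * w ^+ n : R[i]^o) @ \oo --> ((1 - w) ^- k.+1 : R[i]^o).
Proof.
move=> w1; have w01 : 0 <= normc w < 1 by rewrite normc_ge0.
have w0 : 1 - w != 0.
  by apply: contraTneq w1 => /eqP; rewrite subr_eq0 => /eqP <-; rewrite ComplexField.Normc.normc1 ltxx.
have bin0c m : (fun n => 'C(n + m, m)%:R * w ^+ n : R[i]^o) @ \oo --> (0 : R[i]^o).
  apply/cvgC_normP => e e0.
  have /cvgrPdist_lt/(_ _ e0) := negbin_cvg0 m w01.
  apply: filterS => n; rewrite !sub0r normrN normcN ger0_norm ?mulr_ge0 ?exprn_ge0 ?normc_ge0//.
  rewrite ComplexField.Normc.normcM normcX.
  by rewrite normc_nat.
elim: k => [|k IH].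
  have -> : series (fun n => 'C(n + 0, 0)%:R * w ^+ n : R[i]^o) =
      (fun n => (1 - w)^-1 * (1 - w ^+ n) : R[i]^o).
    apply/funext => n; rewrite /series /=; elim: n => [|n IH].
      by rewrite big_geq// expr0 subrr mulr0.
    rewrite big_nat_recr//= IH bin0 exprS; field; exact: w0.
  rewrite expr1 -[X in _ --> X]mulr1; apply: cvgC_mull.
  apply/cvgC_normP => e e0; move/cvgC_normP : (bin0c 0%N) => /(_ _ e0).
  apply: filterS => n; rewrite bin0 mul1r.
  by rewrite (_ : 0 - w ^+ n = - (1 - (1 - w ^+ n))) ?normcN//; ring.
have -> : series (fun n => 'C(n + k.+1, k.+1)%:R * w ^+ n : R[i]^o) =
   (fun n => (1 - w)^-1 * (series (fun i => 'C(i + k, k)%:R * w ^+ i : R[i]^o) n +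
      (-1) * ('C(n + k, k.+1)%:R * w ^+ n))).
  apply/funext => n; apply: (mulfI w0); rewrite mulrA mulfV// mul1r.
  by rewrite /series/= negbin_sum_rec mulN1r.
have -> : (1 - w) ^- k.+2 = (1 - w)^-1 * ((1 - w) ^- k.+1 + (-1) * 0).
  by rewrite mulr0 addr0 exprS invfM.
apply: cvgC_mull; apply: (cvgC_add IH); apply: cvgC_mull.
apply/cvgC_normP => e e0; move/cvgC_normP : (bin0c k.+1) => /(_ _ e0).
apply: filterS => n; rewrite !sub0r !normcN; apply: le_lt_trans.
rewrite !ComplexField.Normc.normcM ler_wpM2r ?normc_ge0//.
rewrite !normc_nat ler_nat.
by rewrite addnS binS leq_addr.
Qed.

End power_series.

(** * The weighted composition operators T_s *)

Section composition.
Context {R : realType}.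
Implicit Types (z w : R[i]) (f : R[i] -> R[i]) (a : nat -> R[i]) (s r : R).

(** The analytic self-map of the disk that fixes 1 and sends 0 to s. The operator T_s of the
    overview is [wcomp s]. *)
Definition phi s z : R[i] := s%:C / (1 - (1 - s)%:C * z).

Definition wcomp s f z : R[i] := (1 - (1 - s)%:C * z)^-1 * f (phi s z).

(** The coefficient of z^n in [wcomp s] applied to z^k, read off from s^k (1 - (1-s) z)^(-k-1). *)
Definition wcomp_term s n k : R := 'C(n + k, k)%:R * s ^+ k * (1 - s) ^+ n.

Definition wcomp_coef s a n : R[i] :=
  limn (series (fun k => (wcomp_term s n k)%:C * a k) : nat -> R[i]^o).

Lemma wcomp_term_ge0 s n k : 0 < s < 1 -> 0 <= wcomp_term s n k.
Proof. by move=> /andP[s0 s1]; rewrite !mulr_ge0 ?exprn_ge0 ?subr_ge0 ?(ltW s0) ?(ltW s1). Qed.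

Lemma normc_den_ge s z : 0 < s < 1 -> normc z < 1 ->
  1 - (1 - s) * normc z <= normc (1 - (1 - s)%:C * z).
Proof.
move=> /andP[s0 s1] z1.
have := ler_normcD (1 - (1 - s)%:C * z) ((1 - s)%:C * z).
rewrite subrK ComplexField.Normc.normc1 ComplexField.Normc.normcM normcR ger0_norm; last by rewrite subr_ge0 ltW.
lra.
Qed.

(** The majorant times the denominator exceeds s by (1-s)^2 r (1-r). A majorant affine in s is
    wanted because the integral over s of its k-th power is at most 1 / ((1-r) (k+1)); this is where
    the sums of |a_k| / (k+1) come from. *)
Lemma phi_real_bound s r : 0 < s < 1 -> 0 <= r < 1 ->
  0 <= s / (1 - (1 - s) * r) <= 1 - (1 - s) * (1 - r).
Proof.
move=> /andP[s0 s1] /andP[r0 r1].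
have d0 : 0 < 1 - (1 - s) * r by nra.
rewrite divr_ge0 ?(ltW s0) ?(ltW d0)//= ler_pdivrMr//.
suff : 0 <= (1 - s) ^+ 2 * r * (1 - r) by nra.
by rewrite !mulr_ge0 ?sqr_ge0// subr_ge0 ltW.
Qed.

Lemma normc_phi_le s z : 0 < s < 1 -> normc z < 1 ->
  normc (phi s z) <= 1 - (1 - s) * (1 - normc z).
Proof.
move=> s01 z1; have /andP[s0 s1] := s01.
have r01 : 0 <= normc z < 1 by rewrite normc_ge0.
have /andP[_] := phi_real_bound s01 r01; apply: le_trans.
have d0 : 0 < 1 - (1 - s) * normc z by have := normc_ge0 z; nra.
rewrite ComplexField.Normc.normcM ComplexField.Normc.normcV normcR gtr0_norm//.
rewrite ler_wpM2l ?(ltW s0)// lef_pV2 ?posrE ?normc_den_ge//.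
by rewrite (lt_le_trans d0)// normc_den_ge.
Qed.

Lemma phi_bound_lt1 s r : 0 < s < 1 -> 0 <= r < 1 -> 0 <= 1 - (1 - s) * (1 - r) < 1.
Proof. by move=> /andP[s0 s1] /andP[r0 r1]; apply/andP; split; nra. Qed.

Lemma phi_unit_disk s z : 0 < s < 1 -> unit_disk z -> unit_disk (phi s z).
Proof.
move=> s01 z1; rewrite /unit_disk /mkset (le_lt_trans (normc_phi_le s01 z1))//.
have r01 : 0 <= normc z < 1 by rewrite normc_ge0.
by case/andP : (phi_bound_lt1 s01 r01).
Qed.

(** The full sum over n is s^k (1 - (1-s) r)^(-k-1), that is, the k-th power of the value of [phi s]
    at r over a denominator that is at least 1 - r. *)
Lemma wcomp_term_sum_le s r k N : 0 < s < 1 -> 0 <= r < 1 ->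
  \sum_(0 <= n < N) wcomp_term s n k * r ^+ n <= (1 - (1 - s) * (1 - r)) ^+ k / (1 - r).
Proof.
move=> s01 r01; have /andP[s0 s1] := s01; have /andP[r0 r1] := r01.
have d0 : 0 < 1 - (1 - s) * r by nra.
have q01 : 0 <= (1 - s) * r < 1 by apply/andP; split; nra.
apply: (@le_trans _ _ (s ^+ k * (1 - (1 - s) * r) ^- k.+1)).
  rewrite (le_trans _ (ler_wpM2l (exprn_ge0 k (ltW s0)) (negbin_sum_le k N q01)))//.
  rewrite mulr_sumr; apply: ler_sum => n _; rewrite /wcomp_term exprMn.
  by rewrite le_eqVlt; apply/orP; left; apply/eqP; ring.
rewrite exprSr invfM mulrA -exprVn -exprMn.
have /andP[h0 h1] := phi_real_bound s01 r01.
rewrite ler_pM ?exprn_ge0 ?invr_ge0 ?(ltW d0)//; first by apply: lerXn2r; rewrite ?nnegrE// (le_trans h0 h1).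
by rewrite lef_pV2 ?posrE ?subr_gt0//; nra.
Qed.

Lemma wcomp_coef_abs_bound s a n k r : 0 < s < 1 -> 0 < r < 1 ->
  wcomp_term s n k <= r ^- n * ((1 - (1 - s) * (1 - r)) ^+ k / (1 - r)).
Proof.
move=> s01 /andP[r0 r1]; have r01 : 0 <= r < 1 by rewrite ltW.
rewrite ler_pdivlMl ?exprn_gt0// mulrC.
apply: le_trans (wcomp_term_sum_le k n.+1 s01 r01).
rewrite big_nat_recr//= lerDr sumr_ge0// => i _.
by rewrite mulr_ge0 ?exprn_ge0 ?wcomp_term_ge0// ltW.
Qed.

Lemma wcomp_coef_cvg s f a n : 0 < s < 1 -> has_power_series f a ->
  series (fun k => (wcomp_term s n k)%:C * a k : R[i]^o) @ \oo --> (wcomp_coef s a n : R[i]^o).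
Proof.
move=> s01 fa.
have r01 : 0 < (2^-1 : R) < 1 by apply/andP; split; lra.
have r01' : 0 <= (2^-1 : R) < 1 by apply/andP; split; lra.
have [M hM] := power_series_abs_bound fa (phi_bound_lt1 s01 r01').
have [l hl] : exists l : R[i], series (fun k => (wcomp_term s n k)%:C * a k : R[i]^o) @ \oo --> (l : R[i]^o).
  apply: (@abs_series_cvgC _ _ (2^-1 ^- n / (1 - 2^-1) * M)) => K.
  apply: le_trans (ler_wpM2l _ (hM K)); last first.
    by rewrite mulr_ge0 ?invr_ge0 ?exprn_ge0//; lra.
  rewrite mulr_sumr; apply: ler_sum => k _.
  rewrite ComplexField.Normc.normcM normcR ger0_norm ?wcomp_term_ge0//.
  rewrite (le_trans (ler_wpM2r (normc_ge0 _) (wcomp_coef_abs_bound a n k s01 r01)))//.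
  by rewrite le_eqVlt; apply/orP; left; apply/eqP; ring.
by rewrite /wcomp_coef (cvgC_lim hl).
Qed.

Lemma wcomp_sum_normc_le s a z k N : 0 < s < 1 -> normc z < 1 ->
  \sum_(0 <= n < N) normc ((wcomp_term s n k)%:C * a k * z ^+ n) <=
  normc (a k) * (1 - (1 - s) * (1 - normc z)) ^+ k / (1 - normc z).
Proof.
move=> s01 z1; have r01 : 0 <= normc z < 1 by rewrite normc_ge0.
rewrite -mulrA (le_trans _ (ler_wpM2l (normc_ge0 _) (wcomp_term_sum_le k N s01 r01)))//.
rewrite mulr_sumr; apply: ler_sum => n _.
rewrite !ComplexField.Normc.normcM normcX normcR ger0_norm ?wcomp_term_ge0//.
by rewrite mulrAC mulrC.
Qed.

(** The powers of [phi] are expanded by the negative binomial series and the two sums are exchanged.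
    The exchange is legitimate because the series of f converges absolutely at the radius 1 - (1-s)
    (1-|z|) < 1. *)
Lemma wcomp_power_series s f a : 0 < s < 1 -> has_power_series f a ->
  has_power_series (wcomp s f) (wcomp_coef s a).
Proof.
move=> s01 fa z z1; have r01 : 0 <= normc z < 1 by rewrite normc_ge0.
have /andP[s0 s1] := s01.
have [M hM] := power_series_abs_bound fa (phi_bound_lt1 s01 r01).
have d0 : 1 - (1 - s)%:C * z != 0.
  rewrite -normc_eq0 gt_eqF// (lt_le_trans _ (normc_den_ge s01 z1))//.
  by have := normc_ge0 z; have : normc z < 1 := z1; nra.
pose x n k := (wcomp_term s n k)%:C * a k * z ^+ n.
pose t k := (1 - (1 - s)%:C * z)^-1 * (a k * phi s z ^+ k).
pose m k := normc (a k) * (1 - (1 - s) * (1 - normc z)) ^+ k / (1 - normc z).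
apply: (@cvg_series_doubleC _ x (fun n => wcomp_coef s a n * z ^+ n) t _ m ((1 - normc z)^-1 * M)).
- by move=> k N; exact: wcomp_sum_normc_le.
- move=> K; rewrite /m -mulr_suml mulrC ler_wpM2l// invr_ge0 subr_ge0 ltW//.
- move=> n.
  have -> : series (x n : nat -> R[i]^o) = (fun K => z ^+ n * series (fun k => (wcomp_term s n k)%:C * a k : R[i]^o) K).
    by apply/funext => K; rewrite /series /x mulr_sumr; apply: eq_bigr => k _; rewrite mulrC.
  rewrite mulrC; apply: cvgC_mull; exact: wcomp_coef_cvg fa.
- move=> k.
  have -> : series (fun n => x n k : R[i]^o) = (fun N => a k * s%:C ^+ k * series (fun n => 'C(n + k, k)%:R * ((1 - s)%:C * z) ^+ n : R[i]^o) N).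
    apply/funext => K; rewrite /series /x mulr_sumr; apply: eq_bigr => n _.
    rewrite /wcomp_term !rmorphM !rmorphXn rmorph_nat exprMn; ring.
  have -> : t k = a k * s%:C ^+ k * (1 - (1 - s)%:C * z) ^- k.+1.
    by rewrite /t /phi exprMn exprVn exprSr invfM; ring.
  apply: cvgC_mull; apply: negbin_series.
  rewrite ComplexField.Normc.normcM normcR gtr0_norm ?subr_gt0//.
  by have := normc_ge0 z; have : normc z < 1 := z1; nra.
- have -> : series (t : nat -> R[i]^o) = (fun K => (1 - (1 - s)%:C * z)^-1 * series (fun k => a k * phi s z ^+ k : R[i]^o) K).
    by apply/funext => K; rewrite /series mulr_sumr.
  apply: cvgC_mull; apply: fa; exact: phi_unit_disk.
Qed.

End composition.

(** * Euler integrals *)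

Section real_integrals.
Context {R : realType}.
Local Notation mu := (@lebesgue_measure R).
Local Notation RT := (measurableTypeR R).

Lemma integral_itv_if (i : interval R) (f : R -> \bar R) :
  (\int[mu]_(x in [set` i]) f x = \int[mu]_x (if (x \in i)%R then f x else 0))%E.
Proof.
rewrite integral_mkcond; apply: eq_integral => x _.
by rewrite patchE mem_setE.
Qed.

(** The fundamental theorem of calculus applies on [1, +oo[, where the power is continuous up to the
    endpoint. *)
Lemma integral_ninf_powR (a : R) : 0 < a ->
  (\int[mu]_x (if (1 <= x)%R then (x `^ (- a - 1))%:E else 0) = (a^-1)%:E)%E.
Proof.
move=> a0.
pose F (x : R) := - (a^-1) * x `^ (- a).
have dF (x : R) : 0 < x -> is_derive x 1 F (x `^ (- a - 1)).
  move=> x0; have := is_derive1_powR (- a) x0 => h.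
  have -> : x `^ (- a - 1) = - a^-1 *: (- a * x `^ (- a - 1)).
    by rewrite /GRing.scale /= mulrA mulrNN mulVf ?mul1r// gt_eqF.
  exact: is_deriveZ.
have cf (x : R) : 0 < x -> {for x, continuous (fun x : R => x `^ (- a - 1))}.
  move=> x0; apply: differentiable_continuous; apply/derivable1_diffP.
  by apply: derivable_powR; rewrite in_itv/= x0.
have FV : F 1 = - a^-1 by rewrite /F powR1 mulr1.
transitivity (\int[mu]_(x in `[1%R, +oo[) (x `^ (- a - 1))%:E)%E.
  rewrite integral_itv_if; apply: eq_integral => x _.
  by rewrite in_itv/= andbT.
rewrite (@ge0_continuous_FTC2y _ _ F 1 0).
- by rewrite FV sub0e EFinN oppeK.
- by move=> x _; exact: powR_ge0.
- apply: continuous_in_subspaceT => x; rewrite inE/= in_itv/= andbT => x1.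
  by apply: cf; rewrite (lt_le_trans ltr01).
- apply/cvgrPdist_le => e e0; near=> x.
  have x0 : 0 < x by near: x; exact: nbhs_pinfty_gt.
  rewrite sub0r normrN /F mulNr normrN ger0_norm ?mulr_ge0 ?powR_ge0 ?invr_ge0 ?(ltW a0)//.
  rewrite ler_pdivrMl// powRN -[leRHS]invrK lef_pV2 ?posrE ?powR_gt0 ?invr_gt0 ?mulr_gt0//.
  have -> : (a * e)^-1 = ((a * e)^-1 `^ a^-1) `^ a.
    by rewrite -powRrM mulVf ?gt_eqF// powRr1// invr_ge0 mulr_ge0 ?(ltW a0)// ltW.
  apply: ge0_ler_powR; rewrite ?nnegrE ?powR_ge0 ?(ltW a0) ?(ltW x0)//.
- by move=> x x1; have [] := dF x (lt_trans ltr01 x1).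
- apply: cvg_at_right_filter; apply: differentiable_continuous; apply/derivable1_diffP.
  by have [] := dF 1 ltr01.
- move=> x; rewrite in_itv/= andbT => x1; rewrite derive1E.
  by have [_ ->] := dF x (lt_trans ltr01 x1).
Unshelve. all: by end_near. Qed.

(** The power may be singular at 0. Inversion carries ]0, 1] to [1, +oo[, where a primitive has
    already been used, and a dilation brings in t. *)
Lemma integral0_powR (a t : R) : 0 < a -> 0 < t ->
  (\int[mu]_x (if ((0 < x) && (x <= t))%R then (x `^ (a - 1))%:E else 0) = (t `^ a / a)%:E)%E.
Proof.
move=> a0 t0.
pose f (x : R) : \bar R := if x <= 1 then (x `^ (a - 1))%:E else 0%E.
have mf : measurable_fun setT f by rewrite /f; mfun.
have f0 x : (0 <= f x)%E by rewrite /f; case: ifP => // _; rewrite lee_fin powR_ge0.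
have base : (\int[mu]_x (if (0 < x)%R then f x else 0) = (a^-1)%:E)%E.
  rewrite -(integral_inv mf f0) -integral_ninf_powR//.
  apply: eq_integral => x _; case: ifPn => [x0|]; last first.
    by rewrite -leNgt => x0; rewrite (lt_geF (le_lt_trans x0 ltr01)).
  rewrite /f invf_le1//; case: ifPn => _; last by rewrite mul0e.
  rewrite -EFinM; congr EFin.
  have -> : x^-1 = x `^ (-1) :> R by rewrite powR_inv1 ?ltW.
  rewrite -powRrM -powR_mulrn ?ltW// -powRN -powRD ?(gt_eqF x0) ?implybT//.
  by congr (_ `^ _); ring.
have mg : measurable_fun [set: R] (fun x : R => if (0 < x) && (x <= t) then (x `^ (a - 1))%:E else 0%E).
  by mfun.
have mg' : measurable_fun [set: R] (fun x : R => if (0 < t * x) && (t * x <= t) then ((t * x) `^ (a - 1))%:E else 0%E).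
  by mfun.
have mh : measurable_fun [set: R] (fun x : R => if 0 < x then f x else 0%E) by mfun.
rewrite (integral_scale t0 mg); last by move=> x; case: ifP => // _; rewrite lee_fin powR_ge0.
transitivity (t%:E * ((t `^ (a - 1))%:E * \int[mu]_x (if (0 < x)%R then f x else 0)))%E; last first.
  rewrite base -!EFinM; congr EFin; rewrite mulrA mulr_powRB1 ?ltW//.
congr (_ * _)%E; rewrite -(ge0_integralZl mu measurableT (measurable_RT mh)) ?lee_fin ?powR_ge0//; last first.
  by move=> x _; case: ifP.
apply: eq_integral => x _; rewrite pmulr_rgt0// /f ger_pMr//.
case: (ltP 0 x) => /= x0; last by rewrite mule0.
case: ifPn => _; last by rewrite mule0.
by rewrite -EFinM powRM// ltW.
Qed.

Lemma integral_powR_tail (a t : R) : 0 < a -> 0 < t ->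
  (\int[mu]_x (if (t <= x)%R then (x `^ (- a - 1))%:E else 0) = (t `^ (- a) / a)%:E)%E.
Proof.
move=> a0 t0.
have mg : measurable_fun [set: R] (fun x : R => if t <= x then (x `^ (- a - 1))%:E else 0%E).
  by mfun.
have mh : measurable_fun [set: R] (fun x : R => if 1 <= x then (x `^ (- a - 1))%:E else 0%E).
  by mfun.
rewrite (integral_scale t0 mg); last by move=> x; case: ifP => // _; rewrite lee_fin powR_ge0.
transitivity (t%:E * ((t `^ (- a - 1))%:E * \int[mu]_x (if (1 <= x)%R then (x `^ (- a - 1))%:E else 0)))%E; last first.
  rewrite integral_ninf_powR// -!EFinM; congr EFin; rewrite mulrA; congr (_ / _).
  rewrite -[X in X * _]powRr1 ?ltW// -powRD ?(gt_eqF t0) ?implybT//.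
  by congr (_ `^ _); ring.
congr (_ * _)%E; rewrite -(ge0_integralZl mu measurableT (measurable_RT mh)) ?lee_fin ?powR_ge0//; last first.
  by move=> x _; case: ifP => // _; rewrite lee_fin powR_ge0.
apply: eq_integral => x _; rewrite ler_pMr//.
case: ifPn => /= x0; last by rewrite mule0.
by rewrite -EFinM powRM ?(ltW t0)// (le_trans ler01).
Qed.

Lemma integral_onem (f : R -> \bar R) : measurable_fun setT f -> (forall x, 0 <= f x)%E ->
  (\int[mu]_x f x = \int[mu]_x f (1 - x)%R)%E.
Proof.
move=> mf f0.
have h : (-1 : R) != 0 by rewrite oppr_eq0 oner_eq0.
rewrite (integral_affine 1 h mf f0) normrN1 mul1e; apply: eq_integral => x _.
by congr f; ring.
Qed.

Lemma integral1_powR (a t : R) : 0 < a -> 0 < t ->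
  (\int[mu]_x (if ((1 - t <= x) && (x < 1))%R then ((1 - x) `^ (a - 1))%:E else 0) = (t `^ a / a)%:E)%E.
Proof.
move=> a0 t0.
pose f x : \bar R := if ((1 - t <= x) && (x < 1))%R then ((1 - x) `^ (a - 1))%:E else 0%E.
have mf : measurable_fun [set: R] f by rewrite /f; mfun.
have f0 x : (0 <= f x)%E by rewrite /f; case: ifP => // _; rewrite lee_fin powR_ge0.
rewrite -(integral0_powR a0 t0) (integral_onem mf f0).
apply: eq_integral => x _.
rewrite /f; have -> : 1 - (1 - x) = x :> R by ring.
by rewrite lerD2l lerN2 gtrBl andbC.
Qed.

End real_integrals.

(** * Gamma and Beta integrals *)

Section gamma_beta.
Context {R : realType}.
Local Notation mu := (@lebesgue_measure R).
Local Notation RT := (measurableTypeR R).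

Lemma measurable_if_EFin d (T : measurableType d) (c : T -> bool) (f : T -> R) :
  measurable_fun setT c -> measurable_fun setT f ->
  measurable_fun setT (fun x => if c x then (f x)%:E else 0%E).
Proof. by move=> mc mf; apply: measurable_fun_ifT => //; exact/measurable_EFinP. Qed.

Lemma eq_mulVe (a : R) (x y : \bar R) : a != 0 -> ((a^-1)%:E * x = y -> x = a%:E * y)%E.
Proof. by move=> a0 <-; rewrite muleA -EFinM mulfV// mul1e. Qed.

Lemma integral_onem_powR (c : R) : 0 <= c ->
  (\int[mu]_x (if ((0 < x) && (x < 1))%R then ((1 - x) `^ c)%:E else 0) = ((c + 1)^-1)%:E)%E.
Proof.
move=> c0; have c1 : 0 < c + 1 by lra.
have := @integral1_powR R (c + 1) 1 c1 ltr01.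
rewrite powR1 div1r subrr addrK => <-.
transitivity (\int[mu]_(x in `]0%R, 1%R[) ((1 - x) `^ c)%:E)%E.
  by rewrite integral_itv_if.
transitivity (\int[mu]_(x in `[0%R, 1%R[) ((1 - x) `^ c)%:E)%E; last by rewrite integral_itv_if.
apply: integral_itv_obnd_cbnd; apply: measurable_funTS; apply: measurable_RT.
by apply/measurable_EFinP; mfun.
Qed.

(** Integration by parts in the form of Tonelli's theorem: x^k (1-y)^c over the triangle 0 < x <= y
    < 1 is integrated in both orders. *)
Lemma beta_int_rec k (c : R) : 0 <= c ->
  (\int[mu]_x (if ((0 < x) && (x < 1))%R then (x ^+ k.+1 * (1 - x) `^ c)%:E else 0) =
   (k.+1%:R / (c + 1))%:E *
   \int[mu]_x (if ((0 < x) && (x < 1))%R then (x ^+ k * (1 - x) `^ (c + 1))%:E else 0))%E.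
Proof.
move=> c0; have c1 : 0 < c + 1 by lra.
pose K (w : R * R) : \bar R := if (0 < w.1) && (w.1 <= w.2) && (w.2 < 1) then
   (w.1 ^+ k * (1 - w.2) `^ c)%:E else 0%E.
have mK : measurable_fun setT K by rewrite /K; apply: measurable_if_EFin; mfun.
have K0 w : (0 <= K w)%E.
  rewrite /K; case: ifP => // /andP[/andP[w0 _] _].
  by rewrite lee_fin mulr_ge0 ?powR_ge0// exprn_ge0// ltW.
have E1 : (\int[leb2]_w K w = ((c + 1)^-1)%:E *
  \int[mu]_x (if ((0 < x) && (x < 1))%R then (x ^+ k * (1 - x) `^ (c + 1))%:E else 0))%E.
  rewrite (tonelli1 mK K0).
  have m1 : measurable_fun [set: R] (fun x : R => if (0 < x) && (x < 1) then (x ^+ k * (1 - x) `^ (c + 1))%:E else 0%E).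
    by apply: measurable_if_EFin; mfun.
  rewrite -(ge0_integralZl mu measurableT (measurable_RT m1)) ?lee_fin ?invr_ge0 ?(ltW c1)//; last first.
    move=> x _; case: ifP => // /andP[x0 _]; rewrite lee_fin mulr_ge0 ?powR_ge0// exprn_ge0//.
    exact: ltW.
  apply: eq_integral => x _; case: ifPn => [/andP[x0 x1]|x01]; last first.
    rewrite mule0 integral0_eq// => y _; rewrite /K /=; case: ifP => // /andP[/andP[x0 xy] y1].
    by move: x01; rewrite x0 (le_lt_trans xy y1).
  have x1' : 0 < 1 - (x : R) by rewrite subr_gt0.
  have m2 : measurable_fun [set: R] (fun y : R => if (1 - (1 - (x : R)) <= y) && (y < 1) then ((1 - y) `^ (c + 1 - 1))%:E else 0%E).
    by apply: measurable_if_EFin; mfun.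
  have := @integral1_powR R (c + 1) (1 - x) c1 x1'.
  rewrite mulrC EFinM => /(congr1 (fun z => (x ^+ k)%:E * z)%E).
  rewrite muleCA -EFinM => <-.
  rewrite -(ge0_integralZl mu measurableT (measurable_RT m2)) ?lee_fin ?exprn_ge0 ?(ltW x0)//; last first.
    by move=> y _; case: ifP => // _; rewrite lee_fin powR_ge0.
  apply: eq_integral => y _; rewrite /K /= x0 /= (_ : 1 - (1 - x) = x)%R; last by ring.
  by case: ifPn => _; rewrite ?mule0// -EFinM addrK.
have E2 : (\int[leb2]_w K w = (k.+1%:R^-1)%:E *
  \int[mu]_x (if ((0 < x) && (x < 1))%R then (x ^+ k.+1 * (1 - x) `^ c)%:E else 0))%E.
  rewrite (tonelli2 mK K0).
  have m1 : measurable_fun [set: R] (fun x : R => if (0 < x) && (x < 1) then (x ^+ k.+1 * (1 - x) `^ c)%:E else 0%E).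
    by apply: measurable_if_EFin; mfun.
  rewrite -(ge0_integralZl mu measurableT (measurable_RT m1)) ?lee_fin ?invr_ge0//; last first.
    move=> x _; case: ifP => // /andP[x0 _]; rewrite lee_fin mulr_ge0 ?powR_ge0// exprn_ge0//.
    exact: ltW.
  apply: eq_integral => y _; case: ifPn => [/andP[y0 y1]|y01]; last first.
    rewrite mule0 integral0_eq// => x _; rewrite /K /=; case: ifP => // /andP[/andP[x0 xy] y1].
    by move: y01; rewrite y1 (lt_le_trans x0 xy).
  have m2 : measurable_fun [set: R] (fun x : R => if (0 < x) && (x <= (y : R)) then (x `^ (k.+1%:R - 1))%:E else 0%E).
    by apply: measurable_if_EFin; mfun.
  have := @integral0_powR R k.+1%:R y (ltr0Sn _ _) y0.
  rewrite powR_mulrn ?ltW// => /(congr1 (fun z => ((1 - y) `^ c)%:E * z)%E).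
  rewrite -!EFinM (_ : _ * (_ / _) = k.+1%:R^-1 * (y ^+ k.+1 * (1 - y) `^ c))%R; last by ring.
  move=> <-.
  rewrite -(ge0_integralZl mu measurableT (measurable_RT m2)) ?lee_fin ?powR_ge0//; last first.
    by move=> x _; case: ifP => // _; rewrite lee_fin powR_ge0.
  apply: eq_integral => x _; rewrite /K /= y1 andbT.
  case: ifPn => [/andP[x0 _]|]; rewrite ?mule0// -EFinM; congr EFin.
  by rewrite -natr1 addrK powR_mulrn 1?mulrC// ltW.
rewrite EFinM -muleA -E1; apply: eq_mulVe; first by rewrite pnatr_eq0.
exact: esym E2.
Qed.

(** The integral with values in [0, +oo], for which the functional equation can be proved ahead of
    finiteness. *)
Definition GammaE (x : R) : \bar R :=
  (\int[mu]_t (if (0 < t)%R then (t `^ (x - 1) * expR (- t))%:E else 0))%E.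

Lemma GammaE_ge0 x : (0 <= GammaE x)%E.
Proof.
apply: integral_ge0 => t _; case: ifP => // _.
by rewrite lee_fin mulr_ge0 ?powR_ge0 ?expR_ge0.
Qed.

Lemma measurable_fun_expR d (T : measurableType d) (f : T -> R) : measurable_fun setT f ->
  measurable_fun setT (fun x => expR (f x)).
Proof. by move=> mf; apply: (measurableT_comp (@measurable_expR R)). Qed.

Lemma expR_tail (u : R) : (\int[mu]_t (if (u <= t)%R then (expR (- t))%:E else 0) = (expR (- u))%:E)%E.
Proof.
have m1 : measurable_fun [set: R] (fun t : R => if u <= t then (expR (- t))%:E else 0%E).
  by apply: measurable_if_EFin; mfun; apply: measurable_fun_expR; mfun.
have m2 : measurable_fun [set: R] (fun t : R => if 0 <= t then (expR (- t))%:E else 0%E).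
  by apply: measurable_if_EFin; mfun; apply: measurable_fun_expR; mfun.
rewrite (integral_affine u (oner_neq0 R) m1) ?normr1 ?mul1e; last first.
  by move=> x; case: ifP => // _; rewrite lee_fin expR_ge0.
transitivity ((expR (- u))%:E * \int[mu]_t (if (0 <= t)%R then (expR (- t))%:E else 0))%E.
  rewrite -(ge0_integralZl mu measurableT (measurable_RT m2)) ?lee_fin ?expR_ge0//; last first.
    by move=> x _; case: ifP => // _; rewrite lee_fin expR_ge0.
  apply: eq_integral => x _; rewrite mul1r lerDr; case: ifP => _; rewrite ?mule0//.
  by rewrite -EFinM -expRD; congr (expR _)%:E; ring.
rewrite -[RHS]mule1 -(@integral_exponential_pdf R 1 ltr01); congr (_ * _)%E.
apply: eq_integral => x _; rewrite /exponential_pdf patchE mem_setE in_itv/= andbT.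
by case: ifP => // _; rewrite mulN1r mul1r.
Qed.

(** Integration by parts again as two orders of integration, now of u^(x-1) e^(-t) over 0 < u <=
    t. *)
Lemma GammaE_rec x : 0 < x -> GammaE (x + 1) = (x%:E * GammaE x)%E.
Proof.
move=> x0.
pose K (w : R * R) : \bar R := if (0 < w.1) && (w.1 <= w.2) then
   (w.1 `^ (x - 1) * expR (- w.2))%:E else 0%E.
have mK : measurable_fun setT K by rewrite /K; apply: measurable_if_EFin; mfun; apply: measurable_fun_expR; mfun.
have K0 w : (0 <= K w)%E.
  by rewrite /K; case: ifP => // _; rewrite lee_fin mulr_ge0 ?powR_ge0 ?expR_ge0.
have m0 y : measurable_fun [set: R] (fun t : R => if 0 < t then (t `^ (y - 1) * expR (- t))%:E else 0%E).
  by apply: measurable_if_EFin; mfun; apply: measurable_fun_expR; mfun.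
have E1 : (\int[leb2]_w K w = GammaE x)%E.
  rewrite (tonelli1 mK K0); apply: eq_integral => u _; rewrite /K /=.
  case: (ltP 0 u) => u0 /=; last by rewrite integral0.
  rewrite EFinM -expR_tail.
  have m2 : measurable_fun [set: R] (fun t : R => if (u : R) <= t then (expR (- t))%:E else 0%E).
    by apply: measurable_if_EFin; mfun; apply: measurable_fun_expR; mfun.
  rewrite -(ge0_integralZl mu measurableT (measurable_RT m2)) ?lee_fin ?powR_ge0//; last first.
    by move=> y _; case: ifP => // _; rewrite lee_fin expR_ge0.
  by apply: eq_integral => t _; case: ifP => _; rewrite ?mule0// EFinM.
have E2 : (\int[leb2]_w K w = (x^-1)%:E * GammaE (x + 1))%E.
  rewrite (tonelli2 mK K0).
  rewrite -(ge0_integralZl mu measurableT (measurable_RT (m0 _))) ?lee_fin ?invr_ge0 ?(ltW x0)//; last first.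
    by move=> y _; case: ifP => // _; rewrite lee_fin mulr_ge0 ?powR_ge0 ?expR_ge0.
  apply: eq_integral => t _; rewrite /K /=.
  case: (ltP 0 t) => t0 /=; last first.
    rewrite mule0 integral0_eq// => u _; case: ifP => // /andP[u0 ut].
    by have := lt_le_trans u0 (le_trans ut t0); rewrite ltxx.
  have := @integral0_powR R x t x0 t0 => /(congr1 (fun z => (expR (- t))%:E * z)%E).
  rewrite -[X in _ = X -> _]EFinM addrK (_ : _ * (_ / _) = x^-1 * (t `^ x * expR (- t)))%R; last by ring.
  rewrite EFinM => <-.
  have m2 : measurable_fun [set: R] (fun u : R => if (0 < u) && (u <= (t : R)) then (u `^ (x - 1))%:E else 0%E).
    by apply: measurable_if_EFin; mfun.
  rewrite -(ge0_integralZl mu measurableT (measurable_RT m2)) ?lee_fin ?expR_ge0//; last first.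
    by move=> y _; case: ifP => // _; rewrite lee_fin powR_ge0.
  by apply: eq_integral => u _; case: ifP => _; rewrite ?mule0// -EFinM mulrC.
apply: eq_mulVe; first by rewrite gt_eqF.
exact: etrans (esym E2) E1.
Qed.

Lemma GammaE1 : GammaE 1 = 1%E.
Proof.
have := expR_tail 0; rewrite oppr0 expR0 => <-.
transitivity (\int[mu]_(t in `]0%R, +oo[) (expR (- t))%:E)%E.
  rewrite integral_itv_if; apply: eq_integral => t _.
  by rewrite in_itv/= andbT subrr powRr0 mul1r.
transitivity (\int[mu]_(t in `[0%R, +oo[) (expR (- t))%:E)%E.
  apply: integral_itv_obnd_cbnd; apply: measurable_funTS; apply: measurable_RT.
  by apply/measurable_EFinP; apply: measurable_fun_expR; mfun.
by rewrite integral_itv_if; apply: eq_integral => t _; rewrite in_itv/= andbT.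
Qed.

Lemma GammaE_nat n : GammaE (n%:R + 1) = (n`!%:R)%:E.
Proof.
elim: n => [|n IH]; first by rewrite add0r GammaE1.
by rewrite -natr1 GammaE_rec ?IH -?EFinM ?factS ?natrM// natr1.
Qed.

End gamma_beta.

Section hilbert_weights.
Context {R : realType}.
Local Notation mu := (@lebesgue_measure R).
Local Notation RT := (measurableTypeR R).

Implicit Types (x b c : R).

(** The power t^(x-1) is at most 1 + t^n for a natural number n >= x - 1, and the integrals of both
    summands are factorials. *)
Lemma GammaE_fin x : 1 <= x -> GammaE x \is a fin_num.
Proof.
move=> x1; rewrite ge0_fin_numE ?GammaE_ge0//.
pose n := Num.truncn x.
have m0 y : measurable_fun [set: R] (fun t : R => if 0 < t then (t `^ (y - 1) * expR (- t))%:E else 0%E).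
  by apply: measurable_if_EFin; mfun; apply: measurable_fun_expR; mfun.
have P0 (y t : R) : (0 <= if (0 < t)%R then (t `^ (y - 1) * expR (- t))%:E else 0)%E.
  by case: ifP => // _; rewrite lee_fin mulr_ge0 ?powR_ge0 ?expR_ge0.
apply: (@le_lt_trans _ _ (GammaE 1 + GammaE (n%:R + 1))%E); last first.
  by rewrite GammaE1 GammaE_nat -EFinD ltry.
rewrite /GammaE -(ge0_integralD mu measurableT (fun x _ => P0 1 x) (measurable_RT (m0 1))
  (fun x _ => P0 (n%:R + 1) x) (measurable_RT (m0 (n%:R + 1)))).
apply: le_integral_leb => //; first by apply: emeasurable_funD.
move=> t /=; case: ifP => [t0|]; last by rewrite adde0.
rewrite -EFinD lee_fin -mulrDl ler_wpM2r ?expR_ge0//.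
rewrite subrr powRr0 addrK.
have [t1|t1] := leP t 1.
  rewrite (@le_trans _ _ 1)// ?lerDl ?powR_ge0// -[leRHS](powRr0 t).
  by apply: ger_powR; rewrite ?t0// subr_ge0.
rewrite (@le_trans _ _ (t `^ n%:R))// ?lerDr//; apply: ler_powR; first exact: ltW.
by rewrite lerBlDr natr1 ltW// truncnS_gt.
Qed.

Lemma GammaE_gt0 x : (0 < GammaE x)%E.
Proof.
have m0 y : measurable_fun [set: R] (fun t : R => if 0 < t then (t `^ (y - 1) * expR (- t))%:E else 0%E).
  by apply: measurable_if_EFin; mfun; apply: measurable_fun_expR; mfun.
(* A lower bound of the integrand on ]1, 2[; the sign of x - 1 decides at which end the power is
   smallest. *)
pose e := (if 1 <= x then 1 else 2 `^ (x - 1)) * expR (- 2) : R.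
have e0 : 0 < e.
  by rewrite /e mulr_gt0 ?expR_gt0//; case: ifP => _; rewrite ?powR_gt0.
have m1 : measurable_fun [set: R] (fun t : R => if (1 < t) && (t < 2) then 1%E else 0%E : \bar R).
  by mfun.
apply: (@lt_le_trans _ _ (e%:E * (2 - 1)%:E)%E).
  by rewrite -EFinM lte_fin; lra.
rewrite -integral_ltr_itv ?ler1n// -(ge0_integralZl mu measurableT (measurable_RT m1)) ?lee_fin ?(ltW e0)//; last first.
  by move=> t _; case: ifP.
apply: le_integral_leb => //; first by apply: emeasurable_funM => //; mfun.
  by move=> t; case: ifP; rewrite ?mule0// mule1 lee_fin ltW.
move=> t; case: ifPn => [/andP[t1 t2]|_]; last first.
  by rewrite mule0; case: ifP => // _; rewrite lee_fin mulr_ge0 ?powR_ge0 ?expR_ge0.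
rewrite mule1 (lt_trans ltr01 t1) lee_fin ler_pM ?expR_ge0//.
- by case: ifP => _; rewrite ?powR_ge0.
- case: ifPn => [x1|]; first by rewrite -[leLHS](powRr0 t) ler_powR ?subr_ge0// ltW.
  rewrite -ltNge => x1; have -> : x - 1 = - (1 - x) by ring.
  have : 0 < 1 - x by lra.
  move: (1 - x) => y y0; have t0 : 0 < t by exact: lt_trans t1.
  rewrite !powRN lef_pV2 ?posrE ?powR_gt0//.
  by apply: ge0_ler_powR; rewrite ?nnegrE; lra.
- by rewrite ler_expR; lra.
Qed.

Lemma GammaEE x : Gamma x = fine (GammaE x).
Proof.
rewrite /Gamma /Rintegral integral_itv_if; congr fine.
by apply: eq_integral => t _; rewrite in_itv/= andbT.
Qed.

Lemma Gamma_gt0 x : 1 <= x -> 0 < Gamma x.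
Proof.
move=> x1; rewrite GammaEE; have := GammaE_gt0 x.
by rewrite -{1}(fineK (GammaE_fin x1)) lte_fin.
Qed.

Lemma Gamma_rec x : 1 <= x -> Gamma (x + 1) = x * Gamma x.
Proof.
move=> x1; rewrite !GammaEE GammaE_rec ?(lt_le_trans ltr01)//.
by rewrite fineM ?GammaE_fin.
Qed.

Lemma Gamma_nat n : Gamma (n%:R + 1 : R) = n`!%:R.
Proof. by rewrite GammaEE GammaE_nat. Qed.

Lemma beta_int_nat k (c : R) : 0 <= c ->
  (\int[mu]_x (if ((0 < x) && (x < 1))%R then (x ^+ k * (1 - x) `^ c)%:E else 0) =
  (k`!%:R * Gamma (c + 1) / Gamma (c + k%:R + 2))%:E)%E.
Proof.
elim: k c => [|k IH] c c0.
  have := integral_onem_powR c0 => h.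
  transitivity (((c + 1)^-1)%:E : \bar R).
    by rewrite -h; apply: eq_integral => x _; rewrite expr0 mul1r.
  have -> : c + 0%:R + 2 = (c + 1) + 1 by ring.
  rewrite (@Gamma_rec (c + 1)); last by lra.
  have G0 := Gamma_gt0 (_ : 1 <= c + 1).
  congr EFin; rewrite fact0 mul1r; field.
  by rewrite gt_eqF ?gt_eqF ?G0//; lra.
rewrite beta_int_rec// IH ?addr_ge0// -EFinM; congr EFin.
have -> : c + 1 + k%:R + 2 = c + k.+1%:R + 2 by rewrite -natr1; ring.
rewrite (@Gamma_rec (c + 1)); last by lra.
rewrite factS natrM; have G0 : 0 < Gamma (c + k.+1%:R + 2) by apply: Gamma_gt0; have := ler0n R k.+1; lra.
by field; rewrite !gt_eqF//; lra.
Qed.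

(** The point of contact between the matrix of the operator and the average over s: a Beta integral
    in which the binomial coefficient turns k! into (n+k)! / n!. *)
Lemma hilbert_weight_integral b n k : 0 <= b ->
  (\int[mu]_s (if ((0 < s) && (s < 1))%R then ((1 - s) `^ b * wcomp_term s n k)%:E else 0) =
   (hilbert_weight b n k)%:E)%E.
Proof.
move=> b0; have bn0 : 0 <= b + n%:R by rewrite addr_ge0.
have m1 : measurable_fun [set: R] (fun x : R => if (0 < x) && (x < 1) then (x ^+ k * (1 - x) `^ (b + n%:R))%:E else 0%E).
  by apply: measurable_if_EFin; mfun.
transitivity (('C(n + k, k)%:R)%:E * \int[mu]_x (if ((0 < x) && (x < 1))%R then (x ^+ k * (1 - x) `^ (b + n%:R))%:E else 0))%E.
  rewrite -(ge0_integralZl mu measurableT (measurable_RT m1)) ?lee_fin//; last first.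
    move=> x _; case: ifP => // /andP[x0 _]; rewrite lee_fin mulr_ge0 ?powR_ge0// exprn_ge0//.
    exact: ltW.
  apply: eq_integral => s _; case: ifP => [/andP[s0 s1]|_]; last by rewrite mule0.
  rewrite -EFinM /wcomp_term; congr EFin.
  have s1' : 0 < 1 - (s : R) by rewrite subr_gt0.
  rewrite powRD ?(gt_eqF s1') ?implybT// powR_mulrn ?(ltW s1')//; ring.
rewrite beta_int_nat// -EFinM /hilbert_weight; congr EFin.
rewrite -natrD (Gamma_nat n) (Gamma_nat (n + k)) natrD.
have -> : n%:R + b + 1 = b + n%:R + 1 by ring.
have -> : n%:R + k%:R + b + 2 = b + n%:R + k%:R + 2 by ring.
have G0 : 0 < Gamma (b + n%:R + k%:R + 2) by apply: Gamma_gt0; have := ler0n R n; have := ler0n R k; lra.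
have := bin_fact (leq_addl n k); rewrite addnK => /(congr1 (fun m => m%:R : R)).
rewrite !natrM => <-; field.
by rewrite gt_eqF//= pnatr_eq0 -lt0n fact_gt0.
Qed.

End hilbert_weights.

(** * Integral representation *)

Section complex_integral.
Context {R : realType}.
Local Notation mu := (@lebesgue_measure R).
Local Notation RT := (measurableTypeR R).
Implicit Types (z w c : R[i]) (F : R -> R[i]).

Definition I01 : set R := `]0, 1[%classic.

Lemma I01P (s : R) : I01 s <-> 0 < s < 1.
Proof. by rewrite /I01 /= in_itv. Qed.

Lemma mI01 : measurable (I01 : set RT). Proof. exact: measurable_itv. Qed.

Definition Cint F : R[i] :=
  (\int[mu]_(s in I01) Re (F s))%R +i* (\int[mu]_(s in I01) Im (F s))%R.

(** Dominated convergence for the partial sums. The majorant bounds sums of moduli, so it also makes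
    each single term integrable. *)
Lemma series_Rintegral_dominated (x : nat -> R -> R) (f dm : R -> R) :
  (forall n, measurable_fun I01 (x n)) ->
  (forall s, I01 s -> forall n, \sum_(0 <= k < n) `|x k s| <= dm s) ->
  mu.-integrable I01 (EFin \o dm) ->
  (forall s, I01 s -> series (x ^~ s) @ \oo --> f s) ->
  [/\ forall n, mu.-integrable I01 (EFin \o x n), mu.-integrable I01 (EFin \o f) &
   series (fun n => \int[mu]_(s in I01) x n s)%R @ \oo --> (\int[mu]_(s in I01) f s)%R].
Proof.
move=> mx xdm idm xf.
have dm0 s : I01 s -> 0 <= dm s by move=> /xdm/(_ 0%N); rewrite big_geq.
have ix n : mu.-integrable I01 (EFin \o x n).
  apply: (le_integrable mI01 _ _ idm); first by apply/measurable_EFinP; exact: mx.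
  move=> s Is /=; rewrite lee_fin [leRHS]ger0_norm ?dm0//.
  rewrite (le_trans _ (xdm s Is n.+1))// big_nat_recr//= lerDr.
  exact: sumr_ge0.
have mS n : measurable_fun I01 (fun s => series (x ^~ s) n).
  by rewrite /series; apply: measurable_sum.
have mf : measurable_fun I01 f by apply: (measurable_fun_cvg mS).
have Sdm n s : I01 s -> `|series (x ^~ s) n| <= dm s.
  by move=> Is; rewrite (le_trans (ler_norm_sum _ _ _))// xdm.
pose f_ n (s : RT) : \bar R := (series (x ^~ s) n)%:E.
have a1 n : measurable_fun (I01 : set RT) (f_ n) by apply/measurable_EFinP; exact: mS.
have a2 : measurable_fun (I01 : set RT) (EFin \o f) by apply/measurable_EFinP; exact: mf.
have a3 : {ae mu, forall s, I01 s -> f_ ^~ s @ \oo --> (EFin \o f) s}.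
  by apply: aeW => s Is; apply: cvg_EFin; [exact: nearW | exact: xf].
have a4 : {ae mu, forall s n, I01 s -> (`|f_ n s| <= (EFin \o dm) s)%E}.
  by apply: aeW => s n Is; rewrite lee_fin; exact: Sdm.
have [if_ _ h] := dominated_convergence mI01 a1 a2 a3 idm a4.
split => //.
have SE n : (\int[mu]_(s in I01) (series (x ^~ s) n)%:E)%E =
    (series (fun n => \int[mu]_(s in I01) x n s)%R n)%:E.
  rewrite /series /=.
  under eq_integral do rewrite -sumEFin.
  rewrite (integral_sum mI01 ix) -sumEFin; apply: eq_bigr => k _.
  by rewrite /Rintegral fineK// (integrable_fin_num mI01 (ix k)).
have iffin : (\int[mu]_(s in I01) (EFin \o f) s)%E = (\int[mu]_(s in I01) f s)%R%:E.
  by rewrite /Rintegral fineK// (integrable_fin_num mI01 if_).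
move: h; rewrite iffin; under eq_fun do rewrite SE.
by move=> /fine_cvg.
Qed.

Lemma RintegralM_cst (c : R) (f : R -> R) : mu.-integrable I01 (EFin \o f) ->
  (\int[mu]_(s in I01) (c * f s) = c * \int[mu]_(s in I01) f s)%R.
Proof. by move=> fi; rewrite RintegralZl//; exact: mI01. Qed.

Lemma Cint_mulr F c : mu.-integrable I01 (EFin \o (fun s => Re (F s))) ->
  mu.-integrable I01 (EFin \o (fun s => Im (F s))) ->
  Cint (fun s => c * F s) = c * Cint F.
Proof.
move=> h1 h2; case: c => a b; rewrite /Cint.
have RM s : Re ((a +i* b) * F s) = a * Re (F s) - b * Im (F s) by case: (F s).
have IM s : Im ((a +i* b) * F s) = a * Im (F s) + b * Re (F s) by case: (F s).
under eq_Rintegral do rewrite RM.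
under [X in _ +i* X = _]eq_Rintegral do rewrite IM.
have ZI d g : mu.-integrable I01 (EFin \o g) -> mu.-integrable I01 (EFin \o (fun s => d * g s)).
  by move=> gi; exact: (integrableZl mI01 d gi).
rewrite (RintegralB mI01 (ZI _ _ h1) (ZI _ _ h2)).
rewrite (RintegralD mI01 (ZI _ _ h2) (ZI _ _ h1)).
by rewrite !RintegralM_cst.
Qed.

(** With C the integral, |C|^2 is the integral of the real part of conj(C) F, hence at most |C|
    times the integral of |F|. *)
Lemma Cint_norm_le F : mu.-integrable I01 (EFin \o (fun s => Re (F s))) ->
  mu.-integrable I01 (EFin \o (fun s => Im (F s))) ->
  ((normc (Cint F))%:E <= \int[mu]_(s in I01) (normc (F s))%:E)%E.
Proof.
move=> h1 h2.
have mn : measurable_fun I01 (fun s => normc (F s)).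
  have -> : (fun s => normc (F s)) = (fun s => Num.sqrt (Re (F s) ^+ 2 + Im (F s) ^+ 2)).
    by apply/funext => s; rewrite -sqr_normcE sqrtr_sqr ger0_norm ?normc_ge0.
  apply: measurable_fun_sqrt; apply: measurable_funD; apply: measurable_funX.
    by have /measurable_int/measurable_EFinP := h1.
  by have /measurable_int/measurable_EFinP := h2.
have [->|C0] := eqVneq (Cint F) 0.
  by rewrite ComplexField.Normc.normc0 integral_ge0// => s _; rewrite lee_fin normc_ge0.
set C := Cint F; have N0 : 0 < normc C by rewrite lt_neqAle normc_ge0 eq_sym normc_eq0 C0.
have iZ (d : R) g : mu.-integrable I01 (EFin \o g) -> mu.-integrable I01 (EFin \o (fun s => d * g s)).
  by move=> gi; exact: (integrableZl mI01 d gi).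
have iL : mu.-integrable I01 (EFin \o (fun s => Re C * Re (F s) + Im C * Im (F s))).
  by apply: (integrableD mI01 (iZ _ _ h1) (iZ _ _ h2)).
have E : normc C ^+ 2 = (\int[mu]_(s in I01) (Re C * Re (F s) + Im C * Im (F s)))%R.
  rewrite (RintegralD mI01 (iZ _ _ h1) (iZ _ _ h2)).
  by rewrite !RintegralM_cst// sqr_normcE !expr2.
clearbody C.
suff : ((normc C ^+ 2)%:E <= (normc C)%:E * \int[mu]_(s in I01) (normc (F s))%:E)%E.
  by rewrite expr2 EFinM lee_pmul2l.
rewrite -ge0_integralZl//; last 4 first.
- exact: mI01.
- by apply/measurable_EFinP; exact: mn.
- by move=> s _; rewrite lee_fin normc_ge0.
- by rewrite lee_fin normc_ge0.
rewrite E /Rintegral fineK ?(integrable_fin_num mI01 iL)//.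
apply: (le_trans (lee_abs _)).
apply: (le_trans (le_abse_integral mu mI01 (measurable_int mu iL))).
apply: ge0_le_integral => //.
- exact: mI01.
- by apply: measurableT_comp => //; exact: (measurable_int mu iL).
- apply: emeasurable_funM; first exact: measurable_cst.
  by apply/measurable_EFinP; exact: mn.
- move=> s _; rewrite /= lee_fin.
  rewrite -ler_sqr ?nnegrE ?mulr_ge0 ?normc_ge0// real_normK ?num_real//.
  rewrite exprMn !sqr_normcE.
  move: (Re C) (Im C) (Re (F s)) (Im (F s)) => c1 c2 d1 d2.
  by rewrite -subr_ge0 (_ : _ - _ = (c1 * d2 - c2 * d1) ^+ 2) ?sqr_ge0//; ring.
Qed.

Lemma Cint_series (X : nat -> R -> R[i]) F (dm : R -> R) :
  (forall n, measurable_fun I01 (fun s => Re (X n s))) ->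
  (forall n, measurable_fun I01 (fun s => Im (X n s))) ->
  (forall s, I01 s -> forall n, \sum_(0 <= k < n) normc (X k s) <= dm s) ->
  mu.-integrable I01 (EFin \o dm) ->
  (forall s, I01 s -> series (fun n => X n s : R[i]^o) @ \oo --> (F s : R[i]^o)) ->
  [/\ (forall n, mu.-integrable I01 (EFin \o (fun s => Re (X n s)))),
   (forall n, mu.-integrable I01 (EFin \o (fun s => Im (X n s)))),
   mu.-integrable I01 (EFin \o (fun s => Re (F s))),
   mu.-integrable I01 (EFin \o (fun s => Im (F s))) &
   series (fun n => Cint (X n) : R[i]^o) @ \oo --> (Cint F : R[i]^o)].
Proof.
move=> mR mI Xdm idm XF.
have [h1 h2 h3] : [/\ (forall n, mu.-integrable I01 (EFin \o (fun s => Re (X n s)))),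
   mu.-integrable I01 (EFin \o (fun s => Re (F s))) &
   series (fun n => \int[mu]_(s in I01) Re (X n s))%R @ \oo --> (\int[mu]_(s in I01) Re (F s))%R].
  apply: (series_Rintegral_dominated mR _ idm) => s Is.
    by move=> n; rewrite (le_trans _ (Xdm s Is n))// ler_sum// => k _; exact: ler_normc_Re.
  by have /cvgCP[+ _] := XF s Is; under eq_fun do rewrite /series/= Re_sum.
have [h4 h5 h6] : [/\ (forall n, mu.-integrable I01 (EFin \o (fun s => Im (X n s)))),
   mu.-integrable I01 (EFin \o (fun s => Im (F s))) &
   series (fun n => \int[mu]_(s in I01) Im (X n s))%R @ \oo --> (\int[mu]_(s in I01) Im (F s))%R].
  apply: (series_Rintegral_dominated mI _ idm) => s Is.
    by move=> n; rewrite (le_trans _ (Xdm s Is n))// ler_sum// => k _; exact: ler_normc_Im.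
  by have /cvgCP[_ +] := XF s Is; under eq_fun do rewrite /series/= Im_sum.
split => //; apply/cvgCP; split => /=.
- by under eq_fun do rewrite /series/= Re_sum.
- by under eq_fun do rewrite /series/= Im_sum.
Qed.

End complex_integral.

Section hilbert_formula.
Context {R : realType}.
Local Notation mu := (@lebesgue_measure R).
Local Notation RT := (measurableTypeR R).
Variables (f : R[i] -> R[i]) (a : nat -> R[i]) (S : R).
Hypothesis fa : has_power_series f a.
Hypothesis aS : forall K, \sum_(0 <= k < K) normc (a k) / k.+1%:R <= S.

Let u (r s : R) k := normc (a k) * (1 - (1 - s) * (1 - r)) ^+ k / (1 - r).

(** A majorant, integrable in s, of the double series of [wcomp s f] at radius r. The same one
    serves for single coefficients, at r = 1/2, and for the whole Taylor series, at r = |z|. *)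
Definition wdom (r s : R) : R := limn (series (u r s)).

Let u_ge0 r s k : 0 <= r < 1 -> I01 s -> 0 <= u r s k.
Proof.
move=> r01 /I01P s01; have /andP[q0 _] := phi_bound_lt1 s01 r01.
by rewrite !mulr_ge0 ?normc_ge0 ?exprn_ge0// invr_ge0 subr_ge0 ltW//; case/andP : r01.
Qed.

Let u_cvg r s : 0 <= r < 1 -> I01 s -> cvgn (series (u r s)).
Proof.
move=> r01 Is; have s01 := (I01P s).1 Is.
have [M hM] := power_series_abs_bound fa (phi_bound_lt1 s01 r01).
apply: (@nneg_series_cvg _ _ (M / (1 - r))) => [k|n]; first exact: u_ge0.
rewrite /u -mulr_suml ler_wpM2r ?hM// invr_ge0 subr_ge0 ltW//.
by case/andP : r01.
Qed.

Lemma integral_I01 (g : R -> \bar R) :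
  (\int[mu]_(s in I01) g s = \int[mu]_s (if ((0 < s) && (s < 1))%R then g s else 0))%E.
Proof. by rewrite integral_itv_if; apply: eq_integral => s _; rewrite in_itv. Qed.

Lemma wdom_ge r s n : 0 <= r < 1 -> I01 s -> \sum_(0 <= k < n) u r s k <= wdom r s.
Proof.
move=> r01 Is; apply: (nondecreasing_cvgn_le _ (u_cvg r01 Is)).
by apply: nondecreasing_series => // k _ _; exact: u_ge0.
Qed.

Let mu_ r k : measurable_fun setT (fun s => u r s k).
Proof. by rewrite /u; mfun. Qed.

(** Substitute q = r + (1-r) s and enlarge the range ]r, 1[ to ]0, 1]. *)
Let int_pow r k : 0 <= r < 1 ->
  (\int[mu]_(s in I01) ((1 - (1 - s) * (1 - r)) ^+ k)%:E <= ((1 - r)^-1 / k.+1%:R)%:E)%E.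
Proof.
move=> /andP[r0 r1]; have r1' : 0 < 1 - r by rewrite subr_gt0.
rewrite integral_I01.
pose g (q : R) : \bar R := if (0 < q) && (q <= 1) then (q `^ (k.+1%:R - 1))%:E else 0%E.
have mg : measurable_fun setT g by rewrite /g; apply: measurable_if_EFin; mfun.
have g0 q : (0 <= g q)%E by rewrite /g; case: ifP => // _; rewrite lee_fin powR_ge0.
have mg' : measurable_fun setT (fun q => g ((1 - r) * q + r)).
  by apply: (measurableT_comp mg); mfun.
have rn0 : 1 - r != 0 by rewrite gt_eqF.
have := @integral0_powR R k.+1%:R 1 (ltr0Sn _ _) ltr01; rewrite powR1.
rewrite -/(g _) (integral_affine r rn0 mg g0) gtr0_norm// => E.
have -> : (((1 - r)^-1 / k.+1%:R)%:E = \int[mu]_x g ((1 - r) * x + r)%R)%E.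
  have := E; rewrite div1r => /(congr1 (fun z => (1 - r)^-1%:E * z)%E).
  by rewrite muleA -!EFinM mulVf// mul1e => <-.
apply: le_integral_leb => //.
- by apply: measurable_if_EFin; mfun.
- move=> s; case: ifP => // s01.
  have r01 : 0 <= r < 1 by rewrite r0.
  by have /andP[q0 _] := phi_bound_lt1 s01 r01; rewrite lee_fin exprn_ge0.
- move=> s; case: ifPn => [|_]; last exact: g0.
  move=> /andP[s0 s1]; rewrite /g.
  have q0 : 0 < (1 - r) * s + r by rewrite ltr_wpDr// mulr_gt0.
  rewrite q0 ifT; last by rewrite /=; nra.
  rewrite -natr1 addrK powR_mulrn ?(ltW q0)// lee_fin le_eqVlt; apply/orP; left; apply/eqP.
  by congr (_ ^+ _); ring.
Qed.

(** Integrated term by term, the index k contributes at most |a_k| / (k+1) times (1-r)^(-2); the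
    hypothesis [aS] then bounds the sum. *)
Lemma integrable_wdom r : 0 <= r < 1 -> mu.-integrable I01 (EFin \o wdom r).
Proof.
move=> r01; have /andP[r0 r1] := r01; have r1' : 0 < 1 - r by rewrite subr_gt0.
have mdom : measurable_fun I01 (wdom r).
  apply: (@measurable_fun_cvg _ _ _ _ (fun n s => series (u r s) n)).
    by move=> n; rewrite /series; apply: measurable_sum => k; apply: measurable_funTS; exact: mu_.
  by move=> s Is; exact: u_cvg.
have d0 s : I01 s -> 0 <= wdom r s.
  by move=> Is; have := wdom_ge 0 r01 Is; rewrite big_geq.
apply/integrableP; split; first by apply/measurable_EFinP; exact: mdom.
have mu2 k : measurable_fun (I01 : set RT) (fun s => (u r s k)%:E).
  by apply/measurable_EFinP; apply: measurable_funTS; exact: mu_.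
have u0 k s : I01 s -> (0 <= (u r s k)%:E)%E by move=> Is; rewrite lee_fin u_ge0.
have E s : I01 s -> `|(wdom r s)%:E|%E = (\sum_(k <oo) (u r s k)%:E)%E.
  move=> Is; rewrite gee0_abs ?lee_fin ?d0//; apply/esym/cvg_lim => //.
  under eq_fun do rewrite sumEFin.
  by apply: cvg_EFin; [exact: nearW | exact: u_cvg].
rewrite (eq_integral (fun s : RT => \sum_(k <oo) (u r s k)%:E)%E); last first.
  by move=> s /set_mem Is; exact: E.
rewrite (integral_nneseries _ mI01 mu2 u0).
apply: (@le_lt_trans _ _ (S / (1 - r) / (1 - r))%:E); last exact: ltry.
apply: lime_le.
  by apply: is_cvg_nneseries => k _ _; apply: integral_ge0 => s Is; exact: u0.
apply: nearW => n.
apply: (@le_trans _ _ (\sum_(0 <= k < n) (normc (a k) / k.+1%:R / (1 - r) / (1 - r))%:E)%E).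
  apply: lee_sum => k _.
  have mp : measurable_fun (I01 : set RT) (fun s : RT => ((1 - (1 - (s : R)) * (1 - r)) ^+ k)%:E).
    by apply: measurable_funTS; apply: measurable_RT; mfun.
  rewrite (_ : (fun s => _) = (fun s => (normc (a k) / (1 - r))%:E * ((1 - (1 - s) * (1 - r)) ^+ k)%:E)%E); last first.
    by apply/funext => s; rewrite -EFinM /u mulrAC.
  rewrite (ge0_integralZl _ mI01 mp); last 2 first.
  - move=> s /I01P s01; have /andP[q0 _] := phi_bound_lt1 s01 r01.
    by rewrite lee_fin exprn_ge0.
  - by rewrite lee_fin mulr_ge0 ?normc_ge0// invr_ge0 ltW.
  apply: le_trans (lee_wpmul2l _ (int_pow k r01)) _.
    by rewrite lee_fin mulr_ge0 ?normc_ge0// invr_ge0 ltW.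
  by rewrite -EFinM lee_fin le_eqVlt; apply/orP; left; apply/eqP; ring.
rewrite sumEFin lee_fin -!mulr_suml !ler_wpM2r ?invr_ge0 ?(ltW r1')//.
Qed.

Let measurable_term (b : R) n k : measurable_fun setT (fun s : R => (1 - s) `^ b * wcomp_term s n k).
Proof. by rewrite /wcomp_term; mfun. Qed.

Let onem_powR_le1 (b s : R) : 0 <= b -> I01 s -> (1 - s) `^ b <= 1.
Proof.
move=> b0 /I01P/andP[s0 s1]; rewrite -[leRHS](powRr0 (1 - s)).
by apply: ger_powR => //; apply/andP; split; lra.
Qed.

Lemma integral_coef (b : R) n : 0 <= b ->
  [/\ mu.-integrable I01 (EFin \o (fun s => Re (((1 - s) `^ b)%:C * wcomp_coef s a n))),
   mu.-integrable I01 (EFin \o (fun s => Im (((1 - s) `^ b)%:C * wcomp_coef s a n))) &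
   series (fun k => (hilbert_weight b n k)%:C * a k : R[i]^o) @ \oo -->
     (Cint (fun s => ((1 - s) `^ b)%:C * wcomp_coef s a n) : R[i]^o)].
Proof.
move=> b0.
pose t k (s : R) := (1 - s) `^ b * wcomp_term s n k.
pose X k s := a k * (t k s)%:C.
have r01 : 0 < (2^-1 : R) < 1 by apply/andP; split; lra.
have r01' : 0 <= (2^-1 : R) < 1 by apply/andP; split; lra.
have t0 k s : I01 s -> 0 <= t k s.
  by move=> /I01P s01; rewrite mulr_ge0 ?powR_ge0 ?wcomp_term_ge0.
have RX k s : Re (X k s) = Re (a k) * t k s by rewrite /X; case: (a k) => x y /=; rewrite mulr0 subr0.
have IX k s : Im (X k s) = Im (a k) * t k s by rewrite /X; case: (a k) => x y /=; rewrite mulr0 add0r.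
have mR k : measurable_fun I01 (fun s => Re (X k s)).
  under eq_fun do rewrite RX; apply: measurable_funM => //.
  by apply: measurable_funTS; exact: measurable_term.
have mI k : measurable_fun I01 (fun s => Im (X k s)).
  under eq_fun do rewrite IX; apply: measurable_funM => //.
  by apply: measurable_funTS; exact: measurable_term.
(* A single coefficient costs r^(-n) compared with the sum at radius r; at r = 1/2 this is the
   factor 2^n. *)
have Xb s : I01 s -> forall N, \sum_(0 <= k < N) normc (X k s) <= 2 ^+ n * wdom 2^-1 s.
  move=> Is N; have s01 := (I01P s).1 Is.
  apply: le_trans (ler_wpM2l _ (wdom_ge N r01' Is)); last by rewrite exprn_ge0.
  rewrite mulr_sumr; apply: ler_sum => k _.
  rewrite ComplexField.Normc.normcM normcR ger0_norm ?t0// /u.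
  have h : t k s <= 2^-1 ^- n * ((1 - (1 - s) * (1 - 2^-1)) ^+ k / (1 - 2^-1)).
    rewrite -[leRHS]mul1r ler_pM ?powR_ge0 ?wcomp_term_ge0 ?onem_powR_le1//.
    exact: wcomp_coef_abs_bound.
  rewrite (le_trans (ler_wpM2l (normc_ge0 _) h))// exprVn invrK.
  by rewrite le_eqVlt; apply/orP; left; apply/eqP; ring.
have idm : mu.-integrable I01 (EFin \o (fun s => 2 ^+ n * wdom 2^-1 s)).
  exact: (integrableZl mI01 (2 ^+ n) (integrable_wdom r01')).
have XF s : I01 s -> series (fun k => X k s : R[i]^o) @ \oo -->
    (((1 - s) `^ b)%:C * wcomp_coef s a n : R[i]^o).
  move=> Is; have s01 := (I01P s).1 Is.
  have -> : series (fun k => X k s : R[i]^o) = (fun K => ((1 - s) `^ b)%:C *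
      series (fun k => (wcomp_term s n k)%:C * a k : R[i]^o) K).
    apply/funext => K; rewrite /series /X /t mulr_sumr; apply: eq_bigr => k _.
    by rewrite rmorphM; ring.
  by apply: cvgC_mull; exact: wcomp_coef_cvg fa.
have [_ _ h1 h2 h3] := Cint_series mR mI Xb idm XF.
split => //.
rewrite (_ : series _ = series (fun k => Cint (X k) : R[i]^o))//.
apply/funext => K; rewrite /series; apply: eq_bigr => k _.
have it : mu.-integrable I01 (EFin \o t k).
  apply/integrableP; split.
    by apply/measurable_EFinP; apply: measurable_funTS; exact: measurable_term.
  rewrite (eq_integral (fun s : RT => (t k s)%:E)); last first.
    by move=> s /set_mem Is; rewrite /= ger0_norm// t0.
  by rewrite integral_I01 hilbert_weight_integral// ltry.
have Et : (\int[mu]_(s in I01) t k s)%R = hilbert_weight b n k.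
  by rewrite /Rintegral integral_I01 hilbert_weight_integral.
rewrite /Cint.
under eq_Rintegral do rewrite RX.
under [X in _ = _ +i* X]eq_Rintegral do rewrite IX.
rewrite !(RintegralM_cst _ it) Et; case: (a k) => x y /=.
by apply/eqP; rewrite eq_complex /= !mul0r subr0 addr0 ![_ * hilbert_weight b n k]mulrC !eqxx.
Qed.

Lemma integral_formula (b : R) z : 0 <= b -> unit_disk z ->
  [/\ mu.-integrable I01 (EFin \o (fun s => Re (((1 - s) `^ b)%:C * wcomp s f z))),
   mu.-integrable I01 (EFin \o (fun s => Im (((1 - s) `^ b)%:C * wcomp s f z))) &
   series (fun n => Cint (fun s => ((1 - s) `^ b)%:C * wcomp_coef s a n) * z ^+ n : R[i]^o) @ \oo -->
     (Cint (fun s => ((1 - s) `^ b)%:C * wcomp s f z) : R[i]^o)].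
Proof.
move=> b0 z1; have r01 : 0 <= normc z < 1 by rewrite normc_ge0.
pose X n s := z ^+ n * (((1 - s) `^ b)%:C * wcomp_coef s a n).
have CX n : Cint (X n) = Cint (fun s => ((1 - s) `^ b)%:C * wcomp_coef s a n) * z ^+ n.
  by have [h1 h2 _] := integral_coef n b0; rewrite /X Cint_mulr// mulrC.
have mW n : measurable_fun I01 (fun s => Re (((1 - s) `^ b)%:C * wcomp_coef s a n)) /\
    measurable_fun I01 (fun s => Im (((1 - s) `^ b)%:C * wcomp_coef s a n)).
  have [h1 h2 _] := integral_coef n b0; split.
    by have /measurable_int/measurable_EFinP := h1.
  by have /measurable_int/measurable_EFinP := h2.
have mR n : measurable_fun I01 (fun s => Re (X n s)).
  have [m1 m2] := mW n; rewrite /X; case: (z ^+ n) => x y.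
  have -> : (fun s => Re ((x +i* y) * (((1 - s) `^ b)%:C * wcomp_coef s a n))) =
   (fun s => x * Re (((1 - s) `^ b)%:C * wcomp_coef s a n) - y * Im (((1 - s) `^ b)%:C * wcomp_coef s a n)).
    by apply/funext => s; case: (_ * wcomp_coef s a n).
  by apply: measurable_funB; apply: measurable_funM.
have mI n : measurable_fun I01 (fun s => Im (X n s)).
  have [m1 m2] := mW n; rewrite /X; case: (z ^+ n) => x y.
  have -> : (fun s => Im ((x +i* y) * (((1 - s) `^ b)%:C * wcomp_coef s a n))) =
   (fun s => x * Im (((1 - s) `^ b)%:C * wcomp_coef s a n) + y * Re (((1 - s) `^ b)%:C * wcomp_coef s a n)).
    by apply/funext => s; case: (_ * wcomp_coef s a n).
  by apply: measurable_funD; apply: measurable_funM.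
have Xb s : I01 s -> forall N, \sum_(0 <= n < N) normc (X n s) <= wdom (normc z) s.
  move=> Is N; have s01 := (I01P s).1 Is.
  apply: (@le_trans _ _ (\sum_(0 <= n < N) normc (wcomp_coef s a n * z ^+ n))).
    apply: ler_sum => n _; rewrite /X !ComplexField.Normc.normcM normcR ger0_norm ?powR_ge0//.
    rewrite mulrC ler_wpM2r ?normc_ge0// -[leRHS]mul1r ler_wpM2r ?normc_ge0//.
    exact: onem_powR_le1.
  (* The coefficients are themselves limits: the bound is shown for inner sums truncated at K and
     then passed to the limit. *)
  pose y n K := series (fun k => (wcomp_term s n k)%:C * a k : R[i]^o) K * z ^+ n.
  have yc n : (fun K => normc (y n K)) @ \oo --> normc (wcomp_coef s a n * z ^+ n).
    apply/cvgrPdist_le => e e0.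
    have : (fun K => z ^+ n * series (fun k => (wcomp_term s n k)%:C * a k : R[i]^o) K : R[i]^o)
        @ \oo --> (z ^+ n * wcomp_coef s a n : R[i]^o).
      by apply: cvgC_mull; exact: wcomp_coef_cvg fa.
    move/cvgC_normP/(_ _ e0); apply: filterS => K; rewrite ![z ^+ n * _]mulrC -/(y n K).
    move: (wcomp_coef s a n * z ^+ n) (y n K) => A B AB.
    have h1 := ler_normcD (A - B) B; have h2 := ler_normcB A (A - B).
    rewrite subrK in h1; rewrite opprB addrC subrK in h2.
    by rewrite ler_norml; apply/andP; split; lra.
  have : (fun K => \sum_(0 <= n < N) normc (y n K)) @ \oo -->
      \sum_(0 <= n < N) normc (wcomp_coef s a n * z ^+ n).
    elim: N => [|N IH].
      by under eq_fun do rewrite big_geq//; rewrite big_geq//; exact: cvg_cst.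
    under eq_fun do rewrite big_nat_recr//=; rewrite big_nat_recr//=.
    by apply: cvgD.
  move=> h; rewrite -(cvg_lim _ h)//; apply: limr_le; first by apply/cvg_ex; eexists; exact: h.
  apply: nearW => K; rewrite (le_trans _ (wdom_ge K r01 Is))//.
  apply: (@le_trans _ _ (\sum_(0 <= n < N) \sum_(0 <= k < K) normc ((wcomp_term s n k)%:C * a k * z ^+ n))).
    by apply: ler_sum => n _; rewrite /y /series mulr_suml normc_sum.
  rewrite exchange_big_nat/=; apply: ler_sum => k _; exact: wcomp_sum_normc_le.
have XF s : I01 s -> series (fun n => X n s : R[i]^o) @ \oo -->
    (((1 - s) `^ b)%:C * wcomp s f z : R[i]^o).
  move=> Is; have s01 := (I01P s).1 Is.
  have -> : series (fun n => X n s : R[i]^o) = (fun K => ((1 - s) `^ b)%:C *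
      series (fun n => wcomp_coef s a n * z ^+ n : R[i]^o) K).
    apply/funext => K; rewrite /series /X mulr_sumr; apply: eq_bigr => k _; ring.
  apply: cvgC_mull; exact: (wcomp_power_series s01 fa).
have [_ _ h1 h2 h3] := Cint_series mR mI Xb (integrable_wdom r01) XF.
split => //.
rewrite (_ : series _ = series (fun n => Cint (X n) : R[i]^o))//.
by apply/funext => K; rewrite /series; apply: eq_bigr => n _; rewrite CX.
Qed.

End hilbert_formula.

(** * Coefficient estimates *)

Section disk_functions.
Context {R : realType}.
Local Notation mu := (@lebesgue_measure R).
Local Notation RT := (measurableTypeR R).
Implicit Types (f : R[i] -> R[i]) (a : nat -> R[i]) (w : R * R).

Definition nsq w : R := w.1 ^+ 2 + w.2 ^+ 2.

Definition cpx w : R[i] := w.1 +i* w.2.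

Lemma nsq_ge0 w : 0 <= nsq w. Proof. by rewrite addr_ge0// sqr_ge0. Qed.

Lemma sqr_normc_cpx w : normc (cpx w) ^+ 2 = nsq w.
Proof. by rewrite sqr_normcE. Qed.

Lemma normc_cpx_lt w (r : R) : 0 <= r -> (normc (cpx w) < r) = (nsq w < r ^+ 2).
Proof. by move=> r0; rewrite -sqr_normc_cpx ltr_sqr ?nnegrE ?normc_ge0. Qed.

Lemma unit_diskE w : unit_disk (cpx w) = (nsq w < 1).
Proof. by rewrite /unit_disk/= (normc_cpx_lt _ ler01) expr1n. Qed.

Lemma measurable_nsq : measurable_fun setT nsq.
Proof. by rewrite /nsq; mfun. Qed.

Lemma measurable_cpxX n : measurable_fun setT (fun w => Re (cpx w ^+ n)) /\
  measurable_fun setT (fun w => Im (cpx w ^+ n)).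
Proof.
elim: n => [|n [IHr IHi]]; first by split; apply: measurable_cst.
have eR w : Re (cpx w ^+ n.+1) = w.1 * Re (cpx w ^+ n) - w.2 * Im (cpx w ^+ n).
  by rewrite exprS; case: (cpx w ^+ n).
have eI w : Im (cpx w ^+ n.+1) = w.1 * Im (cpx w ^+ n) + w.2 * Re (cpx w ^+ n).
  by rewrite exprS; case: (cpx w ^+ n).
by split; [rewrite (funext eR)|rewrite (funext eI)]; mfun.
Qed.

Lemma measurable_cpx_sum a n :
  measurable_fun setT (fun w => Re (\sum_(0 <= k < n) a k * cpx w ^+ k)) /\
  measurable_fun setT (fun w => Im (\sum_(0 <= k < n) a k * cpx w ^+ k)).
Proof.
have h k : measurable_fun setT (fun w => Re (a k * cpx w ^+ k)) /\
  measurable_fun setT (fun w => Im (a k * cpx w ^+ k)).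
  have [mR mI] := measurable_cpxX k.
  have eR w : Re (a k * cpx w ^+ k) = Re (a k) * Re (cpx w ^+ k) - Im (a k) * Im (cpx w ^+ k).
    by case: (a k); case: (cpx w ^+ k).
  have eI w : Im (a k * cpx w ^+ k) = Re (a k) * Im (cpx w ^+ k) + Im (a k) * Re (cpx w ^+ k).
    by case: (a k); case: (cpx w ^+ k).
  by split; [rewrite (funext eR)|rewrite (funext eI)]; mfun.
split; [under eq_fun do rewrite Re_sum|under eq_fun do rewrite Im_sum];
  apply: measurable_sum => k; by have [] := h k.
Qed.

(** A pointwise limit of polynomials on the disk; the cut-off by 0 is there because f is arbitrary
    outside. *)
Lemma measurable_power_series f a : has_power_series f a ->
  measurable_fun setT (fun w => if nsq w < 1 then Re (f (cpx w)) else 0) /\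
  measurable_fun setT (fun w => if nsq w < 1 then Im (f (cpx w)) else 0).
Proof.
move=> fa; have mn := measurable_nsq.
have cv w : nsq w < 1 -> (fun n => Re (\sum_(0 <= k < n) a k * cpx w ^+ k)) @ \oo --> Re (f (cpx w))
  /\ (fun n => Im (\sum_(0 <= k < n) a k * cpx w ^+ k)) @ \oo --> Im (f (cpx w)).
  by rewrite -unit_diskE => w1; have /cvgCP := fa _ w1.
split.
- apply: (measurable_fun_cvg (h := fun n w => if nsq w < 1 then
    Re (\sum_(0 <= k < n) a k * cpx w ^+ k) else 0)) => [n|w _].
    by have [mR _] := measurable_cpx_sum a n; mfun.
  by case: ifPn => [/cv[]|_] //; exact: cvg_cst.
- apply: (measurable_fun_cvg (h := fun n w => if nsq w < 1 then
    Im (\sum_(0 <= k < n) a k * cpx w ^+ k) else 0)) => [n|w _].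
    by have [_ mI] := measurable_cpx_sum a n; mfun.
  by case: ifPn => [/cv[]|_] //; exact: cvg_cst.
Qed.

Lemma measurable_normc_power_series f a : has_power_series f a ->
  measurable_fun setT (fun w => if nsq w < 1 then normc (f (cpx w)) else 0).
Proof.
move=> fa; have mn := measurable_nsq; have [mR mI] := measurable_power_series fa.
have e w : (if nsq w < 1 then normc (f (cpx w)) else 0) = Num.sqrt
  ((if nsq w < 1 then Re (f (cpx w)) else 0) ^+ 2 + (if nsq w < 1 then Im (f (cpx w)) else 0) ^+ 2).
  case: ifP => _; last by rewrite expr0n/= addr0 sqrtr0.
  by rewrite -sqr_normcE sqrtr_sqr ger0_norm// normc_ge0.
rewrite (funext e).
by apply: measurable_fun_sqrt; apply: measurable_funD; apply: measurable_funX.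
Qed.

(** The p-th power of the norm without its normalizing constants, written over the whole plane so
    that substitutions apply directly. *)
Definition Iw (p alpha : R) f : \bar R :=
  (\int[leb2]_w (if (nsq w < 1)%R
     then (normc (f (cpx w)) `^ p * (1 - nsq w) `^ alpha)%:E else 0))%E.

Lemma Iw_ge0 p alpha f : (0 <= Iw p alpha f)%E.
Proof.
by apply: integral_ge0 => w _; case: ifP => // _; rewrite lee_fin mulr_ge0 ?powR_ge0.
Qed.

Lemma measurable_Iw p alpha f a : has_power_series f a -> measurable_fun setT (fun w =>
  (if (nsq w < 1)%R then (normc (f (cpx w)) `^ p * (1 - nsq w) `^ alpha)%:E else 0)%E).
Proof.
move=> /measurable_normc_power_series; set F := (X in measurable_fun _ X) => mf.
have mn := measurable_nsq.
have e w : (if (nsq w < 1)%R then (normc (f (cpx w)) `^ p * (1 - nsq w) `^ alpha)%:E else 0)%E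
 = (if (nsq w < 1)%R then (F w `^ p * (1 - nsq w) `^ alpha)%:E else 0)%E.
  by rewrite /F; case: ifP.
rewrite (funext e); clearbody F.
by mfun.
Qed.

End disk_functions.

(** * Means over circles by roots of unity *)

Section roots_of_unity_average.
Context {R : realType}.
Implicit Types (f : R[i] -> R[i]) (a : nat -> R[i]) (z u v : R[i]).

(** The polynomial X^n - 1 splits and is separable in characteristic 0; among its n distinct roots
    one is primitive. *)
Lemma primitive_root_exists n : (0 < n)%N -> exists u, n.-primitive_root (u : R[i]).
Proof.
move=> n0; pose p : {poly R[i]} := 'X^n - 1.
have [r Dp] := closed_field_poly_normal p.
rewrite (monicP _) ?monicXnsubC // scale1r in Dp.
have rn1 : all n.-unity_root r by apply/allP => z; rewrite -root_prod_XsubC -Dp.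
have sz : (n < (size r).+1)%N by rewrite -(size_prod_XsubC r id) -Dp size_XnsubC.
have [|z] := hasP (cyclic.has_prim_root n0 rn1 _ sz); last by exists z.
by rewrite -separable_prod_XsubC -Dp separable_Xn_sub_1// pnatr_eq0 -lt0n.
Qed.

Lemma sqr_normcC z : (normc z ^+ 2)%:C = z * z^*%C.
Proof. by rewrite -sqr_normc normrC rmorphXn. Qed.

Lemma normc_unity_root n u : (0 < n)%N -> u ^+ n = 1 -> normc u = 1.
Proof.
move=> n0 un; have := congr1 (@normc R) un; rewrite normcX ComplexField.Normc.normc1.
by move/eqP; rewrite pexprn_eq1 ?normc_ge0// => /orP[/eqP h|/eqP//]; rewrite h in n0.
Qed.

Lemma sum_unity_root n v : v ^+ n = 1 -> v != 1 -> \sum_(j < n) v ^+ j = 0.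
Proof.
move=> vn v1; have := subrX1 v n; rewrite vn subrr => /esym/eqP.
by rewrite mulf_eq0 subr_eq0 (negbTE v1) => /eqP.
Qed.

(** Orthogonality of the characters j |-> u^(j m) modulo n. The average over n rotations is exact
    because all degrees are below n. *)
Lemma parseval_unity_root a n u z : n.-primitive_root u ->
  \sum_(j < n) normc (\sum_(m < n) a m * (u ^+ j * z) ^+ m) ^+ 2 =
  n%:R * \sum_(m < n) normc (a m) ^+ 2 * normc z ^+ m ^+ 2.
Proof.
move=> pu; have n0 := prim_order_gt0 pu; have un := prim_expr_order pu.
have nu := normc_unity_root n0 un.
have uu k : u ^+ k * (u ^+ k)^*%C = 1.
  by rewrite -sqr_normcC normcX nu !expr1n.
apply: (@complexI R); rewrite rmorphM/= !rmorph_sum/=.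
transitivity (\sum_(m < n) \sum_(l < n) a m * z ^+ m * (a l * z ^+ l)^*%C *
    \sum_(j < n) (u ^+ m * (u ^+ l)^*%C) ^+ j).
  under eq_bigr => j _.
    rewrite sqr_normcC rmorph_sum mulr_suml.
    under eq_bigr => m _ do rewrite mulr_sumr.
    over.
  rewrite exchange_big; apply: eq_bigr => m _; rewrite exchange_big; apply: eq_bigr => l _.
  rewrite mulr_sumr; apply: eq_bigr => j _.
  rewrite !(rmorphM, rmorphXn)/= !exprMn -!exprM [(m * j)%N]mulnC [(l * j)%N]mulnC.
  by ring.
rewrite rmorph_nat mulr_sumr; apply: eq_bigr => m _.
rewrite (bigD1 m)//= [X in _ + X]big1 => [|l lm].
  rewrite addr0 uu; under eq_bigr do rewrite expr1n.
  rewrite sumr_const card_ord -sqr_normcC ComplexField.Normc.normcM normcX exprMn.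
  by rewrite mulrC.
rewrite sum_unity_root ?mulr0//.
  by rewrite exprMn -rmorphXn -!exprM ![(_ * n)%N]mulnC !exprM un !expr1n rmorph1 mulr1.
apply: contra lm => /eqP h; rewrite -val_eqE eq_sym/=.
have := eq_prim_root_expr pu m l; rewrite !modn_small// => <-.
have := congr1 (fun x => x * u ^+ l) h; rewrite mul1r -mulrA [_^*%C * _]mulrC uu mulr1.
by move=> ->.
Qed.

End roots_of_unity_average.

Section coefficient_bound.
Context {R : realType}.
Local Notation mu := (@lebesgue_measure R).
Local Notation RT := (measurableTypeR R).
Implicit Types (f : R[i] -> R[i]) (a : nat -> R[i]) (w : R * R).

(** The discrete Parseval identity concerns polynomials. On |z| <= rho a long partial sum can take
    the place of f, uniformly in z, at the price of an additive 1. *)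
Lemma partial_sum_sqr_le f a (rho : R) K : has_power_series f a -> 0 <= rho < 1 ->
  exists N, (K < N)%N /\ forall z, normc z <= rho ->
    normc (\sum_(m < N) a m * z ^+ m) ^+ 2 <= normc (f z) ^+ 2 + 1.
Proof.
move=> fa rho01; have /andP[rho0 rho1] := rho01.
have [M aM] := power_series_abs_bound fa rho01.
pose u k := normc (a k) * rho ^+ k.
have u0 k : 0 <= u k by rewrite mulr_ge0 ?normc_ge0 ?exprn_ge0.
have cu := nneg_series_cvg u0 aM.
set S := limn (series u) in cu.
have uS n : series u n <= S.
  by apply: nondecreasing_cvgn_le => //; apply: nondecreasing_series => // k _; exact: u0.
have S0 : 0 <= S by rewrite (le_trans _ (uS 0%N))// /series/= big_geq.
(* The tail is chosen so that 2 S times it is at most 1: where |P| > |f|, the difference of squares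
   is at most 2 |P| (|P| - |f|), and |P| <= S. *)
have e0 : 0 < (2 * (S + 1))^-1 by rewrite invr_gt0; lra.
have [N0 _ hN0] : \forall n \near \oo, `|S - series u n| < (2 * (S + 1))^-1.
  by move/cvgrPdist_lt : cu; apply.
pose N := maxn N0 K.+1; exists N; split; first by rewrite leq_max ltnSn orbT.
move=> z zr.
have := hN0 N (leq_maxl _ _); rewrite ger0_norm ?subr_ge0// => hN.
set P := \sum_(m < N) _.
have PE : P = \sum_(0 <= m < N) a m * z ^+ m by rewrite big_mkord.
have tz k : normc (a k * z ^+ k) <= u k.
  rewrite ComplexField.Normc.normcM normcX ler_wpM2l ?normc_ge0// lerXn2r ?nnegrE ?normc_ge0//.
have hP : normc P <= S.
  rewrite PE (le_trans (normc_sum _ _ _))// (le_trans _ (uS N))// ler_sum// => k _; exact: tz.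
have hf : normc (f z - P) <= S - series u N.
  apply: cvgC_norm_le (fa z (le_lt_trans zr rho1)) _.
  exists N => // n /= Nn.
  rewrite (_ : series _ n = \sum_(0 <= k < n) a k * z ^+ k)// PE (big_cat_nat (leq0n N) Nn)//= addrAC subrr add0r.
  rewrite (le_trans (normc_sum _ _ _))//.
  apply: (@le_trans _ _ (\sum_(N <= k < n) u k)); first by apply: ler_sum => k _; exact: tz.
  rewrite lerBrDr addrC; apply: le_trans (uS n).
  by rewrite /series/= (big_cat_nat (leq0n N) Nn).
have hPf : normc P <= normc (f z) + (S - series u N).
  rewrite (le_trans _ (lerD (lexx _) hf))//.
  by rewrite -{1}[P](subKr (f z)) ler_normcB.
have hS : 2 * (S + 1) * (S - series u N) <= 1.
  by rewrite mulrC -ler_pdivlMr ?mul1r ?ltW//; lra.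
have := normc_ge0 P; have := normc_ge0 (f z).
move: (S - series u N) hf hPf hS (normc_ge0 (f z - P)) => tau hf hPf hS ntau.
move: (normc P) (normc (f z)) hP hPf => x y hP hPf y0 x0.
have [xy|xy] := leP x y; first by nra.
nra.
Qed.

(** [N] and [u] depend on rho but not on z, so the inequality can be integrated over the disk of
    radius rho. *)
Lemma coef_sqr_mean_le f a (rho : R) K : has_power_series f a -> 0 <= rho < 1 ->
  exists N u, N.-primitive_root (u : R[i]) /\ forall z, normc z <= rho ->
    \sum_(k < K) normc (a k) ^+ 2 * normc z ^+ k ^+ 2 <=
    N%:R^-1 * (\sum_(j < N) normc (f (u ^+ j * z)) ^+ 2) + 1.
Proof.
move=> fa rho01; have [N [KN hN]] := partial_sum_sqr_le K fa rho01.
have N0 : (0 < N)%N by rewrite (leq_ltn_trans _ KN).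
have [u pu] := @primitive_root_exists R _ N0; exists N, u; split => // z zr.
have nu j : normc (u ^+ j) = 1.
  by rewrite normcX (normc_unity_root N0 (prim_expr_order pu)) expr1n.
have NR : (0 : R) < N%:R by rewrite ltr0n.
apply: (@le_trans _ _ (\sum_(k < N) normc (a k) ^+ 2 * normc z ^+ k ^+ 2)).
  rewrite -!(big_mkord xpredT (fun k => normc (a k) ^+ 2 * normc z ^+ k ^+ 2)).
  rewrite (big_cat_nat (leq0n K) (ltnW KN))//= lerDl sumr_ge0// => k _.
  by rewrite mulr_ge0 ?exprn_ge0 ?normc_ge0.
rewrite -[leLHS](mulKf (lt0r_neq0 NR)) -(parseval_unity_root a z pu) ler_pdivrMl// mulrDr.
rewrite (mulVKf (lt0r_neq0 NR)) mulr1.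
rewrite -[X in _ + X%:R](card_ord N) -sum1_card natr_sum -big_split/=.
apply: ler_sum => j _; apply: hN.
by rewrite ComplexField.Normc.normcM nu mul1r.
Qed.

(** Stands in for Hoelder's inequality with exponent p/2, pointwise. The cases are separated at x =
    t^k, where x^2 t^be = x^p t^alpha. *)
Lemma sqr_weight_le (x t p alpha be : R) : 0 <= x -> 0 < t -> 2 < p ->
  x ^+ 2 * t `^ be <= x `^ p * t `^ alpha + t `^ (be + 2 * ((be - alpha) / (p - 2))).
Proof.
move=> x0 t0 p2; set k := (be - alpha) / (p - 2).
have [xt|tx] := leP x (t `^ k).
  rewrite ler_wpDl ?mulr_ge0 ?powR_ge0// powRD ?(gt_eqF t0) ?implybT// [leRHS]mulrC.
  by rewrite [2 * k]mulrC powRrM powR_mulrn ?powR_ge0// ler_wpM2r ?powR_ge0// lerXn2r ?nnegrE ?powR_ge0.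
rewrite ler_wpDr ?powR_ge0//.
have x1 : 0 < x by rewrite (lt_trans _ tx)// powR_gt0.
have -> : x `^ p = x ^+ 2 * x `^ (p - 2).
  by rewrite -powR_mulrn// -powRD ?(gt_eqF x1) ?implybT// addrC subrK.
rewrite -mulrA ler_wpM2l ?sqr_ge0//.
have -> : be = k * (p - 2) + alpha by rewrite /k divfK ?subrK//; lra.
rewrite [t `^ _]powRD ?(gt_eqF t0) ?implybT// ler_wpM2r ?powR_ge0// powRrM.
by apply: ge0_ler_powR; rewrite ?nnegrE ?powR_ge0 ?(ltW x1) ?(ltW tx) ?ler0n//; lra.
Qed.

End coefficient_bound.

Section coefficient_bound_integrated.
Context {R : realType}.
Local Notation mu := (@lebesgue_measure R).
Local Notation RT := (measurableTypeR R).
Implicit Types (f : R[i] -> R[i]) (a : nat -> R[i]) (w : R * R).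

Lemma onem_expr_ge (x : R) n : 0 <= x <= 1 -> 1 - n%:R * x <= (1 - x) ^+ n.
Proof.
move=> /andP[x0 x1]; elim: n => [|n IH]; first by rewrite mul0r subr0 expr0.
rewrite exprS (le_trans _ (ler_wpM2l _ IH)) ?subr_ge0// -natr1.
by have := ler0n R n; move: (n%:R : R) => y y0; have := sqr_ge0 x; nra.
Qed.

(** The k-th summand is integrated only over 1 - 1/(2(k+1)) < x < 1 - 1/(4(k+1)), where x^k >= 1/2
    by Bernoulli's inequality and (1-x)^(-dl) >= (k+1)^dl; the length 1/(4(k+1)) then yields 1/8.
    The upper limit of integration stays below 1 and still contains the windows of all k < K. *)
Lemma integral_moment_ge (A : nat -> R) (dl : R) K : 0 <= dl -> (forall k, 0 <= A k) ->
  ((8^-1 * \sum_(k < K) A k * (k.+1%:R `^ dl / k.+1%:R))%:E <=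
   \int[mu]_x (if ((0 < x) && (x < 1 - (4 * K.+1%:R)^-1))%R
     then (\sum_(k < K) A k * x ^+ k * (1 - x) `^ (- dl))%:E else 0))%E.
Proof.
move=> dl0 A0.
pose c k : R := A k * (2^-1 * k.+1%:R `^ dl).
have c0 k : 0 <= c k by rewrite !mulr_ge0// powR_ge0.
pose lo k : R := 1 - (2 * k.+1%:R)^-1.
pose hi k : R := 1 - (4 * k.+1%:R)^-1.
pose ind k (x : R) : \bar R := if (lo k < x) && (x < hi k) then 1%E else 0%E.
have mind k : measurable_fun setT (ind k) by rewrite /ind; mfun.
have ind0 k x : (0 <= ind k x)%E by rewrite /ind; case: ifP.
have kS k : (1 : R) <= k.+1%:R by rewrite ler1n.
have V k : (k.+1%:R : R)^-1 * k.+1%:R = 1 by rewrite mulVf// gt_eqF// (lt_le_trans ltr01).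
have V0 k : 0 < (k.+1%:R : R)^-1 by rewrite invr_gt0 (lt_le_trans ltr01).
have -> : (8^-1 * \sum_(k < K) A k * (k.+1%:R `^ dl / k.+1%:R))%:E =
    (\int[mu]_x \sum_(k < K) (c k)%:E * ind k x)%E.
  rewrite (ge0_integral_sum _ measurableT); first last.
  - by move=> k x _; rewrite mule_ge0 ?lee_fin.
  - by move=> k; apply: measurable_RT; mfun.
  rewrite mulr_sumr -sumEFin; apply: eq_bigr => k _.
  rewrite (ge0_integralZl mu measurableT (measurable_RT (mind k)))//; last by rewrite lee_fin.
  rewrite integral_ltr_itv -?EFinM; last first.
    by rewrite /lo /hi !invfM; move: (V0 k); move: ((k.+1%:R : R)^-1) => v; lra.
  by congr EFin; rewrite /c /lo /hi !invfM; move: ((k.+1%:R : R)^-1) => v; field.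
apply: le_integral_leb.
- by apply: emeasurable_sum => k; mfun.
- mfun; apply: measurable_sum => k; mfun.
- by move=> x; apply: sume_ge0 => k _; rewrite mule_ge0 ?lee_fin.
move=> x; case: ifPn => [/andP[x0 x1]|xr].
  rewrite -sumEFin; apply: lee_sum => k _; rewrite /ind; case: ifPn => [/andP[hlo hhi]|_]; last first.
    by rewrite mule0 lee_fin !mulr_ge0 ?A0 ?powR_ge0 ?exprn_ge0 ?ltW.
  rewrite mule1 lee_fin /c -mulrA ler_wpM2l//; apply: ler_pM; rewrite ?powR_ge0//.
    apply: (@le_trans _ _ ((1 - (2 * k.+1%:R)^-1) ^+ k)).
      apply: le_trans (onem_expr_ge _ _); rewrite invfM.
        have := V k; have := V0 k; move: ((k.+1%:R : R)^-1) => v; rewrite -natr1 mulrDr mulr1.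
        by move: (k%:R : R) => y v0 vy; rewrite mulrCA [y * v]mulrC; move: (v * y) vy => z; lra.
      have := V k; have := V0 k; have := kS k; move: (k.+1%:R : R) ((k.+1%:R : R)^-1) => y v.
      by move=> *; apply/andP; split; nra.
    rewrite lerXn2r ?nnegrE ?(ltW x0) ?(ltW hlo)// subr_ge0 invf_le1 ?mulr_gt0 ?(lt_le_trans ltr01)//.
    by have := kS k; move: (k.+1%:R : R) => y; lra.
  have t0 : 0 < 1 - x by move: hhi (V0 k); rewrite /hi invfM; move: ((k.+1%:R : R)^-1) => v; lra.
  have k0 : 0 < (k.+1%:R : R) by rewrite (lt_le_trans ltr01).
  rewrite powRN -[leRHS]mul1r ler_pdivlMr ?powR_gt0// -powRM ?(ltW t0) ?(ltW k0)// [leRHS](_ : 1 = 1 `^ dl); last by rewrite powR1.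
  apply: ge0_ler_powR; rewrite ?nnegrE ?ler01 ?mulr_ge0 ?(ltW t0) ?(ltW k0)//.
  move: hlo (V0 k) (V k); rewrite /lo invfM.
  move: (k.+1%:R : R) k0 ((k.+1%:R : R)^-1) => y y0 v hlo v0 vy.
  have : y * (1 - x) <= y * (2^-1 * v) by rewrite ler_wpM2l ?(ltW y0)//; lra.
  by rewrite [y * (2^-1 * _)]mulrCA [y * v]mulrC vy; lra.
rewrite big1 // => k _; rewrite /ind ifF ?mule0//; apply/negP => /andP[hlo hhi].
move/negP : xr; apply; apply/andP; split.
  apply: lt_trans hlo; rewrite /lo subr_gt0 invf_lt1 ?mulr_gt0 ?(lt_le_trans ltr01)//.
  have := kS k; lra.
apply: lt_le_trans hhi _; rewrite /hi lerD2l lerN2 lef_pV2 ?posrE ?mulr_gt0 ?(lt_le_trans ltr01)//.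
by rewrite (ler_wpM2l (ler0n _ _))// ler_nat ltnS ltnW.
Qed.

End coefficient_bound_integrated.

Section weighted_coefficient_bound.
Context {R : realType}.
Local Notation mu := (@lebesgue_measure R).
Local Notation RT := (measurableTypeR R).
Implicit Types (f : R[i] -> R[i]) (a : nat -> R[i]) (w : R * R).

Lemma mul_cpx (u : R[i]) w : u * cpx w = cpx (Re u * w.1 - Im u * w.2, Im u * w.1 + Re u * w.2).
Proof. by rewrite /cpx; case: u => c s /=; simpc; rewrite addrC [s * _ + _]addrC; congr (_ +i* _); ring. Qed.

Lemma integral_disk_onem_powR (c eta : R) : 0 <= c -> -1 < eta ->
  (\int[leb2]_w (if ((0 < nsq w) && (nsq w < 1))%R then (c * (1 - nsq w) `^ eta)%:E else 0) <=
   @disk_area R * (c / (eta + 1))%:E)%E.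
Proof.
move=> c0 eta1.
pose E (x : R) : \bar R := if (0 < x) && (x < 1) then (c * (1 - x) `^ eta)%:E else 0%E.
have mE : measurable_fun setT E by rewrite /E; mfun.
have E0 x : (0 <= E x)%E by rewrite /E; case: ifP; rewrite // lee_fin mulr_ge0 ?powR_ge0.
rewrite (_ : (\int[leb2]_w _)%E = (\int[leb2]_w (if (0 < (w.1 : R) ^+ 2 + w.2 ^+ 2)%R then E (w.1 ^+ 2 + w.2 ^+ 2)%R else 0))%E).
  rewrite (integral_radial mE E0); apply: lee_wpmul2l; first exact: ltW disk_area_gt0.
  have eta0 : 0 < eta + 1 by lra.
  rewrite (_ : (c / (eta + 1))%:E = c%:E * (1 `^ (eta + 1) / (eta + 1))%:E)%E; last first.
    by rewrite powR1 mul1r EFinM.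
  have mI : measurable_fun setT (fun x : R =>
      (if ((1 - 1 <= x) && (x < 1))%R then ((1 - x) `^ (eta + 1 - 1))%:E else 0)%E) by mfun.
  rewrite -(integral1_powR eta0 ltr01) -(ge0_integralZl mu measurableT (measurable_RT mI)); first last.
  - by rewrite lee_fin.
  - by move=> x _; case: ifP; rewrite // lee_fin powR_ge0.
  apply: le_integral_leb.
  - by mfun.
  - by mfun.
  - by move=> x; case: ifP.
  move=> x; rewrite /E; case: ifPn => [x0|_]; last first.
    by case: ifP; rewrite ?mule0// lee_fin mulr_ge0 ?powR_ge0.
  by case: ifPn => [/andP[_ x1]|_]; rewrite ?subrr ?(ltW x0) ?x1 ?addrK// mule_ge0 ?lee_fin//; case: ifP; rewrite // lee_fin powR_ge0.
by apply: eq_integral => w _; rewrite -/(nsq w) /E; case: (0 < nsq w)%R.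
Qed.

(** Parseval's inequality is multiplied by (1 - |z|^2)^(-dl) and integrated. [dl] is half of (p - 2
    alpha - 2) / p, the value below which eta > -1, so that the remainder of [sqr_weight_le] is
    integrable. As eta <= -dl, the same weight also absorbs the additive 1 of the mean inequality;
    hence the 2. *)
Lemma coef_sqr_integral_le f a (p alpha dl eta : R) K : has_power_series f a -> 0 <= alpha ->
  2 * (alpha + 2) <= p -> dl = (p - 2 * alpha - 2) / (2 * p) ->
  eta = - dl + 2 * ((- dl - alpha) / (p - 2)) ->
  (@disk_area R * (8^-1 * \sum_(k < K) normc (a k) ^+ 2 * (k.+1%:R `^ dl / k.+1%:R))%:E <=
   Iw p alpha f + @disk_area R * (2 / (eta + 1))%:E)%E.
Proof.
move=> fa al0 pal dl_def eta_def.
have p4 : 4 <= p by lra.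
have dl0 : 0 < dl by rewrite dl_def divr_gt0//; lra.
have dlE : dl * (2 * p) = p - 2 * alpha - 2 by rewrite dl_def divfK//; lra.
have e2E : 2 * ((- dl - alpha) / (p - 2)) * (p - 2) = 2 * (- dl - alpha) by rewrite -mulrA divfK//; lra.
have eta_le : eta <= - dl.
  by rewrite eta_def gerDl -(ler_pM2r (_ : 0 < p - 2)) ?e2E; nra.
have eta1 : -1 < eta.
  by rewrite eta_def -(ltr_pM2r (_ : 0 < p - 2)) ?mulrDl ?e2E; nra.
pose r : R := 1 - (4 * K.+1%:R)^-1.
have r01 : 0 < r < 1.
  have : (4 * K.+1%:R : R)^-1 <= 4^-1.
    by rewrite lef_pV2 ?posrE ?mulr_gt0 ?ltr0n// ler_pMr// ler1n.
  have : 0 < (4 * K.+1%:R : R)^-1 by rewrite invr_gt0 mulr_gt0 ?ltr0n.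
  by rewrite /r; move: (4 * K.+1%:R : R)^-1 => v *; apply/andP; split; lra.
have /andP[r0 r1] := r01.
have sr01 : 0 <= Num.sqrt r < 1.
  by rewrite sqrtr_ge0 -[ltRHS]sqrtr1 ltr_sqrt.
have [N [u [pu hu]]] := coef_sqr_mean_le K fa sr01.
have N0 := prim_order_gt0 pu.
have nu j : normc (u ^+ j) = 1.
  by rewrite normcX (normc_unity_root N0 (prim_expr_order pu)) expr1n.
pose rot j w : R * R := (Re (u ^+ j) * w.1 - Im (u ^+ j) * w.2, Im (u ^+ j) * w.1 + Re (u ^+ j) * w.2).
have cpx_rot j w : cpx (rot j w) = u ^+ j * cpx w by rewrite mul_cpx.
have nsq_rot j w : nsq (rot j w) = nsq w.
  by rewrite -!sqr_normc_cpx cpx_rot ComplexField.Normc.normcM nu mul1r.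
pose H w : \bar R := if nsq w < 1 then (normc (f (cpx w)) `^ p * (1 - nsq w) `^ alpha)%:E else 0%E.
have mH : measurable_fun setT H := measurable_Iw p alpha fa.
have H0 w : (0 <= H w)%E by rewrite /H; case: ifP; rewrite // lee_fin mulr_ge0 ?powR_ge0.
have mHr j : measurable_fun setT (fun w => H (rot j w)).
  by apply: (measurableT_comp mH); apply: measurable_fun_pair; mfun.
(* The average over the rotations has the same integral as [H], since rotations preserve area. *)
pose A w : \bar R := ((N%:R^-1)%:E * \sum_(j < N) H (rot j w))%E.
have mA : measurable_fun setT A.
  apply: emeasurable_funM; first exact: measurable_cst.
  by apply: emeasurable_sum => j; exact: mHr.
have A0 w : (0 <= A w)%E.
  by apply: mule_ge0; [rewrite lee_fin|apply: sume_ge0].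
have IA : (\int[leb2]_w A w = Iw p alpha f)%E.
  have mS : measurable_fun setT (fun w => \sum_(j < N) H (rot j w))%E.
    by apply: emeasurable_sum => j; exact: mHr.
  rewrite (ge0_integralZl leb2 measurableT (measurable_RT2 mS)); [|by move=> w _; apply: sume_ge0|by rewrite lee_fin].
  rewrite (ge0_integral_sum leb2 measurableT (fun j : 'I_N => measurable_RT2 (mHr j))); last by [].
  rewrite (eq_bigr (fun=> 1%:E * Iw p alpha f)%E) => [|j _]; last first.
    rewrite mul1e -(integral2_rot _ mH H0)//.
    by rewrite -sqr_normcE nu expr1n.
  rewrite -ge0_sume_distrl// sumEFin sumr_const card_ord muleA -EFinM mulVf ?mul1e// pnatr_eq0 -lt0n//.
pose G (x : R) : \bar R := if (0 < x) && (x < r) then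
  (\sum_(k < K) normc (a k) ^+ 2 * x ^+ k * (1 - x) `^ (- dl))%:E else 0%E.
have mG : measurable_fun setT G.
  by rewrite /G; mfun; apply: measurable_sum => k; mfun.
have G0 x : (0 <= G x)%E.
  rewrite /G; case: ifPn => // /andP[x0 _]; rewrite lee_fin sumr_ge0// => k _.
  by rewrite !mulr_ge0 ?powR_ge0 ?exprn_ge0 ?normc_ge0 ?(ltW x0).
have := integral_moment_ge K (ltW dl0) (fun k => sqr_ge0 (normc (a k))).
move=> /(lee_wpmul2l (ltW (@disk_area_gt0 R))) /le_trans; apply.
rewrite [X in (_ * X)%E](_ : _ = \int[mu]_x (if (0 < x)%R then G x else 0))%E; last first.
  by apply: eq_integral => x _; rewrite /G -/r; case: (0 < x).
rewrite -(integral_radial mG G0) -IA.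
have e1 := integral_disk_onem_powR (ler0n _ 2) eta1.
apply: le_trans (leeD2l _ e1).
have mE : measurable_fun setT (fun w : R * R =>
    (if ((0 < nsq w) && (nsq w < 1))%R then (2 * (1 - nsq w) `^ eta)%:E else 0)%E).
  by have mn := @measurable_nsq R; mfun.
rewrite -(ge0_integralD leb2 measurableT _ (measurable_RT2 mA) _ (measurable_RT2 mE)); [|by []|]; last first.
  by move=> w _; case: ifP; rewrite // lee_fin mulr_ge0 ?powR_ge0.
apply: le_integral_leb2.
- by have mn := @measurable_nsq R; mfun; apply: (measurableT_comp mG); rewrite -/(nsq _).
- exact: emeasurable_funD.
- by move=> w; case: ifP.
move=> w; rewrite -/(nsq w) /G; case: ifPn => n0; last first.
  by rewrite adde_ge0//; case: ifP; rewrite // lee_fin mulr_ge0 ?powR_ge0.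
rewrite n0/=; case: ifPn => nr; last first.
  by rewrite adde_ge0//; case: ifP; rewrite // lee_fin mulr_ge0 ?powR_ge0.
have n1 : nsq w < 1 := lt_trans nr r1.
rewrite n1 /A (eq_bigr (fun j : 'I_N => (normc (f (u ^+ j * cpx w)) `^ p * (1 - nsq w) `^ alpha)%:E)); last first.
  by move=> j _; rewrite /H nsq_rot n1 cpx_rot.
rewrite sumEFin -EFinM -EFinD lee_fin -mulr_suml.
have zr : normc (cpx w) <= Num.sqrt r.
  by rewrite -ler_sqr ?nnegrE ?normc_ge0 ?sqrtr_ge0// sqr_normc_cpx sqr_sqrtr ltW.
have := hu _ zr.
under eq_bigr do rewrite -exprM mulnC exprM sqr_normc_cpx.
have t0 : 0 < 1 - nsq w by rewrite subr_gt0.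
move=> /(ler_wpM2r (powR_ge0 (1 - nsq w) (- dl))) /le_trans; apply.
have et : (1 - nsq w) `^ (- dl) <= (1 - nsq w) `^ eta.
  apply: ger_powR eta_le; rewrite t0/= lerBlDr lerDl nsq_ge0//.
rewrite mulrDl mul1r mulr2n mulrDl mul1r addrA lerD// -mulrA mulr_suml.
have NN : (N%:R : R) != 0 by rewrite pnatr_eq0 -lt0n.
rewrite ler_pdivrMl ?ltr0n// mulrDr (mulVKf NN).
rewrite -[X in _ + X%:R * _](card_ord N) -sum1_card natr_sum mulr_suml -big_split/=.
apply: ler_sum => j _; rewrite mul1r eta_def; apply: sqr_weight_le => //; [exact: normc_ge0|lra].
Qed.

End weighted_coefficient_bound.

Section coefficient_estimate.
Context {R : realType}.
Local Notation mu := (@lebesgue_measure R).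
Local Notation RT := (measurableTypeR R).
Implicit Types (f : R[i] -> R[i]) (a : nat -> R[i]) (w : R * R).

(** A telescoping bound in place of the integral test; it comes from ln(1 - 1/y) <= -1/y with y = x
    + 1. *)
Lemma onem_powR_diff (d x : R) : 0 < d -> 0 < x ->
  d * ((x + 1) `^ d * (x + 1))^-1 <= (x `^ d)^-1 - ((x + 1) `^ d)^-1.
Proof.
move=> d0 x0; set y := x + 1; have y0 : 0 < y by rewrite /y; lra.
have yd : 0 < y `^ d by rewrite powR_gt0.
have xd : 0 < x `^ d by rewrite powR_gt0.
have e : (x / y) `^ d <= (1 + d / y)^-1.
  have lny : ln (x / y) <= - y^-1.
    have -> : x / y = 1 + (- y^-1) by rewrite /y; field; lra.
    by apply: le_ln1Dx; rewrite ltrN2 invf_lt1// /y; lra.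
  rewrite /powR gt_eqF ?divr_gt0// -[leLHS]invrK lef_pV2 ?posrE ?invr_gt0 ?expR_gt0//; last first.
    by rewrite addr_gt0// divr_gt0.
  rewrite -expRN (le_trans _ (expR_ge1Dx _))// lerD2l -mulrN ler_wpM2l ?(ltW d0)//.
  by rewrite lerNr.
have xyd : x `^ d = (x / y) `^ d * y `^ d.
  by rewrite -powRM ?divr_ge0 ?(ltW x0) ?(ltW y0)// divfK ?gt_eqF.
have q0 : 0 < (x / y) `^ d by rewrite powR_gt0 ?divr_gt0.
have q1 : 1 + d / y <= ((x / y) `^ d)^-1.
  by rewrite -[leLHS]invrK lef_pV2 ?posrE ?invr_gt0 ?addr_gt0 ?divr_gt0.
rewrite xyd !invfM.
have Y0 : 0 <= (y `^ d)^-1 by rewrite invr_ge0 ltW.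
have := mulr_ge0 Y0 (_ : 0 <= ((x / y) `^ d)^-1 - (1 + d / y)); rewrite subr_ge0 => /(_ q1).
by move: ((x / y) `^ d)^-1 (y `^ d)^-1 y^-1 => q Y v; lra.
Qed.

Lemma zeta_sum_le (d : R) K : 0 < d ->
  \sum_(k < K) (k.+1%:R `^ d * k.+1%:R)^-1 <= 1 + d^-1 :> R.
Proof.
move=> d0; case: K => [|K].
  by rewrite big_ord0 addr_ge0// invr_ge0 ltW.
(* The induction runs on this sharper bound, whose increments are those of [onem_powR_diff]. *)
apply: (@le_trans _ _ (1 + d^-1 - d^-1 * (K.+1%:R `^ d)^-1)); last first.
  by rewrite gerBl mulr_ge0// invr_ge0 ?powR_ge0 ?ltW.
elim: K => [|K IH]; first by rewrite big_ord_recl big_ord0 powR1 mulr1 invr1; lra.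
rewrite big_ord_recr/=; have := @onem_powR_diff d K.+1%:R d0 (ltr0Sn _ _).
rewrite natr1 -ler_pdivlMl// mulrBr => h.
by apply: le_trans (lerD IH h) _; rewrite addrA subrK.
Qed.

Lemma has_power_series_scale (c : R[i]) f a : has_power_series f a ->
  has_power_series (fun z => c * f z) (fun k => c * a k).
Proof.
move=> fa z /fa /(@cvgC_mull _ c).
rewrite (_ : (fun n => c * series (fun k => a k * z ^+ k : R[i]^o) n : R[i]^o) =
  series (fun k => c * a k * z ^+ k : R[i]^o))//.
by apply/funext => n; rewrite /series mulr_sumr; apply: eq_bigr => k _; rewrite mulrA.
Qed.

Lemma Iw_scale (c : R[i]) f a (p alpha : R) : has_power_series f a ->
  Iw p alpha (fun z => c * f z) = ((normc c `^ p)%:E * Iw p alpha f)%E.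
Proof.
move=> fa; rewrite /Iw.
rewrite -(ge0_integralZl leb2 measurableT (measurable_RT2 (measurable_Iw p alpha fa))); first last.
- by rewrite lee_fin powR_ge0.
- by move=> w _; case: ifP; rewrite // lee_fin mulr_ge0 ?powR_ge0.
apply: eq_integral => w _; case: ifP => _; last by rewrite mule0.
by rewrite ComplexField.Normc.normcM powRM ?normc_ge0// -mulrA.
Qed.

(** With q = (k+1)^dl one has |a_k| <= |a_k|^2 q + 1/q. Divided by k+1, the first part is bounded by
    [coef_sqr_integral_le] and the second is summable since dl > 0. The case Iw <= 1 is treated
    separately because these bounds are not homogeneous; scaling gives the rest. *)
Lemma coef_sum_bounded (p alpha : R) : 0 <= alpha -> 2 * (alpha + 2) <= p ->
  exists2 C : R, 0 < C & forall f a K (lam : R), has_power_series f a -> 0 < lam ->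
    (Iw p alpha f <= (lam `^ p)%:E)%E ->
    \sum_(0 <= k < K) normc (a k) / k.+1%:R <= C * lam.
Proof.
move=> al0 pal.
pose dl := (p - 2 * alpha - 2) / (2 * p).
pose eta := - dl + 2 * ((- dl - alpha) / (p - 2)).
have dl0 : 0 < dl by rewrite divr_gt0//; lra.
pose D := fine (@disk_area R).
have DE : @disk_area R = D%:E by rewrite fineK// ge0_fin_numE ?(disk_area_lty)// ltW// disk_area_gt0.
have D0 : 0 < D by rewrite -lte_fin -DE disk_area_gt0.
pose C0 := 8 * (D^-1 + 2 / (eta + 1)) + (1 + dl^-1).
have h1 f a K : has_power_series f a -> (Iw p alpha f <= 1)%E ->
    \sum_(k < K) normc (a k) / k.+1%:R <= C0.
  move=> fa If.
  have := coef_sqr_integral_le K fa al0 pal erefl erefl; rewrite -/dl -/eta DE => h.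
  have {h} := le_trans h (leeD2r _ If).
  rewrite -!EFinM -EFinD lee_fin -ler_pdivlMl// mulrDr mulr1 mulKf ?gt_eqF// ler_pdivrMl// => h.
  apply: (@le_trans _ _ (\sum_(k < K) (normc (a k) ^+ 2 * (k.+1%:R `^ dl / k.+1%:R) +
      (k.+1%:R `^ dl * k.+1%:R)^-1))).
    apply: ler_sum => k _.
    have q0 : 0 < (k.+1%:R : R) `^ dl by rewrite powR_gt0.
    rewrite invfM mulrA -mulrDl ler_wpM2r ?invr_ge0//.
    have := mulVf (lt0r_neq0 q0); have : 0 < ((k.+1%:R : R) `^ dl)^-1 by rewrite invr_gt0.
    move: (_ `^ dl) (_ `^ dl)^-1 (normc (a k)) q0 => q v x q0 v0 vq.
    have : 0 <= v * (q * x - 1) ^+ 2 by rewrite mulr_ge0 ?(ltW v0) ?sqr_ge0.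
    have -> : v * (q * x - 1) ^+ 2 = (v * q) * (x ^+ 2 * q) - 2 * (v * q) * x + v by ring.
    rewrite vq; have := sqr_ge0 x; nra.
  by rewrite big_split/=; apply: lerD => //; exact: zeta_sum_le.
exists (Num.max C0 1); first by rewrite lt_max ltr01 orbT.
move=> f a K lam fa lam0 If.
have fa' := @has_power_series_scale (lam^-1)%:C _ _ fa.
have n1 : normc (lam^-1)%:C = lam^-1 by rewrite normcR gtr0_norm ?invr_gt0.
have := h1 _ _ K fa' _; rewrite (Iw_scale _ _ _ fa) n1 => h2.
rewrite -ler_pdivrMr// mulr_suml big_mkord le_max; apply/orP; left.
apply: le_trans (h2 _).
  by apply: ler_sum => k _; rewrite ComplexField.Normc.normcM n1 [lam^-1 * _]mulrC mulrAC.
apply: (@le_trans _ _ ((lam^-1 `^ p)%:E * (lam `^ p)%:E)%E).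
  by rewrite lee_wpmul2l// lee_fin powR_ge0.
by rewrite -EFinM -powRM ?invr_ge0 ?(ltW lam0)// mulVf ?gt_eqF// powR1.
Qed.

End coefficient_estimate.

(** * Upper bound *)

Section weighted_composition_bound.
Context {R : realType}.
Local Notation mu := (@lebesgue_measure R).
Local Notation RT := (measurableTypeR R).
Implicit Types (f : R[i] -> R[i]) (a : nat -> R[i]) (w : R * R).

(* Uses [s (1 - s) (1 - |z|^2) <= |v|^2 - s^2] for [v = 1 - (1 - s) z]; the
   difference of the two sides is [(1 - s) |1 - z|^2]. *)
Lemma wcomp_weight_le (s x y X p alpha : R) : 0 < s < 1 -> 0 <= alpha -> 2 * (alpha + 2) <= p ->
  x ^+ 2 + y ^+ 2 < 1 -> 0 <= X ->
  let n := (1 - (1 - s) * x) ^+ 2 + ((1 - s) * y) ^+ 2 in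
  s ^+ 2 < n ->
  (Num.sqrt n)^-1 `^ p * X `^ p * (1 - (x ^+ 2 + y ^+ 2)) `^ alpha <=
  s `^ (alpha - p) * (1 - s) `^ (- alpha) * (X `^ p * (1 - s ^+ 2 / n) `^ alpha * (s ^+ 4 / n ^+ 2)).
Proof.
move=> /andP[s0 s1] al0 pal xy X0 n sn.
have n0 : 0 < n by rewrite (le_lt_trans _ sn)// sqr_ge0.
set N := Num.sqrt n; have N0 : 0 < N by rewrite sqrtr_gt0.
have nN : n = N ^+ 2 by rewrite sqr_sqrtr// ltW.
have sN : s < N by rewrite -(ltr_pXn2r (_ : 0 < 2)%N) ?nnegrE ?(ltW s0) ?(ltW N0)// -nN.
have s10 : 0 < 1 - s by lra.
have t0 : 0 < 1 - (x ^+ 2 + y ^+ 2) by lra.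
have u0 : 0 < 1 - s ^+ 2 / n by rewrite subr_gt0 ltr_pdivrMr// mul1r.
have h1 : 1 - (x ^+ 2 + y ^+ 2) <= (1 - s ^+ 2 / n) * N ^+ 2 * (s^-1 * (1 - s)^-1).
  rewrite -nN mulrBl mul1r divfK ?gt_eqF// -invfM ler_pdivlMr ?mulr_gt0//.
  have := mulr_ge0 (ltW s10) (addr_ge0 (sqr_ge0 (1 - x)) (sqr_ge0 y)).
  by rewrite /n; nra.
have eV (z r : R) : 0 < z -> z^-1 `^ r = z `^ (- r).
  by move=> z0; rewrite -powR_inv1 ?(ltW z0)// -powRrM mulN1r.
have v0 : 0 <= s^-1 * (1 - s)^-1 by rewrite -invfM invr_ge0 mulr_ge0 ?ltW.
have h2 : (1 - (x ^+ 2 + y ^+ 2)) `^ alpha <=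
    (1 - s ^+ 2 / n) `^ alpha * N `^ (2 * alpha) * (s `^ (- alpha) * (1 - s) `^ (- alpha)).
  have c0 : 0 <= (1 - s ^+ 2 / n) * N ^+ 2 by rewrite mulr_ge0 ?sqr_ge0 ?ltW.
  apply: le_trans (ge0_ler_powR al0 (ltW t0) (mulr_ge0 c0 v0) h1) _.
  have [sV tV] : 0 <= s^-1 /\ 0 <= (1 - s)^-1 by rewrite !invr_ge0 !ltW.
  rewrite (@powRM _ _ _ alpha c0 v0) (@powRM _ _ _ alpha (ltW u0) (sqr_ge0 _)) (@powRM _ _ _ alpha sV tV).
  by rewrite (eV _ _ s0) (eV _ _ s10) powRrM powR_mulrn// ltW.
(* Here p - 2 alpha >= 4 enters: as s < N, the power (s/N)^(p - 2 alpha) is at most (s/N)^4, which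
   is the Jacobian of [phi] up to the factor s^2 / (1-s)^2. *)
have h3 : N `^ (2 * alpha) * N^-1 `^ p <= s `^ (2 * alpha - p) * (s ^+ 4 / n ^+ 2).
  have q : (s / N) `^ (p - 2 * alpha) <= (s / N) ^+ 4.
    rewrite -powR_mulrn ?divr_ge0 ?(ltW s0) ?(ltW N0)//; apply: ger_powR; last by lra.
    by rewrite divr_gt0// ler_pdivrMr// mul1r ltW.
  have -> : s ^+ 4 / n ^+ 2 = (s / N) ^+ 4 by rewrite nN expr_div_n -exprM.
  have -> : N `^ (2 * alpha) * N^-1 `^ p = s `^ (2 * alpha - p) * (s / N) `^ (p - 2 * alpha).
    rewrite powRM ?invr_ge0 ?(ltW s0) ?(ltW N0)// mulrA -powRD ?(gt_eqF s0) ?implybT//.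
    rewrite addrA subrK subrr powRr0 mul1r !(eV _ _ N0).
    by rewrite -powRD ?(gt_eqF N0) ?implybT//; congr (_ `^ _); ring.
  by rewrite ler_wpM2l ?powR_ge0.
have Xp := powR_ge0 X p.
rewrite -mulrA mulrCA; apply: (@le_trans _ _ (X `^ p * (N^-1 `^ p * ((1 - s ^+ 2 / n) `^ alpha *
    N `^ (2 * alpha) * (s `^ (- alpha) * (1 - s) `^ (- alpha)))))).
  by rewrite ler_wpM2l// ler_wpM2l ?powR_ge0.
have -> : s `^ (alpha - p) = s `^ (2 * alpha - p) * s `^ (- alpha).
  by rewrite -powRD ?(gt_eqF s0) ?implybT//; congr (_ `^ _); ring.
have := ler_wpM2l (mulr_ge0 (mulr_ge0 Xp (powR_ge0 (1 - s ^+ 2 / n) alpha))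
  (mulr_ge0 (powR_ge0 s (- alpha)) (powR_ge0 (1 - s) (- alpha)))) h3.
by congr (_ <= _); ring.
Qed.

End weighted_composition_bound.

Section weighted_composition_norm.
Context {R : realType}.
Local Notation mu := (@lebesgue_measure R).
Local Notation RT := (measurableTypeR R).
Implicit Types (f : R[i] -> R[i]) (a : nat -> R[i]) (w : R * R).

(* Substitute [v = 1 - (1 - s) z], then [v = s v'], then invert. *)
Lemma integral_phi_subst (s : R) (H : R * R -> \bar R) : 0 < s < 1 ->
  measurable_fun setT H -> (forall w, 0 <= H w)%E ->
  (\int[leb2]_w (let x := (1 - (1 - s) * w.1)%R in let y := (- ((1 - s) * w.2))%R in
     let n := (x ^+ 2 + y ^+ 2)%R in
     if (0 < x)%R then H (s * x / n, - (s * y / n))%R * (s ^+ 4 / n ^+ 2)%:E else 0) <=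
   (s ^+ 2 / (1 - s) ^+ 2)%:E * \int[leb2]_w H w)%E.
Proof.
move=> /andP[s0 s1] mH H0; have s10 : 0 < 1 - s by lra.
pose B (v : R * R) : \bar R := if (0 < v.1)%R then
  (H (s * v.1 / nsq v, - (s * v.2 / nsq v))%R * (s ^+ 4 / nsq v ^+ 2)%:E)%E else 0%E.
have mn := @measurable_nsq R.
have mB : measurable_fun setT B.
  by rewrite /B; mfun; apply: (measurableT_comp mH); apply: measurable_fun_pair; mfun.
have B0 v : (0 <= B v)%E.
  by rewrite /B; case: ifP => // _; rewrite mule_ge0// lee_fin divr_ge0 ?exprn_ge0 ?nsq_ge0 ?ltW.
have mB2 : measurable_fun setT (fun w => B (- (1 - s) * w.1 + 1, - (1 - s) * w.2 + 0)).
  by apply: (measurableT_comp mB); apply: measurable_fun_pair; mfun.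
have ns : - (1 - s) != 0 by rewrite oppr_eq0 gt_eqF.
have e1 : (\int[leb2]_v B v = ((1 - s) ^+ 2)%:E *
    \int[leb2]_w B (- (1 - s) * w.1 + 1, - (1 - s) * w.2 + 0)%R)%E.
  by rewrite (integral2_affine 1 0 ns ns mB B0) normrN gtr0_norm// expr2.
have sn : s != 0 by rewrite gt_eqF.
have e2 : (\int[leb2]_v B v = (s ^+ 2)%:E * \int[leb2]_v (if (0 < v.1)%R then
    H (v.1 / nsq v, - v.2 / nsq v)%R * (nsq v ^- 2)%:E else 0))%E.
  rewrite (integral2_affine 0 0 sn sn mB B0) gtr0_norm// expr2; congr (_ * _)%E.
  apply: eq_integral => v _; rewrite /B !addr0/= pmulr_rgt0//; case: ifPn => // v0.
  have n0 : 0 < nsq v by rewrite /nsq ltr_pwDl ?sqr_ge0 ?exprn_gt0.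
  have -> : nsq (s * v.1, s * v.2) = s ^+ 2 * nsq v by rewrite /nsq/=; ring.
  congr (H (_, _) * _%:E)%E; field; rewrite ?(gt_eqF n0) ?sn//.
have e3 := integral_inv2 mH H0.
rewrite [X in (X <= _)%E](_ : _ = \int[leb2]_w B (- (1 - s) * w.1 + 1, - (1 - s) * w.2 + 0)%R)%E; last first.
  apply: eq_integral => w _; rewrite /B /nsq/= addr0.
  by rewrite [_ + 1](_ : _ = 1 - (1 - s) * w.1) ?mulNr// addrC.
have -> : (\int[leb2]_w B (- (1 - s) * w.1 + 1, - (1 - s) * w.2 + 0)%R =
    (((1 - s) ^+ 2)^-1)%:E * \int[leb2]_v B v)%E.
  by rewrite e1 muleA -EFinM mulVf ?mul1e// expf_neq0// gt_eqF.
rewrite e2 muleA -EFinM [_^-1 * _]mulrC; apply: lee_wpmul2l.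
  by rewrite lee_fin divr_ge0 ?sqr_ge0.
(* Inversion preserves the right half-plane; the inequality comes from extending the integral to the
   whole plane. *)
rewrite e3; apply: le_integral_leb2 => //.
- by mfun.
- by move=> w; case: ifP.
- by move=> w; case: ifP.
Qed.

(** The factor is the p-th power of s^(gm-1) (1-s)^(-gm) with gm = (alpha+2)/p. It arises from the
    pointwise weight inequality and from the Jacobian of [phi]. *)
Lemma Iw_wcomp_le (s p alpha : R) f a : 0 < s < 1 -> 0 <= alpha -> 2 * (alpha + 2) <= p ->
  has_power_series f a ->
  (Iw p alpha (wcomp s f) <= (s `^ (alpha + 2 - p) * (1 - s) `^ (- alpha - 2))%:E * Iw p alpha f)%E.
Proof.
move=> s01 al0 pal fa; have /andP[s0 s1] := s01; have s10 : 0 < 1 - s by lra.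
pose H w : \bar R := if nsq w < 1 then (normc (f (cpx w)) `^ p * (1 - nsq w) `^ alpha)%:E else 0%E.
have mH : measurable_fun setT H := measurable_Iw p alpha fa.
have H0 w : (0 <= H w)%E by rewrite /H; case: ifP; rewrite // lee_fin mulr_ge0 ?powR_ge0.
have HE w : H w = if nsq w < 1 then (normc (f (cpx w)) `^ p * (1 - nsq w) `^ alpha)%:E else 0%E by [].
clearbody H.
have IH : Iw p alpha f = (\int[leb2]_w H w)%E by apply: eq_integral => w _; rewrite HE.
have := integral_phi_subst s01 mH H0.
pose c : R := s `^ (alpha - p) * (1 - s) `^ (- alpha).
have c0 : 0 <= c by rewrite mulr_ge0 ?powR_ge0.
set J := (X in (X <= _)%E) => hJ.
apply: (@le_trans _ _ (c%:E * J)%E); last first.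
  apply: le_trans (lee_wpmul2l _ hJ) _; first by rewrite lee_fin.
  rewrite IH muleA -EFinM (_ : c * _ = s `^ (alpha + 2 - p) * (1 - s) `^ (- alpha - 2))//.
  rewrite /c mulrACA; congr (_ * _).
    rewrite -powR_mulrn ?(ltW s0)// -powRD ?(gt_eqF s0) ?implybT//; congr (_ `^ _); ring.
  by rewrite -powR_mulrn ?(ltW s10)// -powRN -powRD ?(gt_eqF s10) ?implybT.
rewrite -(ge0_integralZl leb2 measurableT); first last.
- by rewrite lee_fin.
- by move=> w _ /=; case: ifP => // _; rewrite mule_ge0// lee_fin divr_ge0 ?exprn_ge0 ?addr_ge0 ?sqr_ge0 ?ltW.
- apply: measurable_RT2 => /=; mfun; apply: (measurableT_comp mH).
  by apply: measurable_fun_pair; mfun.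
apply: le_integral_leb2.
- exact: measurable_Iw (wcomp_power_series s01 fa).
- apply: emeasurable_funM => /=; first exact: measurable_cst.
  by mfun; apply: (measurableT_comp mH); apply: measurable_fun_pair; mfun.
- by move=> w; case: ifP; rewrite // lee_fin mulr_ge0 ?powR_ge0.
move=> w; have [w1|w1] := boolP (nsq w < 1)%R; last first.
  apply: mule_ge0; first by rewrite lee_fin.
  move=> /=; case: ifP => [_|_]; last exact: lexx.
  by rewrite mule_ge0// lee_fin divr_ge0 ?exprn_ge0 ?addr_ge0 ?sqr_ge0 ?ltW.
move=> /=.
have z1 : unit_disk (cpx w) by rewrite unit_diskE.
have d1 := phi_unit_disk s01 z1.
pose x := 1 - (1 - s) * w.1; pose y := - ((1 - s) * w.2); pose n := x ^+ 2 + y ^+ 2.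
have denE : 1 - (1 - s)%:C * cpx w = x +i* y.
  by rewrite /cpx/=; simpc; rewrite /x /y; congr (_ +i* _); ring.
have x0 : 0 < x.
  have : w.1 < 1 by have := w1; rewrite /nsq; have := sqr_ge0 w.2; nra.
  by rewrite /x; nra.
have n0 : 0 < n by rewrite /n ltr_pwDl ?sqr_ge0 ?exprn_gt0.
have phiE : phi s (cpx w) = cpx (s * x / n, - (s * y / n)).
  rewrite /phi denE /cpx/=; simpc; congr (_ +i* _); rewrite /n; ring.
have nN : normc (x +i* y) = Num.sqrt n by [].
have sn : s ^+ 2 / n < 1.
  have := d1; rewrite phiE unit_diskE /nsq/=.
  rewrite (_ : (s * x / n) ^+ 2 + (- (s * y / n)) ^+ 2 = s ^+ 2 / n)//.
  by rewrite /n; field; rewrite -/n gt_eqF.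
have nsq_phi : nsq (s * x / n, - (s * y / n)) = s ^+ 2 / n.
  by rewrite /nsq/= /n; field; rewrite -/n gt_eqF.
have nE : n = (1 - (1 - s) * w.1) ^+ 2 + ((1 - s) * w.2) ^+ 2 by rewrite /n /y sqrrN.
have key : normc (wcomp s f (cpx w)) `^ p * (1 - nsq w) `^ alpha <=
    c * (normc (f (phi s (cpx w))) `^ p * (1 - s ^+ 2 / n) `^ alpha * (s ^+ 4 / n ^+ 2)).
  rewrite /wcomp denE ComplexField.Normc.normcM ComplexField.Normc.normcV nN.
  rewrite powRM ?invr_ge0 ?sqrtr_ge0 ?normc_ge0// nE.
  apply: wcomp_weight_le => //; first exact: normc_ge0.
  by move: sn; rewrite -nE ltr_pdivrMr// mul1r.
rewrite -/x -/y -/n (ifT _ _ x0) HE nsq_phi (ifT _ _ sn) -phiE.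
exact: key.
Qed.

End weighted_composition_norm.

(** * The kernel in s and Jensen's inequality *)

Section hilbert_kernel.
Context {R : realType}.
Local Notation mu := (@lebesgue_measure R).
Local Notation RT := (measurableTypeR R).
Implicit Types (f : R[i] -> R[i]) (a : nat -> R[i]) (w : R * R) (s gm b : R).

(** The factor (1-s)^b times the bound on the norm of [wcomp s]. *)
Definition hker gm b s : R := s `^ (gm - 1) * (1 - s) `^ (b - gm).

Lemma hker_ge0 gm b s : 0 <= hker gm b s.
Proof. by rewrite mulr_ge0 ?powR_ge0. Qed.

Lemma measurable_hker gm b : measurable_fun setT (hker gm b).
Proof. by rewrite /hker; mfun. Qed.

Definition hkerE gm b s : \bar R := if (0 < s) && (s < 1) then (hker gm b s)%:E else 0%E.

Lemma measurable_hkerE gm b : measurable_fun setT (hkerE gm b).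
Proof. by have mh := measurable_hker gm b; rewrite /hkerE; mfun. Qed.

Lemma hkerE_ge0 gm b s : (0 <= hkerE gm b s)%E.
Proof. by rewrite /hkerE; case: ifP; rewrite // lee_fin hker_ge0. Qed.

(** On either half of ]0, 1[ the factor whose base is at least 1/2 is at most 2, its exponent being
    at least -1. *)
Lemma hker_le gm b s : 0 <= b -> gm <= 1 / 2 -> 0 < gm -> 0 < s < 1 ->
  hker gm b s <= 2 * s `^ (gm - 1) + 2 * (1 - s) `^ (b - gm).
Proof.
move=> b0 g2 g0 /andP[s0 s1]; rewrite /hker.
have v (x r : R) : -1 <= r -> 1 / 2 <= x <= 1 -> x `^ r <= 2.
  move=> r1 /andP[x2 x1]; apply: (@le_trans _ _ (x `^ (-1))).
    by apply: ger_powR => //; rewrite x1 andbT; lra.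
  rewrite powR_inv1; last lra.
  by rewrite -[leRHS]invrK lef_pV2 ?posrE ?invr_gt0//; lra.
have [s2|s2] := leP s (1 / 2).
  rewrite ler_wpDr ?mulr_ge0 ?powR_ge0// mulrC ler_wpM2r ?powR_ge0// v//; first lra.
  by apply/andP; split; lra.
rewrite ler_wpDl ?mulr_ge0 ?powR_ge0// ler_wpM2r ?powR_ge0// v//; first lra.
by apply/andP; split; lra.
Qed.

(** [Beta] is the [fine] part of an extended integral, so it stands for the integral only once
    finiteness is shown. Positivity comes from the interval ]0, 1/2[. *)
Lemma integral_hker gm b : 0 <= b -> gm <= 1 / 2 -> 0 < gm ->
  0 < Beta gm (b + 1 - gm) /\ (\int[mu]_s hkerE gm b s = (Beta gm (b + 1 - gm))%:E)%E.
Proof.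
move=> b0 g2 g0.
have e : Beta gm (b + 1 - gm) = fine (\int[mu]_s hkerE gm b s)%E.
  rewrite /Beta /Rintegral -/I01 integral_I01; congr fine; apply: eq_integral => s _.
  by rewrite /hkerE /hker [b + 1 - gm - 1](_ : _ = b - gm)//; ring.
have mh := measurable_hkerE gm b.
have up : (\int[mu]_s hkerE gm b s <= (2 * (gm^-1 + (b - gm + 1)^-1))%:E)%E.
  pose A s : \bar R := if (0 < s) && (s <= 1) then (s `^ (gm - 1))%:E else 0%E.
  pose B s : \bar R := if (1 - 1 <= s) && (s < 1) then ((1 - s) `^ (b - gm + 1 - 1))%:E else 0%E.
  have mA : measurable_fun setT A by rewrite /A; mfun.
  have mB : measurable_fun setT B by rewrite /B; mfun.
  have A0 s : (0 <= A s)%E by rewrite /A; case: ifP; rewrite // lee_fin powR_ge0.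
  have B0 s : (0 <= B s)%E by rewrite /B; case: ifP; rewrite // lee_fin powR_ge0.
  have IA : (\int[mu]_s A s = (gm^-1)%:E)%E by rewrite (integral0_powR g0 ltr01) powR1 mul1r.
  have bg : 0 < b - gm + 1 by lra.
  have IB : (\int[mu]_s B s = ((b - gm + 1)^-1)%:E)%E by rewrite (integral1_powR bg ltr01) powR1 mul1r.
  have mAB : measurable_fun setT (fun s => A s + B s)%E by exact: emeasurable_funD.
  have -> : (2 * (gm^-1 + (b - gm + 1)^-1))%:E = (2%:E * (\int[mu]_s A s + \int[mu]_s B s))%E.
    by rewrite IA IB -EFinD -EFinM.
  rewrite -(ge0_integralD mu measurableT _ (measurable_RT mA) _ (measurable_RT mB))//.
  rewrite -(ge0_integralZl mu measurableT (measurable_RT mAB)) ?lee_fin//; last first.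
    by move=> s _; rewrite adde_ge0.
  apply: le_integral_leb => //; first by apply: emeasurable_funM.
    by move=> s; exact: hkerE_ge0.
  move=> s; rewrite /hkerE; case: ifPn => [s01|_]; last by rewrite mule_ge0 ?adde_ge0.
  have := hker_le b0 g2 g0 s01; have /andP[s0 s1] := s01.
  rewrite /A /B s0 s1 (ltW s1) subrr (ltW s0)/= addrK -EFinD -EFinM lee_fin mulrDr.
  by [].
have lo : (((1 / 2) `^ b * (1 / 2))%:E <= \int[mu]_s hkerE gm b s)%E.
  have m1 : measurable_fun setT (fun s : R => if ((0 < s) && (s < 1 / 2))%R then 1 else 0 : \bar R)%E.
    by mfun.
  have h2 : 0 <= 1 / 2 :> R by lra.
  rewrite -{2}[1 / 2]subr0 EFinM -(integral_ltr_itv h2).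
  rewrite -(ge0_integralZl mu measurableT (measurable_RT m1)) ?lee_fin ?powR_ge0//; last first.
    by move=> s _; case: ifP.
  apply: le_integral_leb => //.
  - by apply: emeasurable_funM.
  - by move=> s; rewrite mule_ge0 ?lee_fin ?powR_ge0//; case: ifP.
  move=> s; case: ifPn => [/andP[s0 s2]|_]; last by rewrite mule0 hkerE_ge0.
  rewrite mule1 /hkerE s0 /= ifT; last by lra.
  rewrite lee_fin /hker -[leLHS]mul1r; apply: ler_pM; rewrite ?ler01 ?powR_ge0//.
    rewrite -[leLHS](powRr0 s).
    by apply: ger_powR; [apply/andP; split; lra|lra].
  apply: (@le_trans _ _ ((1 - s) `^ b)).
    by apply: ge0_ler_powR => //; rewrite ?nnegrE; lra.
  by apply: ger_powR; [apply/andP; split; lra|lra].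
have fn : (\int[mu]_s hkerE gm b s)%E \is a fin_num.
  have i0 : (0 <= \int[mu]_s hkerE gm b s)%E by apply: integral_ge0 => s _; exact: hkerE_ge0.
  by rewrite (ge0_fin_numE i0); exact: le_lt_trans up (ltry _).
split; last by rewrite e fineK.
rewrite e -lte_fin fineK//; apply: lt_le_trans lo; rewrite lte_fin mulr_gt0 ?powR_gt0//; lra.
Qed.

(* Integrate the tangent line inequality for [x ^ p] at [x = m / B]. *)
Lemma holder_tangent (p m B : R) (X h : R -> R) : 1 < p -> 0 <= m -> 0 < B ->
  measurable_fun setT X -> measurable_fun setT h ->
  (forall s, 0 < s < 1 -> 0 <= X s /\ 0 < h s) ->
  (\int[mu]_s (if ((0 < s) && (s < 1))%R then (h s)%:E else 0) = B%:E)%E ->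
  (m%:E <= \int[mu]_s (if ((0 < s) && (s < 1))%R then (X s)%:E else 0))%E ->
  ((m `^ p)%:E <= (B `^ (p - 1))%:E *
    \int[mu]_s (if ((0 < s) && (s < 1))%R then (X s `^ p * h s `^ (1 - p))%:E else 0))%E.
Proof.
move=> p1 m0 B0 mX mh Xh hB mI; pose t := m / B.
have t0 : 0 <= t by rewrite divr_ge0 ?(ltW B0).
have tp s : 0 < s < 1 -> p * t `^ (p - 1) * X s <= X s `^ p * h s `^ (1 - p) + (p - 1) * t `^ p * h s.
  move=> /Xh[x0 h0].
  (* The tangent line inequality at t is Young's inequality for X / h and t^(p-1). *)
  have q0 : 0 < p / (p - 1) by rewrite divr_gt0; lra.
  have := conjugate_powR (divr_ge0 x0 (ltW h0)) (powR_ge0 t (p - 1)) (_ : 0 < p) q0 _.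
  rewrite -powRrM [(p - 1) * _]mulrC divfK; last by lra.
  have p0 : 0 < p by lra.
  move=> /(_ p0); have -> : p^-1 + (p / (p - 1))^-1 = 1 by field; lra.
  move=> /(_ erefl); rewrite -(ler_pM2l (mulr_gt0 p0 h0)).
  have -> : p * h s * (X s / h s * t `^ (p - 1)) = p * t `^ (p - 1) * X s by field; lra.
  move=> /le_trans; apply.
  have -> : (X s / h s) `^ p = X s `^ p * h s `^ (- p).
    by rewrite powRM// ?invr_ge0 ?(ltW h0)// -powR_inv1 ?(ltW h0)// -powRrM mulN1r.
  have -> : h s `^ (1 - p) = h s * h s `^ (- p).
    by rewrite powRD ?(gt_eqF h0) ?implybT// powRr1// ltW.
  by rewrite le_eqVlt; apply/orP; left; apply/eqP; field; rewrite !gt_eqF//; lra.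
pose XE s : \bar R := if (0 < s) && (s < 1) then (X s)%:E else 0%E.
pose hE s : \bar R := if (0 < s) && (s < 1) then (h s)%:E else 0%E.
pose YE s : \bar R := if (0 < s) && (s < 1) then (X s `^ p * h s `^ (1 - p))%:E else 0%E.
have mXE : measurable_fun setT XE by rewrite /XE; mfun.
have mhE : measurable_fun setT hE by rewrite /hE; mfun.
have mYE : measurable_fun setT YE by rewrite /YE; mfun.
have X0 s : (0 <= XE s)%E by rewrite /XE; case: ifPn => // /Xh[]; rewrite lee_fin.
have h0 s : (0 <= hE s)%E by rewrite /hE; case: ifPn => // /Xh[_ /ltW]; rewrite lee_fin.
have Y0 s : (0 <= YE s)%E by rewrite /YE; case: ifPn => // _; rewrite lee_fin mulr_ge0 ?powR_ge0.
have ct : 0 <= (p - 1) * t `^ p by rewrite mulr_ge0 ?powR_ge0//; lra.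
have cp : 0 <= p * t `^ (p - 1) by rewrite mulr_ge0 ?powR_ge0//; lra.
have mhc : measurable_fun setT (fun s => ((p - 1) * t `^ p)%:E * hE s)%E.
  by apply: emeasurable_funM.
have key : ((p * t `^ (p - 1) * m)%:E <= \int[mu]_s YE s + ((p - 1) * t `^ p * B)%:E)%E.
  rewrite EFinM (le_trans (lee_wpmul2l _ mI)) ?lee_fin// -/XE [X in (_ + X)%E]EFinM -hB -/hE.
  rewrite -(ge0_integralZl mu measurableT (measurable_RT mXE)) ?lee_fin//.
  rewrite -(ge0_integralZl mu measurableT (measurable_RT mhE)) ?lee_fin//.
  rewrite -(ge0_integralD mu measurableT _ (measurable_RT mYE) _ (measurable_RT mhc))//; last first.
    by move=> s _; rewrite mule_ge0 ?lee_fin.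
  apply: le_integral_leb => //.
  - by apply: emeasurable_funM.
  - by apply: emeasurable_funD.
  - by move=> s; rewrite mule_ge0 ?lee_fin.
  move=> s; rewrite /XE /YE /hE; case: ifPn => s01; last by rewrite !mule0 adde0.
  by rewrite -!EFinM -EFinD lee_fin tp.
rewrite -/YE; have Yn : (0 <= \int[mu]_s YE s)%E by apply: integral_ge0.
move: key; move: (\int[mu]_s YE s)%E Yn => [y| |]// y0; last first.
  by rewrite gt0_muley ?leey// lte_fin powR_gt0.
rewrite -EFinD -EFinM !lee_fin => key.
have tB : t * B = m by rewrite /t divfK// gt_eqF.
have tpE : t `^ p = t * t `^ (p - 1).
  have [->|tn] := eqVneq t 0; first by rewrite mul0r powR0//; lra.
  by rewrite -{2}(powRr1 t0) -powRD ?tn ?implybT//; congr (_ `^ _); ring.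
have {key}y_ge : t `^ p * B <= y.
  by move: key; rewrite tpE -tB; lra.
rewrite -tB powRM ?(ltW B0)// -[leLHS]mulrC; have -> : B `^ p = B `^ (p - 1) * B.
  by rewrite -{3}(powRr1 (ltW B0)) -powRD ?(gt_eqF B0) ?implybT//; congr (_ `^ _); ring.
by rewrite -mulrA ler_wpM2l ?powR_ge0// mulrC.
Qed.

End hilbert_kernel.

Section hilbert_upper_bound.
Context {R : realType}.
Local Notation mu := (@lebesgue_measure R).
Local Notation RT := (measurableTypeR R).
Implicit Types (f g : R[i] -> R[i]) (a c : nat -> R[i]) (w : R * R) (s gm b p alpha : R).

(** Real coordinates for the denominator of [phi] and, in [phir], for [phi] itself: measurability is
    needed jointly in s and z. *)
Definition den s w : R * R := (1 - (1 - s) * w.1, - ((1 - s) * w.2)).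

Definition phir s w : R * R :=
  (s * (den s w).1 / nsq (den s w), - (s * (den s w).2 / nsq (den s w))).

Lemma phi_cpx s w : phi s (cpx w) = cpx (phir s w).
Proof.
have denE : 1 - (1 - s)%:C * cpx w = cpx (den s w).
  by rewrite /cpx/=; simpc; congr (_ +i* _); ring.
by rewrite /phi denE /phir /cpx/=; simpc; congr (_ +i* _); rewrite /nsq/=; ring.
Qed.

Lemma normc_wcomp s f w :
  normc (wcomp s f (cpx w)) = (Num.sqrt (nsq (den s w)))^-1 * normc (f (cpx (phir s w))).
Proof.
have denE : 1 - (1 - s)%:C * cpx w = cpx (den s w).
  by rewrite /cpx/=; simpc; congr (_ +i* _); ring.
by rewrite /wcomp phi_cpx denE ComplexField.Normc.normcM ComplexField.Normc.normcV.
Qed.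

Lemma measurable_den : measurable_fun setT (fun x : R * (R * R) => nsq (den x.1 x.2)).
Proof. by rewrite /nsq /den/=; mfun. Qed.

Lemma measurable_phir : measurable_fun setT (fun x : R * (R * R) => phir x.1 x.2).
Proof.
have md := measurable_den.
by rewrite /phir; apply: measurable_fun_pair => /=; mfun.
Qed.

(** Apply [holder_tangent] with the kernel [hker], then Tonelli's theorem. Since (1-s)^b times the
    norm bound of [wcomp s] is exactly [hker], the s-integrand becomes hker^p hker^(1-p) = hker, and
    the constant is B^(p-1) B = B^p. *)
Lemma Iw_hilbert_le f g a c b p alpha : has_power_series f a -> has_power_series g c ->
  0 <= b -> 0 <= alpha -> 2 * (alpha + 2) <= p ->
  (forall z, unit_disk z -> ((normc (g z))%:E <=
     \int[mu]_(s in I01) (normc (((1 - s) `^ b)%:C * wcomp s f z))%:E)%E) ->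
  (Iw p alpha g <= (Beta ((alpha + 2) / p) (b + 1 - (alpha + 2) / p) `^ p)%:E * Iw p alpha f)%E.
Proof.
move=> fa gc b0 al0 pal gle; set gm := (alpha + 2) / p.
have p4 : 4 <= p by lra.
have gmp : gm * p = alpha + 2 by rewrite /gm divfK//; lra.
have gm0 : 0 < gm by rewrite divr_gt0//; lra.
have gm2 : gm <= 1 / 2 by rewrite /gm ler_pdivrMr; lra.
have [B0 hB] := integral_hker b0 gm2 gm0.
set B := Beta _ _ in B0 hB *.
pose F w := if nsq w < 1 then normc (f (cpx w)) else 0.
have mF : measurable_fun setT F := measurable_normc_power_series fa.
have F0 w : 0 <= F w by rewrite /F; case: ifP; rewrite // normc_ge0.
have FE w : nsq w < 1 -> F w = normc (f (cpx w)) by rewrite /F => ->.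
have md := measurable_den; have mn := @measurable_nsq R.
have mh := measurable_hker gm b.
(* [F] is |f| cut off outside the disk, so [X] is measurable everywhere; it agrees with the modulus
   of the integrand when 0 < s < 1 and |z| < 1. *)
pose X (x : R * (R * R)) := (1 - x.1) `^ b * ((Num.sqrt (nsq (den x.1 x.2)))^-1 * F (phir x.1 x.2)).
have mFp : measurable_fun setT (fun x : R * (R * R) => F (phir x.1 x.2)).
  exact: (measurableT_comp mF measurable_phir).
have XE s w : 0 < s < 1 -> nsq w < 1 ->
    X (s, w) = normc (((1 - s) `^ b)%:C * wcomp s f (cpx w)).
  move=> s01 w1; rewrite ComplexField.Normc.normcM normcR ger0_norm ?powR_ge0// normc_wcomp /X FE//=.
  by rewrite -unit_diskE -phi_cpx; apply: phi_unit_disk => //; rewrite unit_diskE.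
have msq : measurable_fun setT (fun x : R * (R * R) => Num.sqrt (nsq (den x.1 x.2))).
  exact: measurable_fun_sqrt.
have mX : measurable_fun setT X.
  by clearbody F; rewrite /X; apply: measurable_funM; [mfun|apply: measurable_funM; [apply: measurable_funV|]].
have X0 x : 0 <= X x by rewrite /X !mulr_ge0 ?powR_ge0 ?invr_ge0 ?sqrtr_ge0.
clearbody X; clear mFp msq mF F0 FE F.
pose K (x : R * (R * R)) : \bar R := if (0 < x.1) && (x.1 < 1) && (nsq x.2 < 1)
  then (X x `^ p * hker gm b x.1 `^ (1 - p) * (1 - nsq x.2) `^ alpha)%:E else 0%E.
have mn2 : measurable_fun setT (fun x : R * (R * R) => nsq x.2).
  exact: (measurableT_comp mn).
have mh1 : measurable_fun setT (fun x : R * (R * R) => hker gm b x.1).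
  exact: (measurableT_comp mh).
have mK : measurable_fun setT K by rewrite /K; mfun.
have K0 x : (0 <= K x)%E by rewrite /K; case: ifP; rewrite // lee_fin !mulr_ge0 ?powR_ge0.
have mKw : measurable_fun [set: R * R] (fun w : R * R => \int[mu]_s K (s, w))%E.
  exact: (@measurable_fun_fubini_tonelli_G _ _ RT (RT * RT)%type R mu K mK K0).
have mKs : measurable_fun [set: R] (fun s : R => \int[leb2]_w K (s, w))%E.
  exact: (@measurable_fun_fubini_tonelli_F _ _ RT (RT * RT)%type R leb2 K mK K0).
have Bp0 : 0 <= B `^ (p - 1) by rewrite powR_ge0.
apply: (@le_trans _ _ (\int[leb2]_w ((B `^ (p - 1))%:E * \int[mu]_s K (s, w)))%E).
  apply: le_integral_leb2.
  - exact: measurable_Iw gc.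
  - by apply: emeasurable_funM.
  - by move=> w; case: ifP; rewrite // lee_fin mulr_ge0 ?powR_ge0.
  move=> w; have [w1|w1] := boolP (nsq w < 1); last first.
    by apply: mule_ge0; rewrite ?lee_fin//; apply: integral_ge0.
  have mXw : measurable_fun [set: R] (fun s => X (s, w)).
    by apply: (measurableT_comp mX); apply: measurable_fun_pair; mfun.
  have := @holder_tangent R p (normc (g (cpx w))) B (fun s => X (s, w)) (hker gm b) _
    (normc_ge0 _) B0 mXw mh _ hB _.
  have p1 : 1 < p by lra.
  move=> /(_ p1) H1.
  have H2 : forall s, 0 < s < 1 -> 0 <= X (s, w) /\ 0 < hker gm b s.
    by move=> s /andP[s0 s1]; split => //; rewrite mulr_gt0 ?powR_gt0 ?subr_gt0.
  move: (H1 H2) => {H1 H2} H1.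
  have d1 : unit_disk (cpx w) by rewrite unit_diskE.
  have H2 : ((normc (g (cpx w)))%:E <=
      \int[mu]_s (if ((0 < s) && (s < 1))%R then (X (s, w))%:E else 0))%E.
    apply: (le_trans (gle _ d1)); rewrite integral_I01; rewrite le_eqVlt; apply/orP; left; apply/eqP.
    apply: eq_integral => s _; case: ifPn => // s01; rewrite XE//.
  move: (H1 H2) => {H1 H2} H1.
  pose q : R := (1 - nsq w) `^ alpha; have q0 : 0 <= q by rewrite powR_ge0.
  rewrite EFinM; apply: (le_trans (lee_wpmul2r _ H1)); first by rewrite lee_fin.
  rewrite -muleA; apply: lee_wpmul2l; first by rewrite lee_fin.
  have mI : measurable_fun setT (fun s : R => if ((0 < s) && (s < 1))%R
      then (X (s, w) `^ p * hker gm b s `^ (1 - p))%:E else 0%E) by mfun.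
  rewrite -(ge0_integralZr mu measurableT (measurable_RT mI)); first last.
  - by rewrite lee_fin.
  - by move=> s _; case: ifP; rewrite // lee_fin mulr_ge0 ?powR_ge0.
  rewrite le_eqVlt; apply/orP; left; apply/eqP; apply: eq_integral => s _; rewrite /K/= w1 andbT; case: ifP => _; last by rewrite mul0e.
  by rewrite -EFinM.
rewrite (ge0_integralZl leb2 measurableT (measurable_RT2 mKw)); first last.
- by rewrite lee_fin.
- by move=> w _; apply: integral_ge0.
rewrite -(tonelli3 mK K0).
have -> : B `^ p = B `^ (p - 1) * B.
  by rewrite -{3}(powRr1 (ltW B0)) -powRD ?(gt_eqF B0) ?implybT//; congr (_ `^ _); ring.
rewrite EFinM -muleA; apply: lee_wpmul2l; first by rewrite lee_fin.
rewrite -hB -(ge0_integralZr mu measurableT (measurable_RT (measurable_hkerE gm b))); first last.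
- exact: Iw_ge0.
- by move=> s _; exact: hkerE_ge0.
apply: le_integral_leb => //.
- by apply: emeasurable_funM; [exact: measurable_hkerE|exact: measurable_cst].
- by move=> s; apply: integral_ge0.
move=> s; rewrite /hkerE; case: ifPn => s01; last first.
  by rewrite mul0e /K/= (negbTE s01)/= integral0.
have /andP[s0 s1] := s01.
have k0 : 0 <= (1 - s) `^ b `^ p * hker gm b s `^ (1 - p) by rewrite mulr_ge0 ?powR_ge0.
have wa := wcomp_power_series s01 fa.
rewrite [X in (X <= _)%E](_ : _ = ((1 - s) `^ b `^ p * hker gm b s `^ (1 - p))%:E * Iw p alpha (wcomp s f))%E; last first.
  rewrite /Iw -(ge0_integralZl leb2 measurableT (measurable_RT2 (measurable_Iw p alpha wa))); first last.
  - by rewrite lee_fin.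
  - by move=> w _; case: ifP; rewrite // lee_fin mulr_ge0 ?powR_ge0.
  apply: eq_integral => w _; rewrite /K/= s01/=; case: ifP => w1; last by rewrite mule0.
  rewrite -EFinM XE// ComplexField.Normc.normcM normcR ger0_norm ?powR_ge0// powRM ?powR_ge0 ?normc_ge0//.
  by congr EFin; ring.
apply: (le_trans (lee_wpmul2l _ (Iw_wcomp_le s01 al0 pal fa))); first by rewrite lee_fin.
rewrite muleA; apply: lee_wpmul2r; first exact: Iw_ge0.
rewrite -EFinM lee_fin le_eqVlt; apply/orP; left; apply/eqP.
have s10 : 0 < 1 - s by lra.
have h0 : 0 < hker gm b s by rewrite mulr_gt0 ?powR_gt0.
have -> : (1 - s) `^ b `^ p * hker gm b s `^ (1 - p) *
    (s `^ (alpha + 2 - p) * (1 - s) `^ (- alpha - 2)) =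
    (s `^ (alpha + 2 - p) * ((1 - s) `^ b `^ p * (1 - s) `^ (- alpha - 2))) * hker gm b s `^ (1 - p).
  by ring.
have -> : s `^ (alpha + 2 - p) * ((1 - s) `^ b `^ p * (1 - s) `^ (- alpha - 2)) = hker gm b s `^ p.
  rewrite /hker powRM ?powR_ge0// -!powRrM -powRD ?(gt_eqF s10) ?implybT//.
  by congr (_ `^ _ * _ `^ _); rewrite mulrBl ?mul1r gmp; ring.
by rewrite -powRD ?(gt_eqF h0) ?implybT// addrC subrK powRr1// ltW.
Qed.

End hilbert_upper_bound.

Section bergman_bridge.
Context {R : realType}.
Local Notation mu := (@lebesgue_measure R).
Local Notation RT := (measurableTypeR R).
Implicit Types (f g : R[i] -> R[i]) (a c : nat -> R[i]) (w : R * R) (s gm b p alpha : R).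

Lemma bergman_normE p alpha f :
  bergman_norm p alpha f = (((alpha + 1)%:E * ((pi^-1)%:E * Iw p alpha f)) `^ p^-1)%E.
Proof.
rewrite /bergman_norm /disk_integral leb2E integral_mkcond; congr ((_ * (_ * _)) `^ _)%E.
apply: eq_integral => w _; rewrite patchE.
have e : (w \in [set w : R * R | unit_disk (w.1 +i* w.2)]) = (nsq w < 1).
  apply/idP/idP; rewrite inE /= -/(cpx w) ?unit_diskE//.
by rewrite e -/(cpx w) sqr_normc_cpx.
Qed.

Definition ccst alpha : R := (alpha + 1) / pi.

Lemma ccst_gt0 alpha : 0 <= alpha -> 0 < ccst alpha.
Proof. by move=> al0; rewrite divr_gt0 ?pi_gt0//; lra. Qed.

Lemma bergman_norm_ccst p alpha f : bergman_norm p alpha f = (((ccst alpha)%:E * Iw p alpha f) `^ p^-1)%E.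
Proof. by rewrite bergman_normE muleA -EFinM. Qed.

Lemma bergman_norm_le p alpha f (m : R) : 0 <= alpha -> 0 < p -> 0 <= m ->
  (bergman_norm p alpha f <= m%:E)%E <-> (Iw p alpha f <= ((ccst alpha)^-1 * m `^ p)%:E)%E.
Proof.
move=> al0 p0 m0; have c0 := ccst_gt0 al0; rewrite bergman_norm_ccst.
have := Iw_ge0 p alpha f; case: (Iw p alpha f) => [x| |] // x0; last first.
  rewrite gt0_muley ?lte_fin// poweRyr; last by rewrite invr_eq0 gt_eqF.
  by split; rewrite leye_eq.
rewrite -EFinM poweR_EFin !lee_fin ler_pdivlMl//.
have cx : 0 <= ccst alpha * x by rewrite mulr_ge0// ltW.
have pn : p != 0 by rewrite gt_eqF.
split => h.
  have := ge0_ler_powR (ltW p0) (powR_ge0 _ _) m0 h.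
  by rewrite -powRrM mulVf// powRr1.
have pi0 : 0 <= p^-1 by rewrite invr_ge0 ltW.
have := ge0_ler_powR pi0 cx (powR_ge0 _ _) h.
by rewrite -powRrM mulfV// powRr1.
Qed.

Lemma bergman_norm_lty p alpha f : 0 <= alpha -> 0 < p ->
  (bergman_norm p alpha f < +oo)%E <-> (Iw p alpha f < +oo)%E.
Proof.
move=> al0 p0; have c0 := ccst_gt0 al0; rewrite bergman_norm_ccst.
have := Iw_ge0 p alpha f; case: (Iw p alpha f) => [x| |] // x0.
  by rewrite -EFinM poweR_EFin !ltry.
by rewrite gt0_muley ?lte_fin// poweRyr// invr_eq0 gt_eqF.
Qed.

Lemma taylor_coefP f : analytic_on_disk f -> has_power_series f (taylor_coef f).
Proof. by move=> [a fa]; rewrite /taylor_coef; case: xgetP => [c _|/(_ a)]. Qed.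

Lemma Iw_real p alpha f a : 0 <= alpha -> 2 * (alpha + 2) <= p -> has_power_series f a ->
  (Iw p alpha f < +oo)%E -> exists S : R, forall K, \sum_(0 <= k < K) normc (a k) / k.+1%:R <= S.
Proof.
move=> al0 pal fa If; have [C C0 hC] := coef_sum_bounded al0 pal.
have p0 : p != 0 by rewrite gt_eqF//; lra.
pose x := fine (Iw p alpha f).
have xE : Iw p alpha f = x%:E by rewrite fineK// ge0_fin_numE ?Iw_ge0.
have x0 : 0 <= x by rewrite -lee_fin -xE Iw_ge0.
pose lam := (x + 1) `^ p^-1.
have l0 : 0 < lam by rewrite powR_gt0; lra.
exists (C * lam) => K; apply: (hC f a K lam fa l0).
by rewrite xE lee_fin /lam -powRrM mulVf// powRr1; lra.
Qed.

Lemma hilbert_opP f b p alpha : 0 <= b -> 0 <= alpha -> 2 * (alpha + 2) <= p ->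
  analytic_on_disk f -> (Iw p alpha f < +oo)%E ->
  [/\ hilbert_op_well_defined b f, has_power_series (hilbert_op b f) (hilbert_coef b f) &
   forall z, unit_disk z ->
   [/\ mu.-integrable I01 (EFin \o (fun s => Re (((1 - s) `^ b)%:C * wcomp s f z))),
     mu.-integrable I01 (EFin \o (fun s => Im (((1 - s) `^ b)%:C * wcomp s f z))) &
     hilbert_op b f z = Cint (fun s => ((1 - s) `^ b)%:C * wcomp s f z)]].
Proof.
move=> b0 al0 pal fan If; have fa := taylor_coefP fan.
have [S aS] := Iw_real al0 pal fa If.
have hc n : hilbert_coef b f n = Cint (fun s => ((1 - s) `^ b)%:C * wcomp_coef s (taylor_coef f) n).
  have [_ _ h] := integral_coef fa aS n b0; exact: cvgC_lim h.
have hs z : unit_disk z -> series (fun n => hilbert_coef b f n * z ^+ n : R[i]^o) @ \oo -->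
    (Cint (fun s => ((1 - s) `^ b)%:C * wcomp s f z) : R[i]^o).
  move=> z1; have [_ _ h] := integral_formula fa aS b0 z1.
  by rewrite (_ : (fun n => _) = (fun n => Cint (fun s => ((1 - s) `^ b)%:C *
    wcomp_coef s (taylor_coef f) n) * z ^+ n : R[i]^o))//; apply/funext => n; rewrite hc.
have ho z : unit_disk z -> hilbert_op b f z = Cint (fun s => ((1 - s) `^ b)%:C * wcomp s f z).
  by move=> z1; exact: cvgC_lim (hs z z1).
split.
- split=> [n|z z1].
    have [_ _ h] := integral_coef fa aS n b0; apply/cvg_ex; eexists; exact: h.
  apply/cvg_ex; eexists; exact: (hs z z1).
- by move=> z z1; rewrite ho//; exact: hs.
- by move=> z z1; rewrite ho//; have [h1 h2 _] := integral_formula fa aS b0 z1.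
Qed.

Lemma Iw_hilbert_op_le f b p alpha : 0 <= b -> 0 <= alpha -> 2 * (alpha + 2) <= p ->
  analytic_on_disk f -> (Iw p alpha f < +oo)%E ->
  (Iw p alpha (hilbert_op b f) <=
   (Beta ((alpha + 2) / p) (b + 1 - (alpha + 2) / p) `^ p)%:E * Iw p alpha f)%E.
Proof.
move=> b0 al0 pal fan If; have [_ hp hz] := hilbert_opP b0 al0 pal fan If.
apply: (Iw_hilbert_le (taylor_coefP fan) hp b0 al0 pal) => z z1.
by have [h1 h2 ->] := hz z z1; exact: Cint_norm_le.
Qed.

End bergman_bridge.

(** * Lower bound *)

Section lower_bound_tools.
Context {R : realType}.
Local Notation mu := (@lebesgue_measure R).
Local Notation RT := (measurableTypeR R).
Implicit Types (f g : R[i] -> R[i]) (a c : nat -> R[i]) (s t u y gm b p alpha : R).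

(** The substitution 1 - y = phi_s(1 - u), composed of the affine map v = s + (1-s) u, the dilation
    v = s t, the inversion of t and a reflection. *)
Lemma integral_phi_real s (Psi : R -> \bar R) : 0 < s < 1 ->
  measurable_fun setT Psi -> (forall y, 0 <= Psi y)%E ->
  (\int[mu]_u (if (0 < u)%R then Psi ((1 - s) * u / (s + (1 - s) * u))%R *
      (s * (1 - s) / (s + (1 - s) * u) ^+ 2)%:E else 0) =
   \int[mu]_y (if ((0 < y) && (y < 1))%R then Psi y else 0))%E.
Proof.
move=> /andP[s0 s1] mP P0; have s10 : 0 < 1 - s by lra.
pose A v : \bar R := if (s < v)%R then (Psi (1 - s / v)%R * (s / v ^+ 2)%:E)%E else 0%E.
have mA : measurable_fun setT A by rewrite /A; mfun; apply: (measurableT_comp mP); mfun.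
have A0 v : (0 <= A v)%E.
  by rewrite /A; case: ifP => // _; rewrite mule_ge0// lee_fin divr_ge0 ?sqr_ge0 ?ltW.
have mA1 : measurable_fun setT (fun u => A ((1 - s) * u + s)).
  by apply: (measurableT_comp mA); mfun.
transitivity (\int[mu]_v A v)%E.
  rewrite (integral_affine s (lt0r_neq0 s10) mA A0) gtr0_norm//.
  rewrite -(ge0_integralZl mu measurableT (measurable_RT mA1)) ?lee_fin ?(ltW s10)//.
  apply: eq_integral => u _; rewrite /A ltrDr pmulr_rgt0//; case: ifPn => u0; last by rewrite mule0.
  have v0 : 0 < s + (1 - s) * u by rewrite addr_gt0// mulr_gt0.
  rewrite [(1 - s) * u + s]addrC muleCA -EFinM.
  by congr (Psi _ * _%:E)%E; field; rewrite gt_eqF.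
pose f x : \bar R := if (x < 1)%R then Psi (1 - x)%R else 0%E.
have mf : measurable_fun setT f by rewrite /f; mfun; apply: (measurableT_comp mP); mfun.
have f0 x : (0 <= f x)%E by rewrite /f; case: ifP.
have mA2 : measurable_fun setT (fun t => A (s * t)) by apply: (measurableT_comp mA); mfun.
transitivity (\int[mu]_x (if (0 < x)%R then f x else 0))%E.
  rewrite (integral_scale s0 mA A0) -(integral_inv mf f0).
  rewrite -(ge0_integralZl mu measurableT (measurable_RT mA2)) ?lee_fin ?(ltW s0)//.
  apply: eq_integral => t _; rewrite /A /f ltr_pMr//.
  have [t0|t0] := ltP 0 t; last by rewrite ifF ?mule0//; apply/negbTE; rewrite -leNgt (le_trans t0).
  rewrite invf_lt1//; case: ifP => _; last by rewrite mule0 mul0e.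
  rewrite muleCA -EFinM; congr (Psi (1 - _)%R * _%:E)%E; field; lra.
pose G x : \bar R := if ((0 < x) && (x < 1))%R then Psi x else 0%E.
have mG : measurable_fun setT G by rewrite /G; mfun.
have G0 x : (0 <= G x)%E by rewrite /G; case: ifP.
transitivity (\int[mu]_x G (1 - x)%R)%E; last exact: esym (integral_onem mG G0).
apply: eq_integral => x _.
by rewrite /f /G subr_gt0 ltrBlDr ltrDl; case: (0 < x); case: (x < 1).
Qed.

(** For s = 1 - y, the function [wcomp s g] takes the value g(s) at 0. This is its coefficient of
    index 0, so [coef_sum_bounded] with a single term applies. *)
Lemma growth p alpha : 0 <= alpha -> 2 * (alpha + 2) <= p ->
  exists2 C : R, 0 < C & forall g c (lam : R), has_power_series g c -> 0 < lam ->
    (Iw p alpha g <= (lam `^ p)%:E)%E -> forall y, 0 < y -> y <= 1 / 2 ->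
    normc (g (1 - y)%:C) <= C * lam * y `^ (- ((alpha + 2) / p)).
Proof.
move=> al0 pal; have [C C0 hC] := coef_sum_bounded al0 pal.
have p0 : 0 < p by lra.
exists (2 * C); first by rewrite mulr_gt0.
move=> g c lam gc lam0 Ig y y0 y2.
have s01 : 0 < 1 - y < 1 by apply/andP; split; lra.
have wc := wcomp_power_series s01 gc.
have w0 : wcomp (1 - y) g 0 = g (1 - y)%:C by rewrite /wcomp /phi mulr0 subr0 invr1 mul1r mulr1.
have d0 : unit_disk (0 : R[i]) by rewrite /unit_disk/= ComplexField.Normc.normc0.
have c0 : wcomp (1 - y) g 0 = wcomp_coef (1 - y) c 0%N.
  apply: cvgC_unique (wc _ d0) _; apply/cvgC_normP => e e0; exists 1%N => // -[//|n] _.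
  rewrite (_ : series _ n.+1 = wcomp_coef (1 - y) c 0%N) ?subrr ?ComplexField.Normc.normc0//.
  rewrite /series/= big_nat_recl//= expr0 mulr1 big1 ?addr0// => k _.
  by rewrite expr0n/= mulr0.
(* The 2 pays for (1-y)^(alpha+2-p) <= (1-y)^(-p) <= 2^p. *)
pose mm := 2 * lam * y `^ (- ((alpha + 2) / p)).
have mm0 : 0 < mm by rewrite !mulr_gt0 ?powR_gt0.
have -> : 2 * C * lam * y `^ (- ((alpha + 2) / p)) = C * mm by rewrite /mm; ring.
have := hC _ _ 1%N mm wc mm0; rewrite big_nat1 divr1 -c0 w0.
apply; apply: (le_trans (Iw_wcomp_le s01 al0 pal gc)).
apply: (le_trans (lee_wpmul2l _ Ig)); first by rewrite lee_fin mulr_ge0 ?powR_ge0.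
rewrite -EFinM lee_fin /mm [1 - (1 - y)](_ : _ = y); last by ring.
rewrite !powRM ?mulr_ge0 ?powR_ge0 ?(ltW lam0)//.
have -> : (y `^ (- ((alpha + 2) / p))) `^ p = y `^ (- alpha - 2).
  by rewrite -powRrM; congr (_ `^ _); field; rewrite gt_eqF.
rewrite mulrAC; apply: ler_wpM2r; first exact: powR_ge0.
rewrite ler_wpM2r ?powR_ge0//.
have [z0 z2] : 0 < 1 - y /\ 1 / 2 <= 1 - y by split; lra.
apply: (@le_trans _ _ ((1 - y) `^ (- p))).
  by apply: ger_powR; [apply/andP; split; lra|lra].
rewrite powRN -[leRHS]invrK lef_pV2 ?posrE ?invr_gt0 ?powR_gt0//.
rewrite -powR_inv1 ?powR_ge0// -powRrM mulrN1 -mulN1r powRrM powR_inv1//.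
by apply: ge0_ler_powR; rewrite ?nnegrE ?(ltW p0) ?(ltW z0) ?invr_ge0//; lra.
Qed.

(** For t <= 1/2 only one factor of the kernel can be singular on each tail; near 1 its exponent b -
    gm is at least -1/2, whence t^(1/2). For t > 1/2 the powers of t are at least 1/2, and the term
    2 B of the constant covers the total mass B. *)
Lemma hker_tails gm b : 0 <= b -> gm <= 1 / 2 -> 0 < gm ->
  exists2 C : R, 0 <= C & forall t, 0 < t ->
  (\int[mu]_s (if (s < t)%R then hkerE gm b s else 0) <= (C * t `^ gm)%:E /\
   ((t <= 1)%R -> \int[mu]_s (if (1 - t < s)%R then hkerE gm b s else 0) <= (C * t `^ (1 / 2))%:E))%E.
Proof.
move=> b0 g2 g0; have [B0 hB] := integral_hker b0 g2 g0; set B := Beta _ _ in B0 hB.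
have mh := measurable_hkerE gm b.
have v (x r : R) : -1 <= r -> 1 / 2 <= x <= 1 -> x `^ r <= 2.
  move=> r1 /andP[x2 x1]; apply: (@le_trans _ _ (x `^ (-1))).
    by apply: ger_powR => //; rewrite x1 andbT; lra.
  rewrite powR_inv1; last lra.
  by rewrite -[leRHS]invrK lef_pV2 ?posrE ?invr_gt0//; lra.
have gi : 0 < gm^-1 by rewrite invr_gt0.
have half t r : 1 / 2 <= t -> 0 <= r <= 1 -> 1 / 2 <= t `^ r.
  move=> t2 /andP[r0 r1]; have [t1|t1] := leP t 1.
    apply: (le_trans t2); rewrite -[leLHS]powRr1; last lra.
    by apply: ger_powR => //; rewrite t1 andbT; lra.
  by apply: (@le_trans _ _ (t `^ 0)); [rewrite powRr0; lra|apply: ler_powR => //; exact: ltW].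
have big (P : R -> bool) (X : R) : measurable_fun setT P -> 1 / 2 <= X ->
    (\int[mu]_s (if P s then hkerE gm b s else 0) <= ((2 * gm^-1 + 4 + 2 * B) * X)%:E)%E.
  move=> mP X2; apply: (@le_trans _ _ B%:E).
    rewrite -hB; apply: le_integral_leb => //.
    - by mfun.
    - by move=> s; case: ifP; rewrite // hkerE_ge0.
    - by move=> s; case: ifP; rewrite // hkerE_ge0.
  by rewrite lee_fin; nra.
exists (2 * gm^-1 + 4 + 2 * B); first lra.
move=> t t0; split.
  have [t2|t2] := leP t (1 / 2); last first.
    by apply: big; [mfun|apply: half; [exact: ltW|apply/andP; split; lra]].
  have mI : measurable_fun setT (fun s : R => if ((0 < s) && (s <= t))%R then (s `^ (gm - 1))%:E else 0%E).
    by mfun.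
  apply: (@le_trans _ _ (2%:E * (t `^ gm / gm)%:E)%E); last first.
    by rewrite -EFinM lee_fin; have := powR_ge0 t gm; move: (_ `^ _) => q q0; nra.
  rewrite -(integral0_powR g0 t0) -(ge0_integralZl mu measurableT (measurable_RT mI)); first last.
  - by rewrite lee_fin.
  - by move=> s _; case: ifP; rewrite // lee_fin powR_ge0.
  apply: le_integral_leb.
  - by mfun.
  - by mfun.
  - by move=> s; case: ifP; rewrite // hkerE_ge0.
  move=> s; rewrite /hkerE; case: ifPn => st; last first.
    by rewrite mule_ge0//; case: ifP; rewrite // lee_fin powR_ge0.
  case: ifPn => [/andP[s0 s1]|_]; last by rewrite mule_ge0//; case: ifP; rewrite // lee_fin powR_ge0.
  rewrite s0 (ltW st)/= -EFinM lee_fin /hker mulrC ler_wpM2r ?powR_ge0//.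
  by apply: v; [lra|apply/andP; split; lra].
move=> t1; have [t2|t2] := leP t (1 / 2); last first.
  by apply: big; [mfun|apply: half; [exact: ltW|apply/andP; split; lra]].
have h0 : 0 < 1 / 2 :> R by lra.
have mI : measurable_fun setT (fun s : R =>
   if ((1 - t <= s) && (s < 1))%R then ((1 - s) `^ (1 / 2 - 1))%:E else 0%E) by mfun.
apply: (@le_trans _ _ (2%:E * (t `^ (1 / 2) / (1 / 2))%:E)%E); last first.
  by rewrite -EFinM lee_fin; have := powR_ge0 t (1 / 2); move: (_ `^ _) => q q0; nra.
rewrite -(integral1_powR h0 t0) -(ge0_integralZl mu measurableT (measurable_RT mI)); first last.
- by rewrite lee_fin.
- by move=> s _; case: ifP; rewrite // lee_fin powR_ge0.
apply: le_integral_leb.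
- by mfun.
- by mfun.
- by move=> s; case: ifP; rewrite // hkerE_ge0.
move=> s; rewrite /hkerE; case: ifPn => st; last first.
  by rewrite mule_ge0//; case: ifP; rewrite // lee_fin powR_ge0.
case: ifPn => [/andP[s0 s1]|_]; last by rewrite mule_ge0//; case: ifP; rewrite // lee_fin powR_ge0.
rewrite s1 (ltW st)/= -EFinM lee_fin /hker; apply: ler_pM; rewrite ?powR_ge0//.
  by apply: v; [lra|apply/andP; split; lra].
by apply: ger_powR; [apply/andP; split; lra|lra].
Qed.

End lower_bound_tools.

Section lower_bound_inequality.
Context {R : realType}.
Local Notation mu := (@lebesgue_measure R).
Local Notation RT := (measurableTypeR R).
Implicit Types (f g : R[i] -> R[i]) (a c : nat -> R[i]) (s t u x y tau gm b p alpha : R).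

Definition ell gm tau g : \bar R := (\int[mu]_u (if ((tau <= u) && (u <= 1 / 2))%R
  then (complex.Re (g (1 - u)%:C) * u `^ (gm - 1))%:E else 0))%E.

Definition nonneg_on_radius g :=
  forall x, 0 <= x < 1 -> Im (g x%:C) = 0 /\ 0 <= Re (g x%:C).

(** The radial values are extended by 0 to give a measurable function on the whole line. *)
Definition Gr g x : R := if (0 <= x) && (x < 1) then Re (g x%:C) else 0.

Lemma Gr_ge0 g x : nonneg_on_radius g -> 0 <= Gr g x.
Proof. by move=> gn; rewrite /Gr; case: ifPn => // /gn[]. Qed.

Lemma measurable_Gr g c : has_power_series g c -> measurable_fun setT (Gr g).
Proof.
move=> /measurable_power_series[mR _].
have mG : measurable_fun [set: R] ((fun w : R * R => if nsq w < 1 then Re (g (cpx w)) else 0) \o (fun x => (x, 0))).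
  by apply: (measurableT_comp mR); apply: measurable_fun_pair; mfun.
rewrite (_ : Gr g = fun x => if (0 <= x) && (x < 1)
  then ((fun w : R * R => if nsq w < 1 then Re (g (cpx w)) else 0) \o (fun x => (x, 0))) x else 0).
  by move: (_ \o _) mG => G mG; mfun.
apply/funext => x; rewrite /Gr; case: ifPn => // /andP[x0 x1] /=.
by rewrite ifT// /nsq/= expr0n/= addr0 expr_lt1.
Qed.

Lemma wcomp_real g s x : 0 < s < 1 -> 0 <= x < 1 -> nonneg_on_radius g ->
  wcomp s g x%:C = ((1 - (1 - s) * x)^-1 * Gr g (s / (1 - (1 - s) * x)))%:C.
Proof.
move=> /andP[s0 s1] /andP[x0 x1] gn.
have v0 : s < 1 - (1 - s) * x by nra.
have vp : 0 < 1 - (1 - s) * x := lt_trans s0 v0.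
have r01 : 0 <= s / (1 - (1 - s) * x) < 1.
  by rewrite divr_ge0 ?(ltW s0) ?(ltW vp)//= ltr_pdivrMr// mul1r.
have [g0 _] := gn _ r01.
set v := 1 - (1 - s) * x in v0 vp r01 g0 *.
have dE : 1 - (1 - s)%:C * x%:C = v%:C.
  by apply/eqP; rewrite eq_complex/=; apply/andP; split; apply/eqP; rewrite /v; ring.
have vV : (v%:C : R[i])^-1 = (v^-1)%:C by rewrite -fmorphV.
have sV : s%:C * (v^-1)%:C = (s / v)%:C.
  by apply/eqP; rewrite eq_complex/=; apply/andP; split; apply/eqP; ring.
rewrite /wcomp /phi dE vV sV /Gr r01; move: g0; case: (g (s / v)%:C) => gr gi /= ->.
by apply/eqP; rewrite eq_complex/=; apply/andP; split; apply/eqP; ring.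
Qed.

Lemma hilbert_op_real g b p alpha x : 0 <= b -> 0 <= alpha -> 2 * (alpha + 2) <= p ->
  analytic_on_disk g -> (Iw p alpha g < +oo)%E -> nonneg_on_radius g -> 0 <= x < 1 ->
  Im (hilbert_op b g x%:C) = 0 /\ (Re (hilbert_op b g x%:C))%:E =
  (\int[mu]_s (if ((0 < s) && (s < 1))%R then ((1 - s) `^ b * ((1 - (1 - s) * x)^-1 *
     Gr g (s / (1 - (1 - s) * x))))%:E else 0))%E.
Proof.
move=> b0 al0 pal gan Ig gn x01; have [_ _ hz] := hilbert_opP b0 al0 pal gan Ig.
have d1 : unit_disk (x%:C : R[i]).
  by rewrite /unit_disk/= normcR; case/andP: x01 => x0 x1; rewrite ger0_norm.
have [h1 h2 ->] := hz _ d1.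
have e s : I01 s -> ((1 - s) `^ b)%:C * wcomp s g x%:C = ((1 - s) `^ b * ((1 - (1 - s) * x)^-1 *
     Gr g (s / (1 - (1 - s) * x))))%:C.
  by move=> /I01P s01; rewrite (wcomp_real s01 x01 gn) -rmorphM.
split; rewrite /Cint/=.
  rewrite /Rintegral (eq_integral (fun=> 0%E)) ?integral0// => s; rewrite inE => Is.
  by rewrite e.
rewrite /Rintegral fineK; last exact: (integrable_fin_num mI01 h1).
by rewrite integral_I01; apply: eq_integral => s _; case: ifPn => // /I01P Is; rewrite e.
Qed.

Lemma hilbert_op_nonneg g b p alpha : 0 <= b -> 0 <= alpha -> 2 * (alpha + 2) <= p ->
  analytic_on_disk g -> (Iw p alpha g < +oo)%E -> nonneg_on_radius g ->
  nonneg_on_radius (hilbert_op b g).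
Proof.
move=> b0 al0 pal gan Ig gn x x01.
have [h1 h2] := hilbert_op_real b0 al0 pal gan Ig gn x01; split => //.
rewrite -lee_fin h2; apply: integral_ge0 => s _; case: ifPn => // /andP[s0 s1].
case/andP: x01 => x0 x1; have v0 : 0 <= 1 - (1 - s) * x by nra.
by rewrite lee_fin !mulr_ge0 ?powR_ge0 ?invr_ge0 ?Gr_ge0.
Qed.

Lemma ell_Gr gm tau g : 0 < tau -> ell gm tau g = (\int[mu]_u (if ((tau <= u) && (u <= 1 / 2))%R
  then (Gr g (1 - u) * u `^ (gm - 1))%:E else 0))%E.
Proof.
move=> t0; apply: eq_integral => u _; case: ifPn => // /andP[tu u2].
by rewrite /Gr ifT//; apply/andP; split; lra.
Qed.

(** With v = s + (1-s) u, the kernel in the variable y is (s/v)^gm times the one in u, and s/v = 1 -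
    y <= 1. The variables s and y thus separate, with an inequality in the useful direction. By y s
    = (1-s) (1-y) u, the two constraints on s keep u in [tau, 1/2]. *)
Lemma phi_kernel_le gm b tau s u G : 0 < s < 1 -> 0 < u -> 0 < gm -> 0 <= G -> 0 < tau ->
  let y := (1 - s) * u / (s + (1 - s) * u) in
  y <= 1 / 2 -> tau / y <= s -> s <= 1 - 2 * y ->
  [/\ tau <= u, u <= 1 / 2, s / (s + (1 - s) * u) = 1 - y &
    hker gm b s * (G * y `^ (gm - 1) * (s * (1 - s) / (s + (1 - s) * u) ^+ 2)) <=
    (1 - s) `^ b * ((s + (1 - s) * u)^-1 * G) * u `^ (gm - 1)].
Proof.
move=> /andP[s0 s1] u0 gm0 G0 t0 y y2 tys sy.
have s10 : 0 < 1 - s by lra.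
set v := s + (1 - s) * u; have v0 : 0 < v by rewrite addr_gt0// mulr_gt0.
have yE : y = (1 - s) * u * v^-1 by [].
have y0 : 0 < y by rewrite divr_gt0// mulr_gt0.
have yv : y * v = (1 - s) * u by rewrite yE divfK// gt_eqF.
have ys : y * s = (1 - s) * u * (1 - y) by have := yv; rewrite /v mulrDr; lra.
have sv : s / v = 1 - y.
  by apply: (mulIf (lt0r_neq0 v0)); rewrite divfK ?gt_eqF// mulrBl mul1r yv /v; ring.
split => //.
- move: tys; rewrite ler_pdivrMr// mulrC ys => tys; apply: (le_trans tys).
  by have := mulr_gt0 s10 u0; have := mulr_gt0 s0 u0; nra.
- rewrite leNgt; apply/negP => u2.
  have c0 : 0 < (1 - s) * (1 - y) by rewrite mulr_gt0//; lra.
  have h1 : (1 - s) * (1 - y) * (1 / 2) < (1 - s) * (1 - y) * u by rewrite ltr_pM2l.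
  have h2 := ler_wpM2l (ltW y0) sy; have h3 := sqr_ge0 y.
  by move: h1; rewrite [_ * u]mulrAC -ys; lra.
have e x : 0 < x -> x `^ (gm - 1) = x `^ gm / x.
  by move=> x0; rewrite powRD ?(gt_eqF x0) ?implybT// powR_inv1// ltW.
have vi0 : 0 < v^-1 by rewrite invr_gt0.
have T0 : 0 < (1 - s) `^ gm by rewrite powR_gt0.
have -> : hker gm b s * (G * y `^ (gm - 1) * (s * (1 - s) / v ^+ 2)) =
    (s / v) `^ gm * ((1 - s) `^ b * (v^-1 * G) * u `^ (gm - 1)).
  rewrite /hker !e// [b - gm]addrC [_ `^ (- gm + b)]powRD ?(gt_eqF s10) ?implybT// powRN.
  rewrite yE !powRM ?mulr_ge0 ?(ltW s0) ?(ltW s10) ?(ltW u0) ?(ltW vi0)//.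
  by field; rewrite !gt_eqF.
rewrite ler_piMl ?mulr_ge0 ?powR_ge0 ?(ltW vi0)//.
have z0 : 0 <= s / v by rewrite divr_ge0 ?ltW.
apply: (@le_trans _ _ (1 `^ gm)); last by rewrite powR1.
by apply: ge0_ler_powR; rewrite ?nnegrE ?(ltW gm0)//; lra.
Qed.

(** The first summand is homogeneous in (tau, y), so its integral over [tau, +oo[ does not depend on
    tau; the second is integrable at 0. They are the kernel tails at s = tau / y and s = 1 - 2 y,
    weighed against dy / y. *)
Lemma error_integral_le (k : R) tau gm : 0 <= k -> 0 < tau -> 0 < gm ->
  (\int[mu]_y (if ((tau <= y) && (y <= 1 / 2))%R then
    (k * (tau `^ gm * y `^ (- gm - 1) + 2 * y `^ (1 / 2 - 1)))%:E else 0) <= (k * (gm^-1 + 4))%:E)%E.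
Proof.
move=> k0 t0 gm0.
pose P y : \bar R := if tau <= y then (y `^ (- gm - 1))%:E else 0%E.
pose Q y : \bar R := if (0 < y) && (y <= 1 / 2) then (y `^ (1 / 2 - 1))%:E else 0%E.
have mP : measurable_fun setT P by rewrite /P; mfun.
have mQ : measurable_fun setT Q by rewrite /Q; mfun.
have P0 y : (0 <= P y)%E by rewrite /P; case: ifP; rewrite // lee_fin powR_ge0.
have Q0 y : (0 <= Q y)%E by rewrite /Q; case: ifP; rewrite // lee_fin powR_ge0.
have h2 : 0 < 1 / 2 :> R by lra.
have IP : (\int[mu]_y P y = (tau `^ (- gm) / gm)%:E)%E := integral_powR_tail gm0 t0.
have IQ : (\int[mu]_y Q y = ((1 / 2) `^ (1 / 2) / (1 / 2))%:E)%E := integral0_powR h2 h2.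
have c1 : 0 <= k * tau `^ gm by rewrite mulr_ge0 ?powR_ge0.
have c2 : 0 <= k * 2 by rewrite mulr_ge0.
have m1 : measurable_fun setT (fun y => (k * tau `^ gm)%:E * P y)%E by apply: emeasurable_funM.
have m2 : measurable_fun setT (fun y => (k * 2)%:E * Q y)%E by apply: emeasurable_funM.
apply: (@le_trans _ _ (\int[mu]_y ((k * tau `^ gm)%:E * P y + (k * 2)%:E * Q y))%E).
  apply: le_integral_leb.
  - by mfun.
  - exact: emeasurable_funD.
  - by move=> y; case: ifP; rewrite // lee_fin mulr_ge0// addr_ge0 ?mulr_ge0 ?powR_ge0.
  move=> y; case: ifPn => [/andP[ty y2]|_]; last by rewrite adde_ge0// mule_ge0 ?lee_fin.
  rewrite /P /Q ty (lt_le_trans t0 ty) y2/= -!EFinM -EFinD lee_fin.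
  by rewrite le_eqVlt; apply/orP; left; apply/eqP; ring.
rewrite (ge0_integralD mu measurableT _ (measurable_RT m1) _ (measurable_RT m2)); first last.
- by move=> y _; rewrite mule_ge0 ?lee_fin.
- by move=> y _; rewrite mule_ge0 ?lee_fin.
rewrite (ge0_integralZl mu measurableT (measurable_RT mP)) ?lee_fin//.
rewrite (ge0_integralZl mu measurableT (measurable_RT mQ)) ?lee_fin//.
rewrite IP IQ -!EFinM -EFinD lee_fin.
have -> : k * tau `^ gm * (tau `^ (- gm) / gm) = k * gm^-1.
  by rewrite powRN; field; rewrite !gt_eqF ?powR_gt0.
rewrite [leRHS]mulrDr lerD2l -[leLHS]mulrA ler_wpM2l//.
have : (1 / 2) `^ (1 / 2) <= 1 :> R.
  apply: (@le_trans _ _ (1 `^ (1 / 2))); last by rewrite powR1.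
  by apply: ge0_ler_powR; rewrite ?nnegrE; lra.
by move: (_ `^ _) => q; lra.
Qed.

Lemma hker_mid gm b : 0 <= b -> gm <= 1 / 2 -> 0 < gm ->
  exists2 C : R, 0 <= C & forall t1 t2, 0 < t1 -> 0 < t2 -> t2 <= 1 ->
  ((Beta gm (b + 1 - gm))%:E <=
    \int[mu]_s (if ((t1 <= s) && (s <= 1 - t2))%R then hkerE gm b s else 0) +
    (C * (t1 `^ gm + t2 `^ (1 / 2)))%:E)%E.
Proof.
move=> b0 g2 g0; have [_ hB] := integral_hker b0 g2 g0.
have [C C0 hC] := hker_tails b0 g2 g0; exists C => // t1 t2 t10 t20 t21.
have mh := measurable_hkerE gm b.
have [h1 _] := hC _ t10; have [_ /(_ t21) h2] := hC _ t20.
rewrite mulrDr EFinD; apply: le_trans (leeD2l _ (leeD h1 h2)).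
have m1 : measurable_fun setT (fun s => if (s < t1)%R then hkerE gm b s else 0%E) by mfun.
have m2 : measurable_fun setT (fun s => if (1 - t2 < s)%R then hkerE gm b s else 0%E) by mfun.
have m3 : measurable_fun setT (fun s => if ((t1 <= s) && (s <= 1 - t2))%R then hkerE gm b s else 0%E) by mfun.
have p1 (P : R -> bool) s : (0 <= if P s then hkerE gm b s else 0)%E by case: ifP; rewrite // hkerE_ge0.
rewrite -(ge0_integralD mu measurableT _ (measurable_RT m1) _ (measurable_RT m2)); first last.
- by move=> s _; exact: (p1 (fun s => 1 - t2 < s)).
- by move=> s _; exact: (p1 (fun s => s < t1)).
have m12 := emeasurable_funD m1 m2.
rewrite -(ge0_integralD mu measurableT _ (measurable_RT m3) _ (measurable_RT m12)); first last.
- by move=> s _; rewrite adde_ge0 ?(p1 (fun s => 1 - t2 < s)) ?(p1 (fun s => s < t1)).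
- by move=> s _; exact: (p1 (fun s => (t1 <= s) && (s <= 1 - t2))).
rewrite -hB; apply: le_integral_leb => //.
- exact: emeasurable_funD.
- by move=> s; exact: hkerE_ge0.
move=> s; have h0 := hkerE_ge0 gm b s.
have [st|st] := ltP s t1; have [ss|ss] := leP s (1 - t2); rewrite /= ?add0e ?adde0//.
by rewrite leeDl.
Qed.

End lower_bound_inequality.

Section lower_bound_main.
Context {R : realType}.
Local Notation mu := (@lebesgue_measure R).
Local Notation RT := (measurableTypeR R).
Implicit Types (f g : R[i] -> R[i]) (a c : nat -> R[i]) (s t u x y tau gm b p alpha : R).

(** Written as a double integral and transformed by u |-> y, ell(H_b g) dominates the integral of
    g(1-y) y^(gm-1) [hker] over the pairs (s, y) in [mid]. For fixed y the integral in s falls short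
    of B by two tails only. The growth bound turns their contribution into an error that is uniform
    in tau. *)
Lemma hilbert_lower p alpha b : 0 <= b -> 0 <= alpha -> 2 * (alpha + 2) <= p ->
  let gm := (alpha + 2) / p in
  exists2 C : R, 0 <= C & forall g (lam tau : R), analytic_on_disk g -> 0 < lam -> 0 < tau ->
    (Iw p alpha g <= (lam `^ p)%:E)%E -> nonneg_on_radius g ->
    ((Beta gm (b + 1 - gm))%:E * ell gm tau g <= ell gm tau (hilbert_op b g) + (C * lam)%:E)%E.
Proof.
move=> b0 al0 pal gm.
have p0 : 0 < p by lra.
have gm0 : 0 < gm by rewrite divr_gt0//; lra.
have gm2 : gm <= 1 / 2 by rewrite /gm ler_pdivrMr; lra.
have [B0 hB] := integral_hker b0 gm2 gm0; set B := Beta _ _ in B0 hB *.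
have [C1 C10 hmid] := hker_mid b0 gm2 gm0; rewrite -/B in hmid.
have [C3 C30 hgr] := growth al0 pal.
exists (C3 * C1 * (gm^-1 + 4)); first by rewrite !mulr_ge0 ?addr_ge0 ?invr_ge0 ?(ltW gm0) ?(ltW C30).
move=> g lam tau gan l0 t0 Ig gn.
have gc := taylor_coefP gan.
have Ify : (Iw p alpha g < +oo)%E := le_lt_trans Ig (ltry _).
have mG := measurable_Gr gc; have G0 x := Gr_ge0 x gn.
have hG y : 0 < y -> y <= 1 / 2 -> Gr g (1 - y) <= C3 * lam * y `^ (- gm).
  move=> y0 y2; apply: le_trans (hgr _ _ _ gc l0 Ig _ y0 y2).
  rewrite /Gr ifT; last by apply/andP; split; lra.
  exact: le_trans (ler_norm _) (ler_normc_Re _).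
pose V s u := s + (1 - s) * u.
pose K (x : R * R) : \bar R := if (0 < x.1) && (x.1 < 1) && ((tau <= x.2) && (x.2 <= 1 / 2)) then
  ((1 - x.1) `^ b * ((V x.1 x.2)^-1 * Gr g (x.1 / V x.1 x.2)) * x.2 `^ (gm - 1))%:E else 0%E.
have mGV : measurable_fun setT (fun x : R * R => Gr g (x.1 / V x.1 x.2)).
  by apply: (measurableT_comp mG); rewrite /V; mfun.
have mGy : measurable_fun setT (fun x : R * R => Gr g (1 - x.2)).
  by apply: (measurableT_comp mG); mfun.
have mGy1 : measurable_fun setT (fun y => Gr g (1 - y)).
  by apply: (measurableT_comp mG); mfun.
have mK : measurable_fun setT K by rewrite /K /V; mfun.
have K0 w : (0 <= K w)%E.
  rewrite /K; case: ifPn => // /andP[/andP[s0 s1] /andP[tu u2]]; rewrite lee_fin.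
  by rewrite !mulr_ge0 ?powR_ge0 ?invr_ge0 ?G0// addr_ge0 ?mulr_ge0; lra.
have e1 : ell gm tau (hilbert_op b g) = (\int[mu]_u \int[mu]_s K (s, u))%E.
  apply: eq_integral => u _; case: ifPn => [/andP[tu u2]|h]; last first.
    by rewrite integral0_eq// => s _; rewrite /K/= (negbTE h) andbF.
  have x01 : 0 <= 1 - u < 1 by apply/andP; split; lra.
  have [_ h] := hilbert_op_real b0 al0 pal gan Ify gn x01; rewrite EFinM h.
  have mI : measurable_fun setT (fun s => (if ((0 < s) && (s < 1))%R then ((1 - s) `^ b * ((1 - (1 - s) * (1 - u))^-1 *
     Gr g (s / (1 - (1 - s) * (1 - u)))))%:E else 0)%E).
    have mm : measurable_fun setT (fun s => Gr g (s / (1 - (1 - s) * (1 - u)))).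
      by apply: (measurableT_comp mG); mfun.
    by mfun.
  rewrite -(ge0_integralZr mu measurableT (measurable_RT mI)); first last.
  - by rewrite lee_fin powR_ge0.
  - move=> s _; case: ifPn => // /andP[s0 s1]; have v0 : 0 <= 1 - (1 - s) * (1 - u) by nra.
    by rewrite lee_fin !mulr_ge0 ?powR_ge0 ?invr_ge0.
  apply: eq_integral => s _; rewrite /K/= tu u2 andbT; case: ifP => _; last by rewrite mul0e.
  by rewrite -EFinM (_ : 1 - (1 - s) * (1 - u) = V s u)// /V; ring.
(* For these pairs the preimage u of y lies in [tau, 1/2], the range of integration of [ell]. *)
pose mid (x : R * R) := (tau <= x.2) && (x.2 <= 1 / 2) && ((tau / x.2 <= x.1) && (x.1 <= 1 - 2 * x.2)).
have mmid : measurable_fun setT mid by rewrite /mid; mfun.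
pose Psi (x : R * R) : \bar R := if mid x then (Gr g (1 - x.2) * x.2 `^ (gm - 1))%:E else 0%E.
have mPsi : measurable_fun setT Psi by rewrite /Psi; mfun.
have Psi0 w : (0 <= Psi w)%E by rewrite /Psi; case: ifP; rewrite // lee_fin mulr_ge0 ?powR_ge0.
pose L (x : R * R) : \bar R := (hkerE gm b x.1 * Psi x)%E.
have mh1 : measurable_fun setT (fun x : R * R => hkerE gm b x.1).
  exact: (measurableT_comp (measurable_hkerE gm b)).
have mL : measurable_fun setT L by apply: emeasurable_funM.
have L0 w : (0 <= L w)%E by rewrite mule_ge0 ?hkerE_ge0.
have mLs : measurable_fun [set: R] (fun s : R => \int[mu]_y L (s, y))%E.
  exact: (@measurable_fun_fubini_tonelli_F _ _ RT RT R mu L mL L0).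
have mLy : measurable_fun [set: R] (fun y : R => \int[mu]_s L (s, y))%E.
  exact: (@measurable_fun_fubini_tonelli_G _ _ RT RT R mu L mL L0).
have mKs : measurable_fun [set: R] (fun s : R => \int[mu]_y K (s, y))%E.
  exact: (@measurable_fun_fubini_tonelli_F _ _ RT RT R mu K mK K0).
have e2 : (\int[mu]_y \int[mu]_s L (s, y) <= ell gm tau (hilbert_op b g))%E.
  have tL := esym (tonelli2 mL L0); have tK := esym (tonelli2 mK K0).
  have tL1 := tonelli1 mL L0; have tK1 := tonelli1 mK K0.
  rewrite e1 tL tK tL1 tK1 {tL tK tL1 tK1}.
  apply: le_integral_leb.
  - exact: mLs.
  - exact: mKs.
  - by move=> s; apply: integral_ge0 => y _; exact: L0.
  move=> s; rewrite /L/= /hkerE; case: ifPn => s01; last first.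
    rewrite integral0_eq => [|y _]; last by rewrite mul0e.
    by apply: integral_ge0 => y _; exact: K0.
  have /andP[s0 s1] := s01.
  have mPs : measurable_fun [set: R] (fun y => Psi (s, y)).
    by apply: (measurableT_comp mPsi); apply: measurable_fun_pair; mfun.
  rewrite (ge0_integralZl mu measurableT (measurable_RT mPs)); first last.
  - by rewrite lee_fin hker_ge0.
  - by [].
  have -> : (\int[mu]_y Psi (s, y) = \int[mu]_y (if ((0 < y) && (y < 1))%R then Psi (s, y) else 0))%E.
    apply: eq_integral => y _; case: ifPn => // y01; rewrite /Psi ifF//.
    by apply: contraNF y01 => /andP[/= /andP[ty y2] _]; apply/andP; split; lra.
  rewrite -(integral_phi_real s01 mPs (fun y => Psi0 _)).
  have mPV : measurable_fun setT (fun u => Psi (s, (1 - s) * u / (s + (1 - s) * u))).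
    by apply: (measurableT_comp mPsi); apply: measurable_fun_pair; mfun.
  rewrite -(ge0_integralZl mu measurableT); first last.
  - by rewrite lee_fin hker_ge0.
  - move=> u _; case: ifP => // u0; rewrite mule_ge0// lee_fin divr_ge0 ?sqr_ge0 ?mulr_ge0//; lra.
  - by apply: measurable_RT; mfun.
  apply: le_integral_leb.
  - by apply: emeasurable_funM => //; mfun.
  - by apply: (measurableT_comp mK); apply: measurable_fun_pair; mfun.
  - move=> u; rewrite mule_ge0 ?lee_fin ?hker_ge0//; case: ifP => // u0; rewrite mule_ge0// lee_fin divr_ge0 ?sqr_ge0 ?mulr_ge0//; lra.
  move=> u; case: ifPn => u0; last by rewrite mule0.
  have /= hp := @phi_kernel_le R gm b tau s u _ s01 u0 gm0
    (G0 (1 - (1 - s) * u / (s + (1 - s) * u))) t0.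
  rewrite /Psi /mid /=; move: ((1 - s) * u / (s + (1 - s) * u)) hp => y hp.
  case: ifPn => [/andP[/andP[ty y2] /andP[tys sy]]|_]; last by rewrite mul0e mule0 K0.
  have [tu u2 sv hle] := hp y2 tys sy.
  by rewrite /K /V /= s0 s1 tu u2/= sv -!EFinM lee_fin.
apply: le_trans (leeD2r _ e2).
rewrite ell_Gr//.
(* A bound of what is lost at y: the growth bound C3 lam y^(-gm) times y^(gm-1) times the tails at
   tau / y and 2 y, with (2 y)^(1/2) <= 2 y^(1/2). *)
pose E y : \bar R := if (tau <= y) && (y <= 1 / 2) then
  (C3 * lam * C1 * (tau `^ gm * y `^ (- gm - 1) + 2 * y `^ (1 / 2 - 1)))%:E else 0%E.
have mE : measurable_fun setT E by rewrite /E; mfun.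
have E0 y : (0 <= E y)%E.
  rewrite /E; case: ifP => // _; rewrite lee_fin !mulr_ge0 ?(ltW C30) ?(ltW l0)//.
  by rewrite addr_ge0 ?mulr_ge0 ?powR_ge0.
have mI : measurable_fun setT (fun u => (if ((tau <= u) && (u <= 1 / 2))%R
  then (Gr g (1 - u) * u `^ (gm - 1))%:E else 0)%E) by mfun.
have I0 u : (0 <= (if ((tau <= u) && (u <= 1 / 2))%R
  then (Gr g (1 - u) * u `^ (gm - 1))%:E else 0))%E.
  by case: ifP; rewrite // lee_fin mulr_ge0 ?powR_ge0.
have IE : (\int[mu]_y E y <= (C3 * C1 * (gm^-1 + 4) * lam)%:E)%E.
  rewrite (_ : C3 * C1 * (gm^-1 + 4) * lam = C3 * lam * C1 * (gm^-1 + 4)); last by ring.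
  by apply: error_integral_le => //; rewrite !mulr_ge0 ?(ltW C30) ?(ltW l0).
apply: le_trans (leeD2l _ IE).
rewrite -(ge0_integralD mu measurableT _ (measurable_RT mLy) _ (measurable_RT mE))//; last first.
  by move=> y _; apply: integral_ge0.
rewrite -(ge0_integralZl mu measurableT (measurable_RT mI)) ?lee_fin ?(ltW B0)//.
apply: le_integral_leb.
- exact: emeasurable_funM.
- exact: emeasurable_funD.
- by move=> u; rewrite mule_ge0 ?lee_fin ?(ltW B0).
move=> y; rewrite /E; case: ifPn => [/andP[ty y2]|_]; last by rewrite mule0 adde0 integral_ge0.
have y0 : 0 < y := lt_le_trans t0 ty.
have ty0 : 0 < tau / y by rewrite divr_gt0.
have [yy0 yy1] : 0 < 2 * y /\ 2 * y <= 1 by split; lra.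
have Gy0 : 0 <= Gr g (1 - y) * y `^ (gm - 1) by rewrite mulr_ge0 ?powR_ge0.
have mI3 : measurable_fun setT (fun s => if ((tau / y <= s) && (s <= 1 - 2 * y))%R then hkerE gm b s else 0%E).
  by have mh := measurable_hkerE gm b; mfun.
have -> : (\int[mu]_s L (s, y) = (Gr g (1 - y) * y `^ (gm - 1))%:E *
    \int[mu]_s (if ((tau / y <= s) && (s <= 1 - 2 * y))%R then hkerE gm b s else 0))%E.
  rewrite -(ge0_integralZl mu measurableT (measurable_RT mI3)) ?lee_fin//; last first.
    by move=> s _; case: ifP; rewrite // hkerE_ge0.
  apply: eq_integral => s _; rewrite /L /Psi /mid/= ty y2/=.
  by case: ifP => _; rewrite ?mule0// muleC.
rewrite muleC; apply: (le_trans (lee_wpmul2l _ (hmid _ _ ty0 yy0 yy1))); first by rewrite lee_fin.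
rewrite ge0_muleDr ?lee_fin//; first last.
- by rewrite mulr_ge0// addr_ge0 ?powR_ge0.
- by apply: integral_ge0 => s _; case: ifP; rewrite // hkerE_ge0.
rewrite leeD2l// -EFinM lee_fin.
have q1 : (tau / y) `^ gm = tau `^ gm * y `^ (- gm).
  by rewrite powRM ?invr_ge0 ?(ltW t0) ?(ltW y0)// -powR_inv1 ?(ltW y0)// -powRrM mulN1r.
have q2 : (2 * y) `^ (1 / 2) <= 2 * y `^ (1 / 2).
  rewrite powRM ?(ltW y0)// ler_wpM2r ?powR_ge0// -[leRHS]powRr1//.
  by apply: ler_powR; lra.
have q3 r : y `^ (- gm) * y `^ (gm - 1) * y `^ r = y `^ (r - 1).
  by rewrite -!powRD ?(gt_eqF y0) ?implybT//; congr (_ `^ _); ring.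
apply: (@le_trans _ _ (C3 * lam * y `^ (- gm) * y `^ (gm - 1) * (C1 * (tau `^ gm * y `^ (- gm) + 2 * y `^ (1 / 2))))).
  apply: ler_pM => //; first by rewrite mulr_ge0// addr_ge0 ?powR_ge0.
    by rewrite ler_wpM2r ?powR_ge0// hG.
  by rewrite ler_wpM2l// q1 lerD2l.
rewrite -(q3 (- gm)) -(q3 (1 / 2)) le_eqVlt; apply/orP; left; apply/eqP; ring.
Qed.

End lower_bound_main.

(** * Sums of dyadic simple poles *)

Section test_functions.
Context {R : realType}.
Local Notation mu := (@lebesgue_measure R).
Local Notation RT := (measurableTypeR R).
Implicit Types (f g : R[i] -> R[i]) (a c : nat -> R[i]) (w : R * R).

Lemma has_power_series_add f g a c : has_power_series f a -> has_power_series g c ->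
  has_power_series (fun z => f z + g z) (fun k => a k + c k).
Proof.
move=> fa gc z z1; have := cvgC_add (fa z z1) (gc z z1).
rewrite (_ : (fun n => _) = series (fun k => (a k + c k) * z ^+ k : R[i]^o))//.
by apply/funext => n; rewrite /series/= -big_split/=; apply: eq_bigr => k _; rewrite mulrDl.
Qed.

Lemma has_power_series_sum (F : nat -> R[i] -> R[i]) (A : nat -> nat -> R[i]) J :
  (forall j, has_power_series (F j) (A j)) ->
  has_power_series (fun z => \sum_(j < J) F j z) (fun k => \sum_(j < J) A j k).
Proof.
move=> FA; elim: J => [|J IH].
  move=> z _; rewrite big_ord0; apply/cvgC_normP => e e0; apply: nearW => n.
  rewrite (_ : series _ n = 0) ?subrr ?ComplexField.Normc.normc0//.
  by rewrite /series/= big1// => k _; rewrite big_ord0 mul0r.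
rewrite (_ : (fun z => _) = (fun z => \sum_(j < J) F j z + F J z)); last first.
  by apply/funext => z; rewrite big_ord_recr.
rewrite (_ : (fun k => _) = (fun k => \sum_(j < J) A j k + A J k)); last first.
  by apply/funext => k; rewrite big_ord_recr.
exact: has_power_series_add IH (FA J).
Qed.

Lemma has_power_series_pole (d : R) : 0 < d ->
  has_power_series (fun z => ((1 + d)%:C - z)^-1) (fun k => ((1 + d)%:C)^-1 ^+ k.+1).
Proof.
move=> d0 z z1; set u : R[i] := (1 + d)%:C.
have u1 : normc u = 1 + d by rewrite normcR gtr0_norm//; lra.
have u0 : u != 0 by rewrite -normc_eq0 u1 gt_eqF//; lra.
have zu : normc (u^-1 * z) < 1.
  rewrite ComplexField.Normc.normcM ComplexField.Normc.normcV u1 mulrC ltr_pdivrMr; last lra.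
  by rewrite mul1r (lt_trans z1)//; lra.
have h := @cvgC_mull R u^-1 _ _ (@negbin_series R (u^-1 * z) 0 zu).
have eS n : u^-1 * series (fun k => 'C(k + 0, 0)%:R * (u^-1 * z) ^+ k : R[i]^o) n =
    series (fun k => u^-1 ^+ k.+1 * z ^+ k : R[i]^o) n.
  rewrite /series/= mulr_sumr; apply: eq_bigr => k _.
  by rewrite bin0 mul1r exprMn exprS mulrA.
have eL : u^-1 * (1 - u^-1 * z) ^- 1 = (u - z)^-1.
  by rewrite expr1 -invfM mulrBr mulr1 mulVKf.
apply/cvgC_normP => e e0; move/cvgC_normP/(_ _ e0) : h; apply: filterS => n.
by rewrite eS eL.
Qed.

(** 2^(-i) is comparable to r, unless r lies below the finest scale; then i = J. *)
Lemma dyadic_scale (r : R) J : r < 2 ->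
  exists2 i, (i <= J)%N & r < 2 * 2^-1 ^+ i /\ (i = J \/ 2^-1 ^+ i <= r).
Proof.
move=> r2; elim: J => [|J [i iJ [ri h]]].
  by exists 0%N => //; rewrite expr0 mulr1; split => //; left.
have [hi|hi] := leP (2^-1 ^+ i) r.
  by exists i; [exact: leqW|split => //; right].
case: h => [iE|h]; last by move: (lt_le_trans hi h); rewrite ltxx.
exists J.+1 => //; split; last by left.
by rewrite exprS mulrA divff// mul1r -iE.
Qed.

(** Before i the increasing geometric bound is governed by its last term, from i on the decreasing
    one by its first; 1/r <= 2^i makes both of order q^i. *)
Lemma geometric_mixed_le (q r : R) (T : nat -> R) J : 1 < q -> q < 2 -> 0 < r -> r < 2 ->
  (forall k, 0 <= T k) -> (forall k, T k <= 4 * q ^+ k) -> (forall k, T k <= (q / 2) ^+ k / r) ->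
  exists2 i, (i <= J)%N & r < 2 * 2^-1 ^+ i /\
   \sum_(k < J) T k <= (4 / (q - 1) + (1 - q / 2)^-1) * q ^+ i.
Proof.
move=> q1 q2 r0 r2 T0 T1 T2; have [i iJ [ri hi]] := dyadic_scale J r2.
exists i => //; split => //.
rewrite -(big_mkord xpredT T) (big_cat_nat (leq0n i) iJ)/= mulrDl; apply: lerD.
  have q10 : 0 < q - 1 by lra.
  apply: (@le_trans _ _ (\sum_(0 <= k < i) 4 * q ^+ k)); first by apply: ler_sum => k _; exact: T1.
  rewrite -mulr_sumr -mulrA ler_wpM2l// big_mkord mulrC ler_pdivlMr// mulrC -subrX1.
  by rewrite gerBl.
have q0 : 0 < 1 - q / 2 by lra.
have qi : 0 <= (1 - q / 2)^-1 * q ^+ i by rewrite mulr_ge0 ?invr_ge0 ?exprn_ge0//; lra.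
case: hi => [->|hi]; first by rewrite big_geq// mulr_ge0 ?invr_ge0 ?exprn_ge0//; lra.
have Q k : (q / 2 - 1) * \sum_(0 <= n < k) (q / 2) ^+ n = (q / 2) ^+ k - 1.
  by rewrite big_mkord subrX1.
have QS : (1 - q / 2) * \sum_(i <= k < J) (q / 2) ^+ k = (q / 2) ^+ i - (q / 2) ^+ J.
  have := Q J; rewrite (big_cat_nat (leq0n i) iJ)/= mulrDr Q.
  by move: (\sum_(i <= _ < J) _) => X; lra.
apply: (@le_trans _ _ (\sum_(i <= k < J) (q / 2) ^+ k / r)).
  by apply: ler_sum => k _; exact: T2.
rewrite -mulr_suml ler_pdivrMr// -(ler_pM2l q0) QS -!mulrA mulVKf ?gt_eqF//.
apply: (@le_trans _ _ ((q / 2) ^+ i)); first by rewrite gerBl exprn_ge0//; lra.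
by rewrite expr_div_n ler_wpM2l ?exprn_ge0 -?exprVn//; lra.
Qed.

(** For q = 2^gm, a discretization of (1-z)^(-gm): the pole at distance 2^(-j)/4 from 1 has weight
    2^(-j (1-gm)), so its term has size about 2^(j gm) where |1-z| is about 2^(-j). *)
Definition tfun (q : R) J (z : R[i]) : R[i] :=
  \sum_(j < J) ((q / 2) ^+ j)%:C * ((1 + 2^-1 ^+ j / 4)%:C - z)^-1.

Let dpos j : 0 < (2^-1 : R) ^+ j / 4.
Proof. by rewrite divr_gt0// exprn_gt0. Qed.

Lemma tfun_power_series q J : exists a, has_power_series (tfun q J) a.
Proof.
eexists; apply: (@has_power_series_sum (fun j z => ((q / 2) ^+ j)%:C * ((1 + 2^-1 ^+ j / 4)%:C - z)^-1)) => j.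
by apply: has_power_series_scale; apply: has_power_series_pole; exact: dpos.
Qed.

Lemma tfun_real q J (x : R) : 
  tfun q J x%:C = (\sum_(j < J) (q / 2) ^+ j * (1 + 2^-1 ^+ j / 4 - x)^-1)%:C.
Proof.
rewrite rmorph_sum/=; apply: eq_bigr => j _.
by rewrite rmorphM fmorphV rmorphB.
Qed.

Lemma tfun_nonneg q J : 0 <= q -> nonneg_on_radius (tfun q J).
Proof.
move=> q0 x /andP[x0 x1]; rewrite tfun_real/=; split => //; apply: sumr_ge0 => j _.
rewrite mulr_ge0 ?exprn_ge0 ?divr_ge0// invr_ge0.
by have := dpos j; lra.
Qed.

(** The distance from w to the j-th pole is at least 2^(-j)/4 and at least |1-w|; these give the two
    bounds required by [geometric_mixed_le]. *)
Lemma normc_tfun_le q J w : 1 < q -> q < 2 -> nsq w < 1 ->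
  let r := Num.sqrt (nsq (1 - w.1, w.2)) in
  exists2 i, (i <= J)%N & [/\ r < 2 * 2^-1 ^+ i, 1 - nsq w <= 2 * r &
   normc (tfun q J (cpx w)) <= (4 / (q - 1) + (1 - q / 2)^-1) * q ^+ i].
Proof.
move=> q1 q2 w1 r.
have x1 : w.1 < 1 by move: w1; rewrite /nsq; have := sqr_ge0 w.2; nra.
have xm : -1 < w.1 by move: w1; rewrite /nsq; have := sqr_ge0 w.2; nra.
have n0 : 0 < nsq (1 - w.1, w.2) by rewrite /nsq/= ltr_pwDl ?sqr_ge0// exprn_gt0//; lra.
have r0 : 0 < r by rewrite sqrtr_gt0.
have r2 : r ^+ 2 = nsq (1 - w.1, w.2) by rewrite sqr_sqrtr// ltW.
have rlt : r < 2.
  rewrite -(ltr_pXn2r (_ : 0 < 2)%N) ?nnegrE ?(ltW r0)// r2 /nsq/=.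
  by move: w1; rewrite /nsq; nra.
have rx : 1 - w.1 <= r.
  rewrite -(ler_pXn2r (_ : 0 < 2)%N) ?nnegrE ?(ltW r0)//; last lra.
  by rewrite r2 /nsq/= lerDl sqr_ge0.
have rn : 1 - nsq w <= 2 * r.
  by have := sqr_ge0 (1 - w.1); have := sqr_ge0 w.2; rewrite /nsq; nra.
pose N j := normc ((1 + 2^-1 ^+ j / 4)%:C - cpx w).
have NE j : N j ^+ 2 = (1 + 2^-1 ^+ j / 4 - w.1) ^+ 2 + w.2 ^+ 2.
  by rewrite /N sqr_normcE /cpx/= sub0r sqrrN.
have N1 j : 2^-1 ^+ j / 4 <= N j.
  rewrite -(ler_pXn2r (_ : 0 < 2)%N) ?nnegrE ?normc_ge0 ?(ltW (dpos j))// NE.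
  by have := dpos j; have := sqr_ge0 w.2; move: (_ / 4) => d; nra.
have N2 j : r <= N j.
  rewrite -(ler_pXn2r (_ : 0 < 2)%N) ?nnegrE ?normc_ge0 ?(ltW r0)// NE r2 /nsq/=.
  by have := dpos j; move: (_ / 4) => d; nra.
have N0 j : 0 < N j := lt_le_trans r0 (N2 j).
have q20 j : 0 <= (q / 2) ^+ j by rewrite exprn_ge0//; lra.
have T0 j : 0 <= (q / 2) ^+ j / N j by rewrite divr_ge0// ltW.
have T1 j : (q / 2) ^+ j / N j <= 4 * q ^+ j.
  rewrite ler_pdivrMr//; apply: (@le_trans _ _ (4 * q ^+ j * (2^-1 ^+ j / 4))).
    by rewrite exprMn; rewrite le_eqVlt; apply/orP; left; apply/eqP; field.
  by rewrite ler_wpM2l// mulr_ge0// exprn_ge0//; lra.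
have T2 j : (q / 2) ^+ j / N j <= (q / 2) ^+ j / r.
  by rewrite ler_wpM2l// lef_pV2 ?posrE.
have [i iJ [ri hs]] := geometric_mixed_le J q1 q2 r0 rlt T0 T1 T2.
exists i => //; split => //; apply: le_trans hs.
apply: (le_trans (normc_sum _ _ _)); apply: ler_sum => j _.
rewrite ComplexField.Normc.normcM ComplexField.Normc.normcV normcR ger0_norm//.
Qed.

End test_functions.

Section test_function_estimates.
Context {R : realType}.
Local Notation mu := (@lebesgue_measure R).
Local Notation RT := (measurableTypeR R).
Implicit Types (w : R * R) (p alpha gm tau q u : R).

Let half i : R := 2^-1 ^+ i.

Let half_gt0 i : 0 < half i. Proof. by rewrite exprn_gt0. Qed.

Let halfE i : half i = 2 `^ (- i%:R).
Proof. by rewrite powRN powR_mulrn// /half exprVn. Qed.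

Let q_range gm : 0 < gm -> gm <= 1 / 2 -> 1 < 2 `^ gm :> R /\ 2 `^ gm < 2 :> R.
Proof.
have h r : 0 < r -> 1 < 2 `^ r :> R.
  move=> r0; rewrite [ltLHS](_ : 1 = 1 `^ r); last by rewrite powR1.
  by apply: gt0_ltr_powR; rewrite ?nnegrE//; lra.
move=> g0 g2; split; first exact: h.
have e : 2 = 2 `^ gm * 2 `^ (1 - gm) :> R.
  by rewrite -powRD ?pnatr_eq0 ?implybT// addrC subrK powRr1.
rewrite [ltRHS]e ltr_pMr ?powR_gt0//; apply: h; lra.
Qed.

(** Where |1-z| is about 2^(-i), the integrand is at most a constant times 2^(i gm p) 2^(-i alpha) =
    4^i, on a region of area of order 4^(-i): each of the J+1 scales contributes the same amount. *)
Lemma Iw_tfun_le p alpha : 0 <= alpha -> 2 * (alpha + 2) <= p ->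
  exists2 K, 1 <= K & forall J,
    (Iw p alpha (tfun (2 `^ ((alpha + 2) / p)) J) <= (K * J.+1%:R)%:E)%E.
Proof.
move=> al0 pal; set gm := (alpha + 2) / p.
have p0 : 0 < p by lra.
have gmp : gm * p = alpha + 2 by rewrite /gm divfK//; lra.
have gm0 : 0 < gm by rewrite divr_gt0//; lra.
have gm2 : gm <= 1 / 2 by rewrite /gm ler_pdivrMr; lra.
have [q1 q2] := q_range gm0 gm2; set q := 2 `^ gm in q1 q2 *.
pose C := 4 / (q - 1) + (1 - q / 2)^-1.
have C0 : 0 <= C by rewrite addr_ge0 ?divr_ge0 ?invr_ge0//; lra.
pose K0 := C `^ p * 4 `^ alpha.
have K00 : 0 <= K0 by rewrite mulr_ge0 ?powR_ge0.
exists (K0 * 16 + 1) => [|J]; first by rewrite lerDr mulr_ge0.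
(* Squares centred at 1 of area 16 / 4^i. They overlap, but each point of the disk is charged to a
   single one. *)
pose ind i w : \bar R := if (1 - 2 * half i < w.1) && (w.1 < 1 + 2 * half i) &&
  ((- (2 * half i) < w.2) && (w.2 < 2 * half i)) then 1%E else 0%E.
have mi i : measurable_fun setT (ind i) by rewrite /ind; mfun.
have i0 i w : (0 <= ind i w)%E by rewrite /ind; case: ifP.
have k0 i : 0 <= K0 * 4 ^+ i by rewrite mulr_ge0 ?exprn_ge0.
have [a ga] := tfun_power_series q J.
apply: (@le_trans _ _ (\int[leb2]_w \sum_(i < J.+1) (K0 * 4 ^+ i)%:E * ind i w)%E); last first.
  rewrite (ge0_integral_sum leb2 measurableT (fun i : 'I_J.+1 =>
    measurable_RT2 (emeasurable_funM (measurable_cst (K0 * 4 ^+ i)%:E) (mi i)))); last first.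
    by move=> i w _; rewrite mule_ge0 ?lee_fin.
  rewrite (eq_bigr (fun=> (K0 * 16)%:E)) => [|i _]; last first.
    rewrite (ge0_integralZl leb2 measurableT (measurable_RT2 (mi i))) ?lee_fin//.
    have h0 := half_gt0 i.
    rewrite leb2_rect; [|lra|lra].
    rewrite -EFinM; congr EFin.
    have -> : (1 + 2 * half i - (1 - 2 * half i)) * (2 * half i - - (2 * half i)) = 16 * (half i ^+ 2) by ring.
    have -> : half i ^+ 2 = (4 ^+ i)^-1.
      by rewrite /half -exprM mulnC exprM -exprVn; congr (_ ^+ _); field.
    have : (4 : R) ^+ i != 0 by rewrite expf_neq0.
    by move: (4 ^+ i) => t tn; field.
  by rewrite sumEFin sumr_const card_ord lee_fin -[leLHS]mulr_natr ler_wpM2r// lerDl ler01.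
apply: le_integral_leb2.
- exact: measurable_Iw ga.
- by apply: emeasurable_sum => i; apply: emeasurable_funM.
- by move=> w; case: ifP; rewrite // lee_fin mulr_ge0 ?powR_ge0.
move=> w; case: ifPn => w1; last by apply: sume_ge0 => i _; rewrite mule_ge0 ?lee_fin.
have [i iJ [ri rn hs]] := normc_tfun_le J q1 q2 w1; rewrite -/C in hs.
set r := Num.sqrt _ in ri rn.
have r0 : 0 <= r by rewrite sqrtr_ge0.
have r2 : r ^+ 2 = (1 - w.1) ^+ 2 + w.2 ^+ 2 by rewrite sqr_sqrtr ?nsq_ge0.
have iJ' : (i < J.+1)%N by [].
rewrite (bigD1 (Ordinal iJ'))//=.
rewrite -[leLHS]adde0; apply: leeD; last by apply: sume_ge0 => j _; rewrite mule_ge0 ?lee_fin.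
have -> : ind i w = 1%E.
  have h0 := half_gt0 i; rewrite -/(half i) in ri; rewrite /ind ifT//.
  have r4 : r ^+ 2 < (2 * half i) ^+ 2 by rewrite ltr_pXn2r// nnegrE; lra.
  have := sqr_ge0 w.2; have := sqr_ge0 (1 - w.1).
  by move=> *; apply/andP; split; apply/andP; split; nra.
rewrite mule1 lee_fin.
apply: (@le_trans _ _ ((C * q ^+ i) `^ p * (4 * half i) `^ alpha)).
  have n1 : 0 <= 1 - nsq w by rewrite subr_ge0 ltW.
  have qi : 0 <= q ^+ i by rewrite exprn_ge0//; lra.
  have := half_gt0 i; rewrite -/(half i) in ri => h0.
  apply: ler_pM; rewrite ?powR_ge0//.
    by apply: ge0_ler_powR; rewrite ?nnegrE ?normc_ge0 ?mulr_ge0 ?(ltW p0).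
  by apply: ge0_ler_powR; rewrite ?nnegrE ?mulr_ge0 ?(ltW h0)//; lra.
have qi : 0 <= q ^+ i by rewrite exprn_ge0//; lra.
rewrite !powRM ?(ltW (half_gt0 i))// mulrACA -/K0 ler_wpM2l//.
rewrite halfE /q -powR_mulrn ?powR_ge0// -!powRrM -powRD ?pnatr_eq0 ?implybT//.
rewrite [X in _ `^ X <= _](_ : _ = 2 * i%:R); last first.
  by transitivity (gm * p * i%:R - i%:R * alpha); [ring|rewrite gmp; ring].
have e4 : (2 : R) `^ 2 = 4 by rewrite (powR_mulrn 2 (ler0n _ 2)); ring.
by rewrite powRrM e4 powR_mulrn.
Qed.

(** The i-th summand is kept only on ]d_i, 2 d_i[ with d_i = 2^(-i)/4. There its denominator d_i + u
    is below 3 d_i and (q/2)^i u^(gm-1) >= 1, so each window contributes 1/3. *)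
Lemma ell_tfun_ge gm J : 0 < gm -> gm <= 1 / 2 ->
  exists2 tau : R, 0 < tau & ((J%:R / 3)%:E <= ell gm tau (tfun (2 `^ gm) J))%E.
Proof.
move=> gm0 gm2; have [q1 q2] := q_range gm0 gm2; set q := 2 `^ gm in q1 q2 *.
pose d i := half i / 4; have d0 i : 0 < d i by rewrite divr_gt0.
exists (d J) => //.
pose ind i u : \bar R := if (d i < u) && (u < 2 * d i) then 1%E else 0%E.
have mi i : measurable_fun setT (ind i) by rewrite /ind; mfun.
have i0 i u : (0 <= ind i u)%E by rewrite /ind; case: ifP.
pose c i := (3 * d i)^-1.
have c0 i : 0 <= c i by rewrite invr_ge0 mulr_ge0// ltW.
have [a ga] := tfun_power_series q J.
have mG : measurable_fun setT (fun u => Gr (tfun q J) (1 - u)).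
  by apply: (measurableT_comp (measurable_Gr ga)); mfun.
have -> : (J%:R / 3)%:E = (\int[mu]_u \sum_(i < J) (c i)%:E * ind i u)%E.
  rewrite (ge0_integral_sum mu measurableT (fun i : 'I_J =>
    measurable_RT (emeasurable_funM (measurable_cst (c i)%:E) (mi i)))); last first.
    by move=> i u _; rewrite mule_ge0 ?lee_fin.
  rewrite (eq_bigr (fun=> (3^-1)%:E)) => [|i _].
    by rewrite sumEFin sumr_const card_ord -(mulr_natl (3^-1) J).
  rewrite (ge0_integralZl mu measurableT (measurable_RT (mi i))) ?lee_fin//.
  have di := d0 i; rewrite integral_ltr_itv; last lra.
  by rewrite -EFinM; congr EFin; rewrite /c; field; rewrite gt_eqF.
rewrite ell_Gr//; apply: le_integral_leb.
- by apply: emeasurable_sum => i; apply: emeasurable_funM.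
- by mfun.
- by move=> u; apply: sume_ge0 => i _; rewrite mule_ge0 ?lee_fin.
have dJ i : (i < J)%N -> d J <= d i.
  move=> iJ; rewrite ler_wpM2r//; apply: ler_wiXn2l; [lra|lra|exact: ltnW].
have d4 i : 2 * d i <= half i / 2 /\ half i <= 1.
  split; first by rewrite /d; lra.
  by apply: exprn_ile1; lra.
move=> u; case: ifPn => [/andP[tu u2]|hu]; last first.
  rewrite big1// => i _; rewrite /ind ifF ?mule0//; apply: contraNF hu => /andP[u1 u3].
  have [h1 h2] := d4 i; have := dJ i (ltn_ord i).
  by move=> h3; apply/andP; split; lra.
have u0 : 0 < u := lt_le_trans (d0 J) tu.
have x01 : (0 <= 1 - u) && (1 - u < 1) by apply/andP; split; lra.
rewrite /Gr x01 tfun_real/= mulr_suml -sumEFin; apply: lee_sum => i _.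
have v0 : 0 < 1 + 2^-1 ^+ i / 4 - (1 - u) by have := d0 i; rewrite /d /half; lra.
have q0 : 0 <= (q / 2) ^+ i by rewrite exprn_ge0//; lra.
rewrite /ind; case: ifPn => [/andP[u1 u3]|_]; last first.
  by rewrite mule0 lee_fin !mulr_ge0 ?powR_ge0 ?invr_ge0 ?(ltW v0).
rewrite mule1 lee_fin mulrAC.
have h1 : 1 <= (q / 2) ^+ i * u `^ (gm - 1).
  have [h1 h2] := d4 i.
  have e : (q / 2) ^+ i * (half i) `^ (gm - 1) = 1.
    rewrite halfE /q expr_div_n -powR_mulrn ?powR_ge0// -!powRrM -[_^-1]mul1r.
    rewrite -[2 ^+ i]powR_mulrn// -powRN mul1r -!powRD ?pnatr_eq0 ?implybT//.
    rewrite (_ : _ + _ = 0) ?powRr0//; ring.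
  rewrite -[leLHS]e ler_wpM2l// -[gm - 1]opprB !powRN lef_pV2 ?posrE ?powR_gt0//.
  by apply: ge0_ler_powR; rewrite ?nnegrE ?(ltW u0) ?(ltW (half_gt0 i))//; lra.
rewrite -[leLHS]mul1r; apply: ler_pM => //.
rewrite /c lef_pV2 ?posrE//; last by rewrite mulr_gt0.
by move: u3; rewrite /d /half; lra.
Qed.

End test_function_estimates.

(** * The lower bound for the operator norm *)

Section operator_norm.
Context {R : realType}.
Local Notation mu := (@lebesgue_measure R).
Local Notation RT := (measurableTypeR R).
Implicit Types (f g : R[i] -> R[i]) (a c : nat -> R[i]) (k u x tau gm b p alpha : R).

Lemma ell_scale gm tau k g c : has_power_series g c -> 0 < tau -> 0 <= k -> nonneg_on_radius g ->
  ell gm tau (fun z => k%:C * g z) = (k%:E * ell gm tau g)%E.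
Proof.
move=> gc t0 k0 gn.
have mG : measurable_fun setT (fun u => Gr g (1 - u)).
  by apply: (measurableT_comp (measurable_Gr gc)); mfun.
rewrite (ell_Gr _ g t0) -(ge0_integralZl mu measurableT); first last.
- by rewrite lee_fin.
- by move=> u _; case: ifP; rewrite // lee_fin mulr_ge0 ?powR_ge0 ?Gr_ge0.
- by apply: measurable_RT; mfun.
apply: eq_integral => u _; case: ifPn => [/andP[tu u2]|_]; last by rewrite mule0.
rewrite /Gr ifT; last by apply/andP; split; lra.
rewrite -EFinM mulrA; congr (_ * _)%:E.
by case: (g _) => gr gi /=; rewrite mul0r subr0.
Qed.

Lemma nonneg_on_radius_scale k g : 0 <= k -> nonneg_on_radius g ->
  nonneg_on_radius (fun z => k%:C * g z).
Proof.
move=> k0 gn x /gn[]; case: (g _) => gr gi /= -> gr0.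
by rewrite !mul0r mulr0 addr0 subr0 mulr_ge0.
Qed.

Lemma ell_ge0 gm tau g : 0 < tau -> nonneg_on_radius g -> (0 <= ell gm tau g)%E.
Proof.
move=> t0 gn; rewrite ell_Gr//; apply: integral_ge0 => u _.
by case: ifP; rewrite // lee_fin mulr_ge0 ?powR_ge0 ?Gr_ge0.
Qed.

(** The bound blows up as tau tends to 0. Its purpose is to make the supremum of [ell] finite, so
    that it can be subtracted when B and Lam are compared. *)
Lemma ell_bounded p alpha (lam tau : R) : 0 <= alpha -> 2 * (alpha + 2) <= p -> 0 < lam -> 0 < tau ->
  exists D : R, forall g c, has_power_series g c -> nonneg_on_radius g ->
    (Iw p alpha g <= (lam `^ p)%:E)%E -> (ell ((alpha + 2) / p) tau g <= D%:E)%E.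
Proof.
move=> al0 pal l0 t0; have [C C0 hC] := growth al0 pal; set gm := (alpha + 2) / p in hC *.
exists (C * lam / tau * (1 - 0)) => g c gc gn Ig.
have mG : measurable_fun setT (fun u => Gr g (1 - u)).
  by apply: (measurableT_comp (measurable_Gr gc)); mfun.
have m1 : measurable_fun setT (fun s : R => if ((0 < s) && (s < 1))%R then 1 else 0 : \bar R)%E by mfun.
have k0 : 0 <= C * lam / tau by rewrite divr_ge0 ?mulr_ge0 ?ltW.
rewrite ell_Gr// EFinM -(integral_ltr_itv ler01).
rewrite -(ge0_integralZl mu measurableT (measurable_RT m1)) ?lee_fin//; last first.
  by move=> s _; case: ifP.
apply: le_integral_leb.
- by mfun.
- by apply: emeasurable_funM.
- by move=> u; case: ifP; rewrite // lee_fin mulr_ge0 ?powR_ge0 ?Gr_ge0.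
move=> u; case: ifPn => [/andP[tu u2]|_]; last by rewrite mule_ge0 ?lee_fin//; case: ifP.
have u0 : 0 < u := lt_le_trans t0 tu.
rewrite u0 /= ifT; last lra.
rewrite mule1 lee_fin /Gr ifT; last by apply/andP; split; lra.
have hu := hC g c lam gc l0 Ig u u0 u2.
apply: (@le_trans _ _ (C * lam * u `^ (- gm) * u `^ (gm - 1))).
  by rewrite ler_wpM2r ?powR_ge0// (le_trans _ hu)// (le_trans (ler_norm _))// ler_normc_Re.
rewrite -mulrA -powRD ?(gt_eqF u0) ?implybT// (_ : - gm + (gm - 1) = -1); last by ring.
rewrite powR_inv1 ?(ltW u0)//; apply: ler_wpM2l; first by rewrite mulr_ge0 ?ltW.
by rewrite lef_pV2 ?posrE.
Qed.

Lemma opnorm_lower_bound b alpha p (Lam : R) : 0 <= b -> 0 <= alpha -> 2 * (alpha + 2) <= p ->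
  0 < Lam -> (forall f, bergman p alpha f -> (bergman_norm p alpha f <= 1)%E ->
    (bergman_norm p alpha (hilbert_op b f) <= Lam%:E)%E) ->
  Beta ((alpha + 2) / p) (b + 1 - (alpha + 2) / p) <= Lam.
Proof.
move=> b0 al0 pal L0 hL; set gm := (alpha + 2) / p.
have p0 : 0 < p by lra.
have pn : p != 0 by rewrite gt_eqF.
have gm0 : 0 < gm by rewrite divr_gt0//; lra.
have gm2 : gm <= 1 / 2 by rewrite /gm ler_pdivrMr; lra.
have [B0 _] := integral_hker b0 gm2 gm0; have [C C0 hC] := hilbert_lower b0 al0 pal.
rewrite -/gm in hC; set B := Beta _ _ in B0 hC *.
rewrite leNgt; apply/negP => LB.
have cc0 := ccst_gt0 al0; set cc := ccst alpha in cc0.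
(* With this value, Iw <= lam^p describes the unit ball. *)
pose lam := cc^-1 `^ p^-1.
have l0 : 0 < lam by rewrite powR_gt0// invr_gt0.
have lp : lam `^ p = cc^-1 by rewrite /lam -powRrM mulVf// powRr1// invr_ge0 ltW.
pose S g := [/\ analytic_on_disk g, nonneg_on_radius g & (Iw p alpha g <= (lam `^ p)%:E)%E].
have Slt g : S g -> (Iw p alpha g < +oo)%E by case=> _ _ h; exact: le_lt_trans h (ltry _).
have step g tau : S g -> 0 < tau -> exists g', S g' /\
    (B%:E * ell gm tau g <= Lam%:E * ell gm tau g' + (C * lam)%:E)%E.
  move=> Sg t0; have [gan gn Ig] := Sg; have Il := Slt g Sg.
  have [_ hp _] := hilbert_opP b0 al0 pal gan Il.
  have Li : 0 <= Lam^-1 by rewrite invr_ge0 ltW.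
  have hn := hilbert_op_nonneg b0 al0 pal gan Il gn.
  have IH : (Iw p alpha (hilbert_op b g) <= (cc^-1 * Lam `^ p)%:E)%E.
    apply: (@bergman_norm_le R p alpha _ _ al0 p0 (ltW L0)).1; apply: hL.
      by split => //; exact: (@bergman_norm_lty R p alpha _ al0 p0).2.
    by apply: (@bergman_norm_le R p alpha _ _ al0 p0 ler01).2; rewrite powR1 mulr1 -lp.
  exists (fun z => (Lam^-1)%:C * hilbert_op b g z); split.
    split.
    - by exists (fun n => (Lam^-1)%:C * hilbert_coef b g n); exact: has_power_series_scale.
    - exact: nonneg_on_radius_scale.
    rewrite (Iw_scale _ _ _ hp) normcR ger0_norm//.
    apply: (le_trans (lee_wpmul2l _ IH)); first by rewrite lee_fin powR_ge0.
    rewrite -EFinM lee_fin mulrCA -powRM ?(ltW L0)// mulVf ?gt_eqF// powR1 mulr1 lp//.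
  rewrite (ell_scale _ hp t0 Li hn) muleA -EFinM divff ?gt_eqF// mul1e.
  exact: hC.
have Sbound g tau : S g -> 0 < tau -> (ell gm tau g <= (C * lam / (B - Lam))%:E)%E.
  move=> Sg t0; have [D hD] := ell_bounded al0 pal l0 t0.
  have hD' g' : S g' -> (ell gm tau g' <= D%:E)%E.
    by move=> [[a ga] gn Ig]; exact: hD ga gn Ig.
  pose A := [set ell gm tau g' | g' in S].
  have Ag : A (ell gm tau g) by exists g.
  have sD : (ereal_sup A <= D%:E)%E by apply: ge_ereal_sup => _ [g' Sg' <-]; exact: hD'.
  have s0 : (0 <= ereal_sup A)%E.
    apply: le_trans (ereal_sup_ubound Ag); have [_ gn _] := Sg; exact: ell_ge0.
  have sE : ereal_sup A = (fine (ereal_sup A))%:E.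
    by rewrite fineK// ge0_fin_numE//; exact: le_lt_trans sD (ltry _).
  set l := fine (ereal_sup A) in sE.
  (* With l the supremum this reads B l <= Lam l + C lam; solved for l, it gives a bound without
     tau. *)
  have hl : (ereal_sup A <= ((Lam * l + C * lam) / B)%:E)%E.
    apply: ge_ereal_sup => _ [g' Sg' <-]; have [g2 [Sg2 h]] := step g' tau Sg' t0.
    have h2 : (ell gm tau g2 <= l%:E)%E by rewrite -sE; apply: ereal_sup_ubound; exists g2.
    have e' : ell gm tau g' = (fine (ell gm tau g'))%:E.
      have [_ gn _] := Sg'.
      by rewrite fineK// ge0_fin_numE ?ell_ge0//; exact: le_lt_trans (hD' _ Sg') (ltry _).
    have h3 : (Lam%:E * ell gm tau g2 <= (Lam * l)%:E)%E.
      by rewrite EFinM lee_wpmul2l// lee_fin ltW.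
    have := le_trans h (leeD2r _ h3).
    by rewrite e' -EFinM -EFinD !lee_fin ler_pdivlMr// mulrC.
  apply: (le_trans (ereal_sup_ubound Ag)); rewrite sE lee_fin ler_pdivlMr ?subr_gt0//.
  by move: hl; rewrite sE lee_fin ler_pdivlMr//; lra.
have [K K1 hK] := Iw_tfun_le al0 pal; rewrite -/gm in hK.
pose Z := C * lam / (B - Lam).
have Jbound J : lam * (J%:R / 3) <= Z * (K * J.+1%:R) `^ p^-1.
  have KJ : 0 < K * J.+1%:R by rewrite mulr_gt0//; lra.
  pose m := (K * J.+1%:R) `^ p^-1; have m0 : 0 < m by rewrite powR_gt0.
  have mp : m `^ p = K * J.+1%:R by rewrite /m -powRrM mulVf// powRr1// ltW.
  have [tau t0 ht] := ell_tfun_ge J gm0 gm2.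
  have [a ga] := tfun_power_series (2 `^ gm) J.
  have gn := @tfun_nonneg R (2 `^ gm) J (powR_ge0 _ _).
  have k0 : 0 <= lam / m by rewrite divr_ge0 ?ltW.
  have Sg : S (fun z => (lam / m)%:C * tfun (2 `^ gm) J z).
    split.
    - by exists (fun n => (lam / m)%:C * a n); exact: has_power_series_scale.
    - exact: nonneg_on_radius_scale.
    rewrite (Iw_scale _ _ _ ga) normcR ger0_norm//.
    apply: (le_trans (lee_wpmul2l _ (hK J))); first by rewrite lee_fin powR_ge0.
    by rewrite -EFinM lee_fin -mp -powRM ?(ltW m0)// divfK ?gt_eqF.
  have := Sbound _ tau Sg t0; rewrite (ell_scale _ ga t0 k0 gn) => h.
  have : ((lam / m)%:E * (J%:R / 3)%:E <= Z%:E)%E.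
    by apply: le_trans h; rewrite lee_wpmul2l// lee_fin.
  by rewrite -EFinM lee_fin mulrAC ler_pdivrMr.
have Z0 : 0 <= Z by rewrite divr_ge0 ?mulr_ge0 ?(ltW l0)// subr_ge0 ltW.
(* Since p >= 2, the exponent 1/p may be replaced by 1/2. Squaring then leaves a quadratic in J
   below a linear term; 18 is 9 times the 2 from J + 2 <= 2 (J + 1). *)
have Jb2 J : lam ^+ 2 * (J.+1%:R) <= 18 * Z ^+ 2 * K.
  have KJ : 1 <= K * J.+2%:R by rewrite -[leLHS]mulr1; apply: ler_pM => //; rewrite ler1n.
  have h1 : (K * J.+2%:R) `^ p^-1 <= (K * J.+2%:R) `^ (1 / 2).
    by apply: ler_powR => //; rewrite div1r lef_pV2 ?posrE//; lra.
  have h2 := le_trans (Jbound J.+1) (ler_wpM2l Z0 h1).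
  have h3 : (lam * (J.+1%:R / 3)) ^+ 2 <= (Z * (K * J.+2%:R) `^ (1 / 2)) ^+ 2.
    have hl0 : 0 <= lam * (J.+1%:R / 3) by apply: mulr_ge0; [exact: ltW|exact: divr_ge0].
    have hr0 : 0 <= Z * (K * J.+2%:R) `^ (1 / 2) by apply: mulr_ge0 => //; exact: powR_ge0.
    by rewrite ler_sqr ?nnegrE.
  have K0 : 0 <= K * J.+2%:R := le_trans ler01 KJ.
  rewrite [leLHS]exprMn [leRHS]exprMn div1r (powR12_sqrt K0) (sqr_sqrtr K0) in h3.
  have J1 : 1 <= (J.+1%:R : R) by rewrite ler1n.
  move: h3; rewrite -[J.+2%:R]natr1; move: (J.+1%:R : R) J1 => y y1.
  have ZK : 0 <= Z ^+ 2 * K by rewrite mulr_ge0 ?sqr_ge0//; lra.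
  rewrite [leRHS]mulrA => h3.
  have {h3} : lam ^+ 2 * (y / 3) ^+ 2 <= Z ^+ 2 * K * (2 * y).
    by apply: (le_trans h3); rewrite ler_wpM2l//; lra.
  rewrite (_ : lam ^+ 2 * (y / 3) ^+ 2 = lam ^+ 2 * y / 9 * y); last by field.
  rewrite [X in _ <= X](_ : _ = Z ^+ 2 * K * 2 * y); last by ring.
  have yy : 0 < y by lra.
  by rewrite (ler_pM2r yy); move: (lam ^+ 2 * y) (Z ^+ 2) => u v h; lra.
pose J := Num.truncn (18 * Z ^+ 2 * K / lam ^+ 2).
have := Jb2 J; rewrite mulrC -ler_pdivlMr ?exprn_gt0// leNgt => /negP; apply.
by apply: real_truncnS_gt; exact: num_real.
Qed.

End operator_norm.

Theorem corollary3p1 (R : realType) (b alpha p : R)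
    (hb : 0 <= b) (halpha : 0 <= alpha) (hp : 1 < p)
    (hpalpha : 2 * (alpha + 2) <= p) :
  (forall f : R[i] -> R[i], bergman p alpha f ->
     hilbert_op_well_defined b f /\ bergman p alpha (hilbert_op b f)) /\
  bergman_opnorm p alpha (hilbert_op b) =
    (Beta ((alpha + 2) / p) (b + 1 - (alpha + 2) / p))%:E.
Proof.
have p0 : 0 < p by lra.
have gm0 : 0 < (alpha + 2) / p by rewrite divr_gt0//; lra.
have gm2 : (alpha + 2) / p <= 1 / 2 by rewrite ler_pdivrMr; lra.
have [B0 _] := integral_hker hb gm2 gm0.
have cc0 := ccst_gt0 halpha.
split=> [f [fan /(@bergman_norm_lty R p alpha f halpha p0).1 If]|].
  have [wd hps _] := hilbert_opP hb halpha hpalpha fan If.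
  split; [exact: wd|split; first by exists (hilbert_coef b f)].
  apply: (@bergman_norm_lty R p alpha _ halpha p0).2.
  apply: le_lt_trans (Iw_hilbert_op_le hb halpha hpalpha fan If) _.
  have := Iw_ge0 p alpha f; move: If; case: (Iw p alpha f) => // x _ _.
  by rewrite -EFinM ltry.
have up : (bergman_opnorm p alpha (hilbert_op b) <= (Beta ((alpha + 2) / p) (b + 1 - (alpha + 2) / p))%:E)%E.
  apply: ge_ereal_sup => _ [f [[fan /(@bergman_norm_lty R p alpha f halpha p0).1 If] f1] <-].
  apply: (@bergman_norm_le R p alpha _ _ halpha p0 (ltW B0)).2.
  apply: le_trans (Iw_hilbert_op_le hb halpha hpalpha fan If) _.
  move/(@bergman_norm_le R p alpha _ _ halpha p0 ler01).1 : f1; rewrite powR1 mulr1 => f1.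
  apply: (le_trans (lee_wpmul2l _ f1)); first by rewrite lee_fin powR_ge0.
  by rewrite -EFinM mulrC.
apply/eqP; rewrite eq_le up/= leNgt; apply/negP => lo.
set B := Beta _ _ in B0 up lo.
(* The rescaling by 1 / Lam needs Lam > 0, whence the maximum with B / 2. The norm is a supremum of
   extended reals, so the value -oo is also treated. *)
have [Lam [L0 LB hLam]] : exists Lam : R, [/\ 0 < Lam, Lam < B & (bergman_opnorm p alpha (hilbert_op b) <= Lam%:E)%E].
  move: lo; case: (bergman_opnorm _ _ _) => [l| |] // lB.
    exists (Num.max l (B / 2)); split.
    - by rewrite lt_max divr_gt0// orbT.
    - by rewrite gt_max -lte_fin lB ltr_pdivrMr//; lra.
    - by rewrite lee_fin le_max lexx.
  by exists (B / 2); split; [rewrite divr_gt0|lra|exact: leNye].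
move: LB; rewrite ltNge => /negP; apply.
apply: opnorm_lower_bound hb halpha hpalpha L0 _ => f fb f1.
by apply: le_trans hLam; apply: ereal_sup_ubound; exists f.
Qed.
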